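(* Let $N\in\mathbb{N}$, let $\Lambda\subset\mathcal{F}_N$ be a nonempty admissible set, let $\mathcal{Y}$ be a Hilbert space, and let $\{c_w\}_{w\in\Lambda}\subset\mathcal{L}(\mathcal{Y})$ be a collection of operators with $c_\emptyset=I_{\mathcal{Y}}$. Then there exists $f\in\mathcal{HA}_N^{\rm nc}(\mathcal{Y})$ such that $$f_\emptyset=\frac{c_\emptyset}{2}=\frac{I_{\mathcal{Y}}}{2},\qquad f_w=c_w\quad\text{for all }w\in\Lambda\setminus\{\emptyset\},$$ if and only if there exist a Hilbert space $\mathcal{H}$, an $N$-tuple of operators $\mathbf{G}\in\mathcal{G}_N\cap\mathcal{L}(\mathcal{H})^N$, and an isometry $V\in\mathcal{L}(\mathcal{Y},\mathcal{H})$ such that $$c_w=V^*\mathbf{G}^wV,\qquad w\in\Lambda .$$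
   Context: All Hilbert spaces are complex and separable. $\mathcal{L}(\mathcal{Y},\mathcal{H})$ denotes the bounded linear operators from $\mathcal{Y}$ to $\mathcal{H}$, and $\mathcal{L}(\mathcal{Y})=\mathcal{L}(\mathcal{Y},\mathcal{Y})$. For a bounded operator $A$, $\operatorname{Re}A=\frac12(A+A^* )$, and $A\ge0$ means positive semidefinite. $\mathcal{F}_N$ is the free semigroup (monoid of words) with generators $g_1,\dots,g_N$ and neutral element the empty word $\emptyset$; $|w|$ is the length of $w$. A finite set $\Lambda\subset\mathcal{F}_N$ is called admissible if for every $w\in\mathcal{F}_N\setminus\Lambda$ and $k=1,\dots,N$ one has $g_kw\in\mathcal{F}_N\setminus\Lambda$ and $wg_k\in\mathcal{F}_N\setminus\Lambda$. (A nonempty admissible set contains $\emptyset$.) A formal power series in non-commuting indeterminates $z=(z_1,\dots,z_N)$ with coefficients $f_w\in\mathcal{L}(\mathcal{Y})$ is $f(z)=\sum_{w\in\mathcal{F}_N}f_wz^w$, where $z^w=z_{i_1}\cdots z_{i_m}$ for $w=g_{i_1}\cdots g_{i_m}$ and $z^\emptyset=1$. For $\mathbf{C}=(C_1,\dots,C_N)\in\mathcal{L}(\mathcal{E})^N$ put $\mathbf{C}^w=C_{i_1}\cdots C_{i_m}$, $\mathbf{C}^\emptyset=I_{\mathcal{E}}$, and $f(\mathbf{C})=\sum_{w\in\mathcal{F}_N}f_w\otimes\mathbf{C}^w\in\mathcal{L}(\mathcal{Y}\otimes\mathcal{E})$, where convergence in operator norm is understood for the sum by homogeneous degree, $\sum_{m=0}^\infty\big(\sum_{|w|=m}f_w\otimes\mathbf{C}^w\big)$.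 The non-commutative Herglotz--Agler class $\mathcal{HA}_N^{\rm nc}(\mathcal{Y})$ consists of all formal power series $f$ with coefficients in $\mathcal{L}(\mathcal{Y})$ such that for every Hilbert space $\mathcal{E}$ and every $\mathbf{C}\in\mathcal{L}(\mathcal{E})^N$ with $\|C_k\|<1$, $k=1,\dots,N$, the series $f(\mathbf{C})$ converges in the operator norm and $\operatorname{Re}f(\mathbf{C})\ge0$. $\mathcal{G}_N$ is the class of $N$-tuples $\mathbf{G}=(G_1,\dots,G_N)$ of bounded linear operators on a common Hilbert space such that $\zeta\mathbf{G}:=\sum_{k=1}^N\zeta_kG_k$ is unitary for every $\zeta=(\zeta_1,\dots,\zeta_N)\in\mathbb{T}^N$ ($\mathbb{T}$ the unit circle). *)

(* Defs.v *)
From HB Require Import structures.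
From mathcomp Require Import all_boot all_order all_algebra.
From mathcomp Require Import sesquilinear complex.
From mathcomp Require Import all_classical all_reals all_analysis.

Set Implicit Arguments.
Unset Strict Implicit.
Unset Printing Implicit Defensive.

Import Order.TTheory GRing.Theory Num.Theory.
Import numFieldNormedType.Exports.

Local Open Scope classical_set_scope.
Local Open Scope ring_scope.
Local Open Scope complex_scope.

(* R[i] with its numFieldType structure, named directly so that no cast gets in
   the way of unification in the structures below. *)
Local Notation C R := (ComplexField.complex_complex__canonical__Num_NumField R).

(* As in every normedModType over R[i], norms are R[i]-valued. *)
HB.mixin Record CompleteNormedModule_isHilbert (R : realType) H
    & CompleteNormedModule (C R) H := {
  inner : H -> H -> R[i];
  inner_linear : forall z : H, linear_for *%R (inner^~ z);
  inner_conj : forall x y : H, inner x y = Num.conj (inner y x);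
  normr_inner : forall x : H, `|x| ^+ 2 = inner x x;
  separable_hilbert : exists2 D : set H, countable D & dense D
}.

#[short(type="hilbertType")]
HB.structure Definition Hilbert (R : realType) :=
  {H of CompleteNormedModule (C R) H & CompleteNormedModule_isHilbert R H}.

Section InnerIsDot.
Context {R : realType} (H : hilbertType R).

Lemma inner_bilinear :
  bilinear_for *%R (Num.conj \; *%R) (@inner R H).
Proof.
split=> z a x y; first exact: inner_linear.
by rewrite /= inner_conj inner_linear rmorphD rmorphM (inner_conj z x) (inner_conj z y).
Qed.

HB.instance Definition _ :=
  bilinear_isBilinear.Build _ _ _ _ _ _ (@inner R H) inner_bilinear.

Lemma inner_hermitian (x y : H) :
  inner x y = (-1) ^+ false * Num.conj (inner y x).
Proof. by rewrite expr0 mul1r -inner_conj. Qed.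

HB.instance Definition _ :=
  isHermitianSesquilinear.Build _ _ _ _ (@inner R H) inner_hermitian.

Lemma inner_gt0 (x : H) : x != 0 -> 0 < inner x x.
Proof. by move=> x0; rewrite -normr_inner exprn_gt0// normr_gt0. Qed.

HB.instance Definition _ := isDotProduct.Build _ _ (@inner R H) inner_gt0.

End InnerIsDot.

Section BoundedOperators.
Context {R : realType}.

Definition bounded_linear (H K : hilbertType R) : {pred (H -> K)} :=
  fun A => `[< linear A /\ exists M : R[i], forall x, `|A x| <= M * `|x| >].

Lemma bounded_linear_submod (H K : hilbertType R) :
  submod_closed (@bounded_linear H K).
Proof.
split.
  apply/asboolP; split; first by move=> a x y /=; rewrite scaler0 addr0.
  by exists 0 => x; rewrite mul0r normr0.
move=> a A B /asboolP[lA [M bA]] /asboolP[lB [M' bB]]; apply/asboolP; split.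
  move=> b x y; rewrite !fctE lA lB !scalerDr !scalerA addrACA.
  by rewrite (mulrC b).
exists (`|a| * M + M') => x; rewrite !fctE (le_trans (ler_normD _ _))//.
by rewrite mulrDl lerD// normrZ -mulrA ler_wpM2l.
Qed.

HB.instance Definition _ (H K : hilbertType R) :=
  GRing.isSubmodClosed.Build _ _ (@bounded_linear H K)
    (bounded_linear_submod H K).

Record operator (H K : hilbertType R) : Type := Operator {
  operator_fun :> H -> K;
  operatorP : operator_fun \in @bounded_linear H K }.

HB.instance Definition _ (H K : hilbertType R) :=
  [isSub of operator H K for @operator_fun H K].
HB.instance Definition _ (H K : hilbertType R) :=
  [Choice of operator H K by <:].
HB.instance Definition _ (H K : hilbertType R) :=
  [SubChoice_isSubLmodule of operator H K by <:].

Lemma operator_linear (H K : hilbertType R) (A : operator H K) : linear A.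
Proof. by have /asboolP[] := operatorP A. Qed.

HB.instance Definition _ (H K : hilbertType R) (A : operator H K) :=
  GRing.isLinear.Build _ _ _ _ (operator_fun A) (@operator_linear H K A).

Lemma idop_subproof (H : hilbertType R) : idfun \in @bounded_linear H H.
Proof. by apply/asboolP; split=> //; exists 1 => x; rewrite mul1r. Qed.

Definition idop (H : hilbertType R) : operator H H :=
  Operator (idop_subproof H).

Lemma compop_subproof (H K L : hilbertType R)
  (B : operator K L) (A : operator H K) : B \o A \in @bounded_linear H L.
Proof.
have /asboolP[lA [M bA]] := operatorP A.
have /asboolP[lB [M' bB]] := operatorP B.
apply/asboolP; split; first by move=> a x y /=; rewrite lA lB.
exists (`|M'| * M) => x /=; rewrite (le_trans (bB _))//.
have [->|Ax0] := eqVneq (A x) 0.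
  rewrite normr0 mulr0 -mulrA mulr_ge0//.
  by rewrite (le_trans _ (bA x)).
have M'0 : 0 <= M'.
  have Ax : 0 < `|A x| by rewrite normr_gt0.
  by rewrite -(pmulr_lge0 _ Ax) (le_trans _ (bB (A x))).
by rewrite ger0_norm// -mulrA ler_wpM2l.
Qed.

Definition compop (H K L : hilbertType R)
    (B : operator K L) (A : operator H K) : operator H L :=
  Operator (compop_subproof B A).

Definition opnorm (H K : hilbertType R) (A : operator H K) : R :=
  sup [set complex.Re `|A x| | x in [set x : H | `|x| <= 1]].

(* Such a B exists (Riesz) and is unique, so the default value 0 is never
   used. *)
Definition adjoint (H K : hilbertType R) (A : operator H K) : operator K H :=
  xget 0 [set B : operator K H | forall x y, inner (A x) y = inner x (B y)].

Definition psdop (H : hilbertType R) (A : operator H H) : Prop :=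
  forall x, 0 <= inner (A x) x.

Definition reop (H : hilbertType R) (A : operator H H) : operator H H :=
  2^-1 *: (A + adjoint A).

Definition unitaryop (H : hilbertType R) (U : operator H H) : Prop :=
  compop (adjoint U) U = idop H /\ compop U (adjoint U) = idop H.

Definition isometryop (H K : hilbertType R) (V : operator H K) : Prop :=
  forall x, `|V x| = `|x|.

End BoundedOperators.

Section HilbertTensor.
Context {R : realType}.

(* The Hilbert space tensor product of Y and E, which exists and is determined
   up to a unique unitary commuting with the elementary tensors. *)
Record hilbert_tensor (Y E : hilbertType R) := HilbertTensor {
  tensor_space :> hilbertType R;
  tensor : {bilinear Y -> E -> tensor_space};
  inner_tensor : forall (y y' : Y) (e e' : E),
    inner (tensor y e) (tensor y' e') = inner y y' * inner e e';
  dense_tensor : dense [set x : tensor_space |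
    exists (n : nat) (y : 'I_n -> Y) (e : 'I_n -> E),
      x = \sum_(i < n) tensor (y i) (e i)] }.

(* Again D exists and is unique, by boundedness on the span of the elementary
   tensors. *)
Definition tensorop (Y E : hilbertType R) (T : hilbert_tensor Y E)
    (A : operator Y Y) (B : operator E E) : operator T T :=
  xget 0 [set D : operator T T |
    forall y e, D (tensor T y e) = tensor T (A y) (B e)].

End HilbertTensor.

Section HerglotzAgler.
Context {R : realType} {N : nat}.

Definition word := seq 'I_N.

Definition admissible (L : set word) : Prop :=
  finite_set L /\
  forall w, ~ L w -> forall k, ~ L (k :: w) /\ ~ L (rcons w k).

Definition opword (H : hilbertType R) (C : 'I_N -> operator H H) (w : word) :
    operator H H :=
  foldr (fun k A => compop (C k) A) (idop H) w.

Definition homogeneous_part (Y E : hilbertType R) (T : hilbert_tensor Y E)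
    (f : word -> operator Y Y) (C : 'I_N -> operator E E) (m : nat) :
    operator T T :=
  \sum_(w : m.-tuple 'I_N) tensorop T (f w) (opword C w).

Definition converges_to (Y E : hilbertType R) (T : hilbert_tensor Y E)
    (f : word -> operator Y Y) (C : 'I_N -> operator E E) (S : operator T T) :
    Prop :=
  (fun n => opnorm (\sum_(0 <= m < n) homogeneous_part T f C m - S))
    @ \oo --> (0 : R).

Definition herglotz_agler (Y : hilbertType R) (f : word -> operator Y Y) :
    Prop :=
  forall (E : hilbertType R) (C : 'I_N -> operator E E),
    (forall k, opnorm (C k) < 1) ->
  forall T : hilbert_tensor Y E,
    exists S : operator T T, converges_to f C S /\ psdop (reop S).

Definition unitary_pencil (H : hilbertType R) (G : 'I_N -> operator H H) :
    Prop :=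
  forall zeta : 'I_N -> R[i], (forall k, `|zeta k| = 1) ->
    unitaryop (\sum_(k < N) zeta k *: G k).

End HerglotzAgler.

Arguments word : clear implicits.

(* Main.v *)
From HB Require Import structures.
Require Import Defs.
From mathcomp Require Import all_boot all_order all_algebra.
From mathcomp Require Import complex ring lra.
From mathcomp Require Import all_classical all_reals all_analysis.

(* If zeta G is unitary for every zeta in the torus, the G_k have mutually
   orthogonal ranges and initial spaces, so that |sum_k G_k (x) C_k| < 1 as soon
   as all |C_k| < 1; hence 1/2 + sum_(w <> 1) V^* G^w V z^w is a compression of
   -1/2 + (1 - sum_k G_k (x) C_k)^-1, which has nonnegative real part.

   Conversely, for f in the class, f(z) + f(w)^* has an Agler decomposition
   sum_k (K_k(z, w) - z_k K_k(z, w) conj(w_k)) with positive semidefinite K_k on the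
   words of Lambda.  On the first n vectors of a dense sequence of Y this holds
   up to 1/n: a functional separating f(z) + f(w)^* from the cone of such
   expressions is an inner product for which the shifts w |-> w g_k are
   contractions S_k, and evaluating f at C_k = r S_k^* with r -> 1 contradicts
   the separation.  The diagonals of the K_k are bounded by induction on words,
   so an ultrafilter limit n -> oo gives an exact decomposition.  With vectors
   g_k(w) such that <g_k(v), g_k(w)> = K_k(v, w), and h = sum_k g_k an orthogonal
   sum, the decomposition says that g_k(w) |-> h(w g_k) is isometric; if U is a
   unitary extension of it and P_k are projections with P_k h = g_k and
   sum_k P_k = 1, then G_k = P_k U^* and V y = h(1) y solve the problem. *)

Set Implicit Arguments.
Unset Strict Implicit.
Unset Printing Implicit Defensive.

Import Order.TTheory GRing.Theory Num.Theory.
Import numFieldNormedType.Exports.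

Local Open Scope classical_set_scope.
Local Open Scope ring_scope.
Local Open Scope complex_scope.

(** Two obstacles shape the converse. The coefficients of f outside Lambda are unknown, yet f has to
    be evaluated at operators: the kernel of the separating functional vanishes off the finite grid,
    so <f(C) x, x> sees only f_w with w in Lambda. That the functional is an inner product at all
    comes from iterating a shift until the support leaves the grid. Separation reaches only the
    closure of the cone, hence the error 1/n. A partial isometry need not extend to a unitary on the
    same space, since its defect spaces may differ in dimension; it is extended by 0 and dilated to
    sequences, where its defect operators are projections and no square roots are needed. Operator
    bounds are handled as kernels: |A| <= M says that M^2 <x, y> - <A x, A y> is positive
    semidefinite, and Schur products of such kernels replace norm estimates on tensor products. *)

Section Complex.
Context {R : realType}.
Implicit Types x y : R[i].

Lemma cReD x y : complex.Re (x + y) = complex.Re x + complex.Re y.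
Proof. by case: x; case: y. Qed.

Lemma cReN x : complex.Re (- x) = - complex.Re x.
Proof. by case: x. Qed.

Lemma cReMl (a : R) x : complex.Re (a%:C * x) = a * complex.Re x.
Proof. by case: x => b c /=; rewrite mul0r subr0. Qed.

Lemma cRe_sum I (r : seq I) (P : pred I) (F : I -> R[i]) :
  complex.Re (\sum_(i <- r | P i) F i) = \sum_(i <- r | P i) complex.Re (F i).
Proof. by apply: (big_morph _ cReD). Qed.

Lemma cRe_conj x : complex.Re (Num.conj x) = complex.Re x.
Proof. by case: x. Qed.

Lemma cIm_conj x : complex.Im (Num.conj x) = - complex.Im x.
Proof. by case: x. Qed.

Lemma conj_RC (a : R) : Num.conj (a%:C) = a%:C.
Proof. by apply/eqP; rewrite eq_complex /= oppr0 !eqxx. Qed.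

Lemma RReE x : 0 <= x -> x = (complex.Re x)%:C.
Proof. by move=> x0; rewrite RRe_real// ger0_real. Qed.

Lemma ge0_Re x : 0 <= x -> 0 <= complex.Re x.
Proof. by rewrite lecE/= => /andP[]. Qed.

Lemma Re_norm_le x : `|complex.Re x| <= complex.Re `|x|.
Proof. by rewrite -lecR (le_trans (normc_ge_Re x))// -RReE. Qed.

Lemma norm_Re x : `|x| = (complex.Re `|x|)%:C.
Proof. exact: RReE. Qed.

End Complex.

(** * Inner products, norms and convergence *)

Section InnerTheory.
Context {R : realType} {H : hilbertType R}.
Implicit Types x y z : H.

Lemma innerDl x y z : inner (x + y) z = inner x z + inner y z.
Proof. by have := inner_linear z 1 x y; rewrite scale1r mul1r. Qed.

Lemma inner0l z : inner 0 z = 0.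
Proof. by apply: (addrI (inner 0 z)); rewrite -innerDl !addr0. Qed.

Lemma innerZl a x z : inner (a *: x) z = a * inner x z.
Proof. by have := inner_linear z a x 0; rewrite addr0 inner0l addr0. Qed.

Lemma innerNl x z : inner (- x) z = - inner x z.
Proof. by rewrite -scaleN1r innerZl mulN1r. Qed.

Lemma innerBl x y z : inner (x - y) z = inner x z - inner y z.
Proof. by rewrite innerDl innerNl. Qed.

Lemma innerDr x y z : inner x (y + z) = inner x y + inner x z.
Proof.
by rewrite inner_conj innerDl rmorphD (inner_conj x y) (inner_conj x z).
Qed.

Lemma inner0r z : inner z 0 = 0.
Proof. by rewrite inner_conj inner0l conjC0. Qed.

Lemma innerZr a x z : inner x (a *: z) = Num.conj a * inner x z.
Proof. by rewrite inner_conj innerZl rmorphM (inner_conj x z). Qed.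

Lemma innerNr x z : inner x (- z) = - inner x z.
Proof. by rewrite -scaleN1r innerZr rmorphN rmorph1 mulN1r. Qed.

Lemma innerBr x y z : inner x (y - z) = inner x y - inner x z.
Proof. by rewrite innerDr innerNr. Qed.

Lemma inner_suml I (r : seq I) (P : pred I) (F : I -> H) z :
  inner (\sum_(i <- r | P i) F i) z = \sum_(i <- r | P i) inner (F i) z.
Proof.
apply: (big_morph (fun x => inner x z)) => [x y|]; first exact: innerDl.
exact: inner0l.
Qed.

Lemma inner_sumr I (r : seq I) (P : pred I) (F : I -> H) z :
  inner z (\sum_(i <- r | P i) F i) = \sum_(i <- r | P i) inner z (F i).
Proof.
apply: (big_morph (inner z)) => [x y|]; first exact: innerDr.
exact: inner0r.
Qed.

(** Norms and inner products are [R[i]]-valued; these real counterparts make estimates accessible to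
    [lra] and [nra]. [inner_rinE] recovers the complex inner product from [rin]. *)
Definition rin x y : R := complex.Re (inner x y).
Definition nrm x : R := complex.Re `|x|.

Lemma normE x : `|x| = (nrm x)%:C.
Proof. exact: RReE. Qed.

Lemma nrm_ge0 x : 0 <= nrm x.
Proof. exact: ge0_Re. Qed.
Hint Resolve nrm_ge0 : core.

Lemma nrm0 : nrm 0 = 0.
Proof. by rewrite /nrm normr0. Qed.

Lemma nrm0_eq0 x : nrm x = 0 -> x = 0.
Proof. by move=> x0; apply/eqP; rewrite -normr_eq0 normE x0. Qed.

Lemma nrmN x : nrm (- x) = nrm x.
Proof. by rewrite /nrm normrN. Qed.

Lemma nrmBC x y : nrm (x - y) = nrm (y - x).
Proof. by rewrite -nrmN opprB. Qed.

Lemma nrmD x y : nrm (x + y) <= nrm x + nrm y.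
Proof. by rewrite -lecR rmorphD/= -!normE ler_normD. Qed.

Lemma nrmB x y z : nrm (x - z) <= nrm (x - y) + nrm (y - z).
Proof. by rewrite (le_trans _ (nrmD _ _))// addrA subrK. Qed.

Lemma nrmZ a x : nrm (a *: x) = complex.Re `|a| * nrm x.
Proof. by apply: complexI; rewrite rmorphM/= -normE normrZ -norm_Re -normE. Qed.

Lemma nrmZr (a : R) x : nrm (a%:C *: x) = `|a| * nrm x.
Proof. by rewrite nrmZ normc_def/= expr0n/= addr0 sqrtr_sqr. Qed.

Lemma innerxx x : inner x x = (nrm x ^+ 2)%:C.
Proof. by rewrite -normr_inner normE -rmorphXn. Qed.

Lemma rinxx x : rin x x = nrm x ^+ 2.
Proof. by rewrite /rin innerxx. Qed.

Lemma rinC x y : rin x y = rin y x.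
Proof. by rewrite /rin inner_conj cRe_conj. Qed.

Lemma rinDl x y z : rin (x + y) z = rin x z + rin y z.
Proof. by rewrite /rin innerDl cReD. Qed.

Lemma rinDr x y z : rin x (y + z) = rin x y + rin x z.
Proof. by rewrite /rin innerDr cReD. Qed.

Lemma rinNl x z : rin (- x) z = - rin x z.
Proof. by rewrite /rin innerNl cReN. Qed.

Lemma rinNr x z : rin x (- z) = - rin x z.
Proof. by rewrite /rin innerNr cReN. Qed.

Lemma rinZl (a : R) x z : rin (a%:C *: x) z = a * rin x z.
Proof. by rewrite /rin innerZl cReMl. Qed.

Lemma rinZr (a : R) x z : rin x (a%:C *: z) = a * rin x z.
Proof. by rewrite rinC rinZl rinC. Qed.

Lemma rin0l x : rin 0 x = 0.
Proof. by rewrite /rin inner0l. Qed.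

Lemma rin0r x : rin x 0 = 0.
Proof. by rewrite /rin inner0r. Qed.

Lemma nrmD_sqr x y : nrm (x + y) ^+ 2 = nrm x ^+ 2 + 2 * rin x y + nrm y ^+ 2.
Proof. by rewrite -!rinxx !rinDl !rinDr (rinC y x); ring. Qed.

Lemma nrmB_sqr x y : nrm (x - y) ^+ 2 = nrm x ^+ 2 - 2 * rin x y + nrm y ^+ 2.
Proof. by rewrite nrmD_sqr nrmN rinNr; ring. Qed.

Lemma inner_rinE x y : inner x y = rin x y +i* rin x ('i *: y).
Proof.
rewrite /rin innerZr; case: (inner x y) => a b /=.
by congr (_ +i* _); rewrite mul0r add0r mulN1r opprK.
Qed.

Lemma inner_extl x y : (forall z, inner x z = inner y z) -> x = y.
Proof.
move=> xy; apply/eqP; rewrite -subr_eq0; apply/eqP/nrm0_eq0.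
have /eqP := innerxx (x - y); rewrite innerBl xy subrr => /eqP/esym.
by move/(congr1 (@complex.Re _))/eqP; rewrite /= sqrf_eq0 => /eqP.
Qed.

Lemma rin_le x y : `|rin x y| <= nrm x * nrm y.
Proof.
have key u v : rin u v <= nrm u * nrm v.
  have [v0|v0] := eqVneq (nrm v) 0.
    by rewrite (nrm0_eq0 v0) rin0r nrm0 mulr0.
  have [u0|u0] := eqVneq (nrm u) 0.
    by rewrite (nrm0_eq0 u0) rin0l nrm0 mul0r.
  have vp : 0 < nrm v by rewrite lt_neqAle eq_sym v0 nrm_ge0.
  have up : 0 < nrm u by rewrite lt_neqAle eq_sym u0 nrm_ge0.
  have := sqr_ge0 (nrm ((nrm v)%:C *: u - (nrm u)%:C *: v)).
  rewrite nrmB_sqr rinZl rinZr !nrmZr !ger0_norm// !exprMn => h.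
  have uv : 0 < nrm u * nrm v by apply: mulr_gt0.
  rewrite -(ler_pM2l uv); move: h; lra.
by rewrite ler_norml key andbT lerNl -rinNl -[nrm x]nrmN key.
Qed.

Lemma inner_le x y : complex.Re `|inner x y| <= nrm x * nrm y.
Proof.
have [->|i0] := eqVneq (inner x y) 0; first by rewrite normr0/= mulr_ge0.
(* Multiplying [x] by the unimodular [s] turns the inner product into its modulus and reduces the
   claim to [rin_le]. *)
pose s := Num.conj (inner x y) / `|inner x y|.
have s1 : `|s| = 1.
  by rewrite normrM norm_conjC normfV normr_id divff// normr_eq0.
have : complex.Re (inner (s *: x) y) <= nrm (s *: x) * nrm y.
  by rewrite (le_trans _ (rin_le _ _))// ler_norm.
rewrite nrmZ s1 mul1r innerZl; apply: le_trans.
rewrite /s mulrAC -[_ * inner x y]mulrC -normCK expr2 -mulrA.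
by rewrite divff ?normr_eq0// mulr1.
Qed.

End InnerTheory.

#[export] Hint Extern 0 (is_true (0 <= nrm _)) => solve [apply: nrm_ge0] : core.

Section Convergence.
Context {R : realType} {H : hilbertType R}.

Definition hcvg (u : nat -> H) (l : H) :=
  forall e : R, 0 < e -> exists M, forall n, (M <= n)%N -> nrm (u n - l) < e.

Definition hcauchy (u : nat -> H) :=
  forall e : R, 0 < e ->
  exists M, forall m n, (M <= m)%N -> (M <= n)%N -> nrm (u m - u n) < e.

Lemma gtC0 (e : R[i]) : 0 < e -> e = (complex.Re e)%:C /\ 0 < complex.Re e.
Proof.
move=> e0; have ee := RReE (ltW e0); split=> //.
by rewrite ee ltcR in e0.
Qed.

Lemma hcvg_cvg (u : nat -> H) l : hcvg u l <-> u @ \oo --> l.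
Proof.
split=> ul.
  apply/cvgrPdist_lt => e /gtC0[-> e0]; have [M Mu] := ul _ e0.
  by exists M => // n /= Mn; rewrite normE ltcR nrmBC; apply: Mu.
move=> e e0; have /cvgrPdist_lt/(_ e%:C) := ul.
rewrite (ltcR 0) => /(_ e0)[M _ Mu]; exists M => n Mn.
by have := Mu _ Mn; rewrite /= normE ltcR nrmBC.
Qed.

Lemma hcomplete (u : nat -> H) : hcauchy u -> exists l, hcvg u l.
Proof.
move=> cu; suff /cvg_ex[l ul] : cvg (u @ \oo) by exists l; apply/hcvg_cvg.
apply/cauchy_cvgP/cauchyP => e /gtC0[-> e0].
have [M Mu] := cu _ e0; exists (u M); exists M => // n Mn.
by rewrite -ball_normE/= normE ltcR; exact: Mu.
Qed.

Lemma hdenseP (D : set H) :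
  dense D <-> forall x (e : R), 0 < e -> exists2 d, D d & nrm (x - d) < e.
Proof.
split=> [dD x e e0|dD O [x Ox] oO].
  have [|d [xd Dd]] := dD (ball x e%:C) _ (ball_open _ _).
    by exists x; apply: ballxx; rewrite (ltcR 0).
  by exists d => //; move: xd; rewrite -ball_normE/= normE ltcR.
have [e /= /gtC0[ee e0] eO] : nbhs_ball x O by apply/nbhs_ballP; exact:
  open_nbhs_nbhs.
have [d Dd xd] := dD x _ e0; exists d; split=> //.
by apply: eO; rewrite -ball_normE/= normE ee ltcR.
Qed.

Lemma separable_seq : exists d : nat -> H,
  forall x (e : R), 0 < e -> exists n, nrm (x - d n) < e.
Proof.
have [D cD /hdenseP dD] := @separable_hilbert _ H.
have [f fP] : exists f : nat -> H, D `<=` range f.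
  have /pfcard_geP[->|[f]] := cD; first by exists (fun=> 0).
  by exists f => y Dy; have [n _ <-] := 'surj_f Dy; exists n.
exists f => x e e0; have [d Dd xd] := dD x e e0.
by have [n _ nd] := fP _ Dd; exists n; rewrite nd.
Qed.

End Convergence.

Lemma ler_eps {R : realType} (a b c : R) :
  (forall e, 0 < e -> a <= b + c * e) -> a <= b.
Proof.
move=> h; apply/ler_addgt0Pr => e e0.
have c1 : 0 < `|c| + 1 by rewrite ltr_wpDl.
apply: (le_trans (h (e / (`|c| + 1)) _)); first exact: divr_gt0.
rewrite lerD2l mulrA ler_pdivrMr// mulrC ler_wpM2l//; first exact: ltW.
by rewrite (le_trans (ler_norm c))// lerDl.
Qed.

Lemma archi_inv {R : realType} (e : R) : 0 < e ->
  exists M, forall n, (M <= n)%N -> n.+1%:R^-1 < e.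
Proof.
move=> e0; have [M _ Mn] := near_infty_natSinv_lt (PosNum e0).
by exists M => n /Mn.
Qed.

(** * Projections and bounded operators *)

Section Geometry.
Context {R : realType} {H : hilbertType R}.

Lemma nrm_lt_sqr (x : H) (e : R) : 0 < e -> nrm x ^+ 2 < e ^+ 2 -> nrm x < e.
Proof. by move=> /ltW e0; rewrite ltr_sqr ?nnegrE ?nrm_ge0. Qed.

Lemma nrm_le_sqr (x : H) (e : R) : 0 <= e -> nrm x ^+ 2 <= e ^+ 2 -> nrm x <= e.
Proof. by move=> e0; rewrite ler_sqr ?nnegrE ?nrm_ge0. Qed.

Lemma nrm_comb (a : R[i]) (x y : H) (e : R) : 0 < e ->
  nrm x < e / 2 / (complex.Re `|a| + 1) -> nrm y < e / 2 ->
  nrm (a *: x + y) < e.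
Proof.
move=> e0; have a0 : 0 <= complex.Re `|a| by rewrite ge0_Re.
rewrite ltr_pdivlMr ?ltr_wpDl// => xe ye.
rewrite (le_lt_trans (nrmD _ _))// nrmZ.
have := nrm_ge0 x; move: xe ye a0; nra.
Qed.

Definition adh (C : set H) (p : H) :=
  forall e : R, 0 < e -> exists2 c, C c & nrm (p - c) < e.

Lemma sub_adh C c : C c -> adh C c.
Proof. by move=> Cc e e0; exists c => //; rewrite subrr nrm0. Qed.

(* By the parallelogram law a minimizing sequence is Cauchy. *)
Lemma nearest_point (C : set H) (x : H) : C !=set0 ->
  (forall a b, C a -> C b -> C ((2^-1)%:C *: (a + b))) ->
  exists2 p, adh C p & forall c, adh C c -> nrm (x - p) <= nrm (x - c).
Proof.
move=> [c0 Cc0] cvxC.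
pose D := [set nrm (x - c) ^+ 2 | c in C].
have hD : has_inf D.
  split; first by exists (nrm (x - c0) ^+ 2), c0.
  by exists 0 => _ [c _ <-]; exact: sqr_ge0.
pose d := inf D.
have dle c : C c -> d <= nrm (x - c) ^+ 2.
  by move=> Cc; apply: ge_inf; [case: hD|exists c].
have /choice[u uP] (n : nat) :
    exists c, C c /\ nrm (x - c) ^+ 2 < d + n.+1%:R^-1.
  have n0 : 0 < n.+1%:R^-1 :> R by rewrite invr_gt0.
  by have [_ [c Cc <-] cd] := inf_adherent n0 hD; exists c.
have uu n m : nrm (u n - u m) ^+ 2 <= 2 * (n.+1%:R^-1 + m.+1%:R^-1).
  have [Cn n1] := uP n; have [Cm m1] := uP m.
  have := dle _ (cvxC _ _ Cn Cm).
  have -> : x - (2^-1)%:C *: (u n + u m) =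
            (2^-1)%:C *: ((x - u n) + (x - u m)).
    have xE : x = (2^-1)%:C *: (x + x).
      rewrite -[x in RHS]scale1r -scalerDl scalerA -[RHS]scale1r scalerA.
      rewrite -(rmorph1 (real_complex R)) -!rmorphD -!rmorphM/=.
      by rewrite mul1r (_ : _ * _ = 1) ?scale1r//; field.
    by rewrite [in LHS]xE -scalerBr opprD addrACA.
  rewrite nrmZr exprMn (nrmD_sqr (x - u n)).
  have -> : u n - u m = (x - u m) - (x - u n) by rewrite opprB [RHS]addrC addrA
    subrK.
  rewrite (nrmB_sqr (x - u m) (x - u n)) (rinC (x - u m) (x - u n)) => h.
  have e2 : `|2^-1 : R| ^+ 2 = 4^-1 by rewrite ger0_norm ?invr_ge0// expr2; field.
  move: h n1 m1; rewrite e2; move: (n.+1%:R^-1) (m.+1%:R^-1) => a b; lra.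
have [|p up] := @hcomplete _ _ u.
  move=> e e0.
  have e4 : 0 < e ^+ 2 / 4 by rewrite divr_gt0// exprn_gt0.
  have [M Mn] := archi_inv e4; exists M => m n /Mn m4 /Mn n4.
  apply: nrm_lt_sqr => //; apply: (le_lt_trans (uu _ _)).
  by move: m4 n4; move: (m.+1%:R^-1) (n.+1%:R^-1) => a b; lra.
exists p.
  move=> e e0; have [M Mu] := up e e0; exists (u M); first by case: (uP M).
  by rewrite nrmBC; exact: Mu.
have h1 : nrm (x - p) ^+ 2 <= d.
  apply: (@ler_eps _ _ _ (3 + 2 * nrm (x - p))) => e e0.
  pose e1 := Num.min e 1.
  have e10 : 0 < e1 by rewrite lt_min e0 ltr01.
  have e11 : e1 <= 1 by rewrite ge_min lexx orbT.
  have e1e : e1 <= e by rewrite ge_min lexx.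
  have [M Mu] := up _ e10; have [M' M'n] := archi_inv e10.
  pose n := maxn M M'.
  have h := M'n n (leq_maxr _ _); have h' := Mu n (leq_maxl _ _).
  have [_ h''] := uP n.
  have := nrmB x (u n) p; have := nrmB x p (u n).
  rewrite (nrmBC p (u n)).
  have := nrm_ge0 (x - p); have := nrm_ge0 (x - u n); have := nrm_ge0 (u n - p).
  move: h h' h''; move: (n.+1%:R^-1) => a; nra.
move=> c adc.
apply: (@ler_eps _ _ _ 1) => e e0; have [c' Cc' cc'] := adc e e0.
have := le_trans h1 (dle _ Cc').
rewrite ler_sqr ?nnegrE ?nrm_ge0// => h; apply: (le_trans h).
by rewrite mul1r (le_trans (nrmB x c c'))// lerD2l ltW.
Qed.

(** First-order condition at a nearest point. Only t in (0, 1] is available, because a point of a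
    cone can be moved towards 0 by a factor 1 - t only for such t. *)
Lemma variation (v w : H) :
  (forall t : R, 0 < t -> t <= 1 -> nrm v <= nrm (v - t%:C *: w)) ->
  rin v w <= 0.
Proof.
move=> h; rewrite leNgt; apply/negP => vw.
pose W := nrm w ^+ 2 + rin v w.
have W0 : 0 < W by rewrite ltr_wpDl// sqr_ge0.
(* The minimizer <v, w> / |w|^2 may exceed 1; the extra <v, w> in the denominator keeps t <= 1. *)
pose t := rin v w / W.
have t0 : 0 < t by apply: divr_gt0.
have t1 : t <= 1 by rewrite ler_pdivrMr// mul1r lerDr sqr_ge0.
have := h t t0 t1.
move=> k0; have k : nrm v ^+ 2 <= nrm (v - t%:C *: w) ^+ 2.
  by rewrite ler_sqr ?nnegrE ?nrm_ge0.
rewrite nrmB_sqr rinZr nrmZr (ger0_norm (ltW t0)) exprMn in k.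
have tW : t * W = rin v w by rewrite /t divfK// gt_eqF.
have : 2 * rin v w <= t * nrm w ^+ 2.
  rewrite -(ler_pM2l t0); move: k; rewrite (expr2 t); move: (nrm w ^+ 2) => W' k.
  nra.
have : t * nrm w ^+ 2 <= rin v w by rewrite -tW ler_pM2l// lerDl ltW.
move: vw; lra.
Qed.

Definition subspace (S : set H) :=
  S 0 /\ forall a x y, S x -> S y -> S (a *: x + y).

Lemma adh_subspace S : subspace S -> subspace (adh S).
Proof.
move=> [S0 SD]; split; first exact: sub_adh.
move=> a x y ax ay e e0.
have a1 : 0 < complex.Re `|a| + 1 by rewrite ltr_wpDl// ge0_Re.
have e' : 0 < e / 2 / (complex.Re `|a| + 1) by rewrite !divr_gt0.
have [x' Sx' xx'] := ax _ e'; have e2 : 0 < e / 2 by rewrite divr_gt0.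
have [y' Sy' yy'] := ay _ e2.
exists (a *: x' + y'); first exact: SD.
by rewrite opprD addrACA -scalerBr nrm_comb.
Qed.

Lemma orth_adh S z : (forall s, S s -> inner z s = 0) ->
  forall s, adh S s -> inner z s = 0.
Proof.
move=> zS s sS; apply/eqP; rewrite -normr_eq0 norm_Re; apply/eqP.
congr (_%:C); apply/eqP; rewrite eq_le ge0_Re// andbT.
apply: (@ler_eps _ _ _ (nrm z)) => e e0; rewrite add0r.
have [s' Ss' ss'] := sS e e0.
have -> : inner z s = inner z (s - s') by rewrite innerBr (zS s')// subr0.
by rewrite (le_trans (inner_le _ _))// ler_wpM2l ?nrm_ge0// ltW.
Qed.

Lemma projection S x : subspace S ->
  exists2 p, adh S p & forall s, S s -> inner (x - p) s = 0.
Proof.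
move=> sS; have [S0 SD] := sS.
have [|a b Sa Sb|p Sp pm] := @nearest_point S x.
- by exists 0.
- by rewrite -[_ *: _]addr0; apply: (SD) => //; rewrite -[a]scale1r; apply: SD.
exists p => //; have [aS0 aSD] := adh_subspace sS.
have key s : S s -> rin (x - p) s <= 0.
  move=> Ss; apply: variation => t _ _.
  have -> : x - p - t%:C *: s = x - (t%:C *: s + p) by rewrite opprD [- _ -
    p]addrC addrA.
  by apply: pm; apply: aSD => //; exact: sub_adh.
have key0 s : S s -> rin (x - p) s = 0.
  move=> Ss; apply/eqP; rewrite eq_le key//= -oppr_le0 -rinNr; apply: key.
  by rewrite -[- s]addr0 -scaleN1r; exact: SD.
move=> s Ss; rewrite inner_rinE !key0//.
by rewrite -[_ *: s]addr0; exact: SD.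
Qed.

Lemma pythagoras_le S x p : subspace S -> adh S p ->
  (forall s, S s -> inner (x - p) s = 0) -> nrm p <= nrm x.
Proof.
move=> sS Sp xp; apply: nrm_le_sqr => //.
rewrite -[in leRHS](subrK p x).
by rewrite nrmD_sqr /rin (orth_adh xp Sp) mulr0 addr0 lerDr sqr_ge0.
Qed.

Lemma riesz (f : H -> R[i]) (M : R) : (forall a x y, f (a *: x + y) = a * f x + f
  y) ->
  (forall x, complex.Re `|f x| <= M * nrm x) ->
  exists v, forall x, f x = inner x v.
Proof.
move=> fD fM.
have [f0|/existsNP[x1 /eqP fx1]] := pselect (forall x, f x = 0).
  by exists 0 => x; rewrite f0 inner0r.
have f00 : f 0 = 0.
  by apply: (addrI (f 0)); have := fD 1 0 0; rewrite scale1r !addr0 mul1r.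
have fZ a x : f (a *: x) = a * f x by rewrite -[_ *: x]addr0 fD f00 addr0.
pose S := [set x | f x = 0].
have sS : subspace S by split=> [|a x y]; [exact: f00|rewrite /S/= => fx fy;
  rewrite fD fx fy mulr0 addr0].
pose x0 := (f x1)^-1 *: x1.
have fx0 : f x0 = 1 by rewrite fZ mulVf.
have [p Sp xp] := projection x0 sS.
(* [p] lies only in the closure of the kernel of [f]; boundedness carries f = 0 over to it. *)
have fp : f p = 0.
  apply/eqP; rewrite -normr_eq0 norm_Re; apply/eqP; congr (_%:C).
  apply/eqP; rewrite eq_le ge0_Re// andbT.
  apply: (@ler_eps _ _ _ `|M|) => e e0; rewrite add0r.
  have [s /= Ss ps] := Sp e e0.
  have -> : f p = f (p - s) by rewrite addrC -scaleN1r fD Ss mulr0 add0r.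
  rewrite (le_trans (fM _))// (le_trans (ler_wpM2r (nrm_ge0 _) (ler_norm M)))//.
  by rewrite ler_wpM2l// ltW.
pose z := x0 - p.
have fz : f z = 1 by rewrite /z addrC -scaleN1r fD fp mulr0 add0r fx0.
have z0 : inner z z != 0.
  rewrite innerxx; apply/negP => /eqP/complexI/eqP; rewrite sqrf_eq0 =>
    /eqP/nrm0_eq0 zz.
  by move: fz; rewrite zz f00 => /eqP; rewrite eq_sym oner_eq0.
exists ((inner z z)^-1 *: z) => x; rewrite innerZr.
have : inner z (x - f x *: z) = 0.
  by apply: xp; rewrite /S/= addrC -scaleNr fD fz mulr1 addNr.
rewrite innerBr innerZr => /eqP; rewrite subr_eq0 => /eqP xz.
have -> : inner x z = f x * inner z z.
  by rewrite inner_conj xz rmorphM/= conjCK -(inner_conj z z).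
rewrite fmorphV/= -(inner_conj z z) mulrCA mulVf ?mulr1//.
Qed.

End Geometry.

Section Operators.
Context {R : realType}.

Lemma bounded_linear_op (H K : hilbertType R) (f : H -> K) (M : R) :
  (forall a x y, f (a *: x + y) = a *: f x + f y) ->
  (forall x, nrm (f x) <= M * nrm x) ->
  exists A : operator H K, forall x, A x = f x.
Proof.
move=> fD fM; suff fP : f \in @bounded_linear R H K by exists (Operator fP).
apply/asboolP; split; first exact: fD.
by exists M%:C => x; rewrite !normE -rmorphM/= lecR.
Qed.

Lemma op_bound (H K : hilbertType R) (A : operator H K) :
  exists2 M : R, 0 <= M & forall x, nrm (A x) <= M * nrm x.
Proof.
have /asboolP[_ [M AM]] := operatorP A.
exists (complex.Re `|M|) => [|x]; first exact: ge0_Re.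
rewrite -lecR rmorphM/= -!normE -norm_Re.
have := AM x; have := normr_ge0 x; rewrite le_eqVlt => /predU1P[<-|x0].
  by rewrite !mulr0.
move=> h; have M0 : 0 <= M by rewrite -(pmulr_lge0 _ x0) (le_trans _ h).
by rewrite ger0_norm.
Qed.

(* S is the graph of a bounded linear map defined on a subspace; A is its closure
   composed with the orthogonal projection p onto the closure of the domain. *)
Lemma op_extend (H K : hilbertType R) (S : H -> K -> Prop) (M : R) : 0 <= M ->
  S 0 0 -> (forall a x z x' z', S x z -> S x' z' -> S (a *: x + x') (a *: z +
    z')) ->
  (forall x z, S x z -> nrm z <= M * nrm x) ->
  exists A : operator H K, forall x, exists p,
    [/\ forall s z, S s z -> inner (x - p) s = 0,
        nrm (A x) <= M * nrm x &
        forall e : R, 0 < e -> exists s z, [/\ S s z, nrm (p - s) < e & nrm (A x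
          - z) < e]].
Proof.
move=> M0 S0 SD SM.
pose D := [set s | exists z, S s z].
have sD : subspace D.
  split; first by exists 0.
  by move=> a x y [z Sz] [z' Sz']; exists (a *: z + z'); exact: SD.
pose G x w := exists p, (forall s z, S s z -> inner (x - p) s = 0) /\
  forall e : R, 0 < e -> exists s z, [/\ S s z, nrm (p - s) < e & nrm (w - z) < e].
have Gtot x : exists w, G x w.
  have [p Dp xp] := projection x sD.
  have /choice[u uP] (n : nat) : exists c : H * K, S c.1 c.2 /\
      nrm (p - c.1) < n.+1%:R^-1.
    have n0 : 0 < n.+1%:R^-1 :> R by rewrite invr_gt0.
    by have [s [z Sz] ps] := Dp _ n0; exists (s, z).
  have [w uw] : exists w, hcvg (fun n => (u n).2) w.
    apply: hcomplete => e e0.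
    have M1 : 0 < M + 1 by rewrite ltr_wpDl.
    have e' : 0 < e / 2 / (M + 1) by rewrite !divr_gt0.
    have [m0 mP] := archi_inv e'; exists m0 => m n /mP mm /mP nn.
    have [Sm pm] := uP m; have [Sn pn] := uP n.
    have := SM _ _ (SD (-1) _ _ _ _ Sn Sm); rewrite !scaleN1r ![- _ + _]addrC => h.
    apply: (le_lt_trans h).
    have := nrmB (u m).1 p (u n).1; rewrite (nrmBC _ p) => h2.
    have h3 : nrm ((u m).1 - (u n).1) < e / (M + 1).
      apply: (le_lt_trans h2).
      have -> : e / (M + 1) = e / 2 / (M + 1) + e / 2 / (M + 1) by field; rewrite
        gt_eqF.
      by rewrite ltrD// (lt_trans pm, lt_trans pn).
    rewrite ltr_pdivlMr// in h3; apply: le_lt_trans h3.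
    by rewrite mulrC ler_wpM2l ?nrm_ge0// lerDl.
  exists w, p; split; first by move=> s z Sz; apply: xp; exists z.
  move=> e e0; have [m0 mP] := archi_inv e0; have [m1 m1P] := uw _ e0.
  pose n := maxn m0 m1; exists (u n).1, (u n).2; have [Sn pn] := uP n.
  split=> //; first by rewrite (lt_trans pn)// mP// leq_maxl.
  by rewrite nrmBC m1P// leq_maxr.
have GD a x w x' w' : G x w -> G x' w' -> G (a *: x + x') (a *: w + w').
  move=> [p [xp pw]] [p' [xp' pw']]; exists (a *: p + p'); split.
    move=> s z Sz; rewrite opprD addrACA -scalerBr innerDl innerZl.
    by rewrite (xp _ _ Sz) (xp' _ _ Sz) mulr0 addr0.
  move=> e e0.
  have a1 : 0 < complex.Re `|a| + 1 by rewrite ltr_wpDl// ge0_Re.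
  have e' : 0 < e / 2 / (complex.Re `|a| + 1) by rewrite !divr_gt0.
  have e2 : 0 < e / 2 by rewrite divr_gt0.
  have [s [z [Sz ps wz]]] := pw _ e'.
  have [s' [z' [Sz' ps' wz']]] := pw' _ e2.
  exists (a *: s + s'), (a *: z + z'); split; first exact: SD.
    by rewrite opprD addrACA -scalerBr nrm_comb.
  by rewrite opprD addrACA -scalerBr nrm_comb.
have GM x w : G x w -> nrm w <= M * nrm x.
  move=> [p [xp pw]].
  have pD : adh D p.
    by move=> e e0; have [s [z [Sz ps _]]] := pw e e0; exists s => //; exists z.
  have px : nrm p <= nrm x.
    by apply: (pythagoras_le sD pD) => s [z Sz]; exact: xp Sz.
  apply: (@ler_eps _ _ _ (M + 1)) => e e0; have [s [z [Sz ps wz]]] := pw e e0.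
  have h1 : nrm w <= nrm z + e.
    by rewrite (_ : w = z + (w - z)) ?(le_trans (nrmD _ _))// ?lerD2l ?ltW//
      addrC subrK.
  have h2 : nrm s <= nrm p + e.
    have -> : s = p - (p - s) by rewrite opprB addrC subrK.
    by rewrite (le_trans (nrmD _ _))// nrmN lerD2l ltW.
  have h3 := SM _ _ Sz.
  have : M * nrm s <= M * (nrm x + e) by rewrite ler_wpM2l// (le_trans h2)// lerD2r.
  move: h1 h3; lra.
have [f fP] := choice Gtot.
have Gf x w : G x w -> w = f x.
  move=> Gw; apply/eqP; rewrite -subr_eq0; apply/eqP/nrm0_eq0/eqP.
  rewrite eq_le nrm_ge0 andbT.
  have := GM _ _ (GD (-1) _ _ _ _ (fP x) Gw).
  by rewrite !scaleN1r !addNr nrm0 mulr0 addrC.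
have [|x|A AP] := @bounded_linear_op _ _ f M; first 2 last.
- exists A => x; have [p [xp pw]] := fP x; exists p; split=> //.
    by rewrite AP GM.
  by move=> e e0; have := pw e e0; rewrite AP.
- by move=> a x y; apply/esym/Gf; exact: GD.
- exact: GM.
Qed.

End Operators.

Section OperatorTheory.
Context {R : realType}.
Implicit Types H K L : hilbertType R.

Lemma opP H K (A B : operator H K) : (forall x, A x = B x) -> A = B.
Proof. by move=> AB; apply: val_inj; apply/funext. Qed.

Lemma opD H K (A : operator H K) x y : A (x + y) = A x + A y.
Proof. exact: linearD. Qed.

Lemma opB H K (A : operator H K) x y : A (x - y) = A x - A y.
Proof. exact: linearB. Qed.

Lemma opN H K (A : operator H K) x : A (- x) = - A x.
Proof. exact: linearN. Qed.

Lemma op0 H K (A : operator H K) : A 0 = 0.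
Proof. exact: linear0. Qed.

Lemma opZ H K (A : operator H K) a x : A (a *: x) = a *: A x.
Proof. exact: linearZ. Qed.

Lemma op_sum H K (A : operator H K) I (r : seq I) (P : pred I) (F : I -> H) :
  A (\sum_(i <- r | P i) F i) = \sum_(i <- r | P i) A (F i).
Proof. exact: linear_sum. Qed.

Lemma addopE H K (A B : operator H K) x : (A + B) x = A x + B x.
Proof. by []. Qed.

Lemma scaleopE H K a (A : operator H K) x : (a *: A) x = a *: A x.
Proof. by []. Qed.

Lemma sumopE H K I (r : seq I) (P : pred I) (F : I -> operator H K) x :
  (\sum_(i <- r | P i) F i) x = \sum_(i <- r | P i) F i x.
Proof. by apply: (big_morph (fun A : operator H K => A x)). Qed.

Lemma opnormP H K (A : operator H K) x : nrm (A x) <= opnorm A * nrm x.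
Proof.
have [->|x0] := eqVneq x 0; first by rewrite linear0 !nrm0 mulr0.
have nx : 0 < nrm x.
  by rewrite lt_neqAle nrm_ge0 andbT eq_sym; apply: contra_neq x0; exact: nrm0_eq0.
have [M M0 AM] := op_bound A.
have : nrm (A ((nrm x)^-1%:C *: x)) <= opnorm A.
  apply: ub_le_sup.
    exists M => _ [y /= y1 <-]; rewrite (le_trans (AM _))//.
    by rewrite ler_piMr// -lecR -normE.
  exists ((nrm x)^-1%:C *: x) => //=.
  by rewrite normE lecR nrmZr ger0_norm ?invr_ge0 ?nrm_ge0// mulVf// gt_eqF.
rewrite linearZ/= nrmZr ger0_norm ?invr_ge0 ?nrm_ge0//.
by rewrite mulrC ler_pdivrMr.
Qed.

Lemma opnorm_le H K (A : operator H K) (M : R) : 0 <= M ->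
  (forall x, nrm (A x) <= M * nrm x) -> opnorm A <= M.
Proof.
move=> M0 AM; apply: ge_sup; first by exists (nrm (A 0)), 0; rewrite //= normr0.
move=> _ [x /= x1 <-]; rewrite (le_trans (AM _))// ler_piMr//.
by rewrite -lecR -normE.
Qed.

Lemma opnorm_ge0 H K (A : operator H K) : 0 <= opnorm A.
Proof.
have [M M0 AM] := op_bound A.
apply: ub_le_sup; last by exists 0; rewrite /= ?normr0 ?linear0// normr0.
exists M => _ [y /= y1 <-]; rewrite (le_trans (AM _))//.
by rewrite ler_piMr// -lecR -normE.
Qed.

Lemma adjointP H K (A : operator H K) x y : inner (A x) y = inner x (adjoint A y).
Proof.
have [M M0 AM] := op_bound A.
suff [B AB] : exists B : operator K H, forall x y, inner (A x) y = inner x (B y).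
  have := @xgetPex _ (0 : operator K H)
    [set B : operator K H | forall x y, inner (A x) y = inner x (B y)].
  by move=> /(_ (ex_intro _ B AB))/(_ x y).
have /choice[f fP] v : exists u, forall x, inner (A x) v = inner x u.
  apply: (@riesz _ _ _ (M * nrm v)) => [a u w|u].
    by rewrite linearP innerDl innerZl.
  by rewrite (le_trans (inner_le _ _))// mulrAC ler_wpM2r ?nrm_ge0.
have [a u w|u|B BP] := @bounded_linear_op _ _ _ f M.
- apply/inner_extl => z; rewrite inner_conj -fP innerDr innerZr rmorphD rmorphM/=.
  by rewrite conjCK innerDl innerZl (inner_conj (f u)) (inner_conj (f w)) -!fP.
- have [->|fu] := eqVneq (f u) 0; first by rewrite nrm0 mulr_ge0.
  have nf : 0 < nrm (f u).
    by rewrite lt_neqAle nrm_ge0 andbT eq_sym; apply: contra_neq fu; exact: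
      nrm0_eq0.
  rewrite -(ler_pM2l nf) -expr2 -rinxx /rin -fP.
  rewrite (le_trans (le_trans (ler_norm _) (rin_le _ _)))//.
  by rewrite mulrA (mulrC (nrm (f u))) ler_wpM2r ?nrm_ge0.
- by exists B => u v; rewrite BP.
Qed.

Lemma adjointPr H K (A : operator H K) x y : inner y (A x) = inner (adjoint A y) x.
Proof. by rewrite inner_conj adjointP -inner_conj. Qed.

Lemma adjoint_uniq H K (A : operator H K) (B : operator K H) :
  (forall x y, inner (A x) y = inner x (B y)) -> adjoint A = B.
Proof.
move=> AB; apply: opP => y; apply: inner_extl => z.
by rewrite -adjointPr inner_conj AB -inner_conj.
Qed.

Lemma adjoint_le H K (A : operator H K) (M : R) : 0 <= M ->
  (forall x, nrm (A x) <= M * nrm x) ->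
  forall y, nrm (adjoint A y) <= M * nrm y.
Proof.
move=> M0 AM y; set u := adjoint A y.
have [u0|u0] := eqVneq u 0; first by rewrite u0 nrm0 mulr_ge0 ?nrm_ge0.
have nu : 0 < nrm u.
  by rewrite lt_neqAle nrm_ge0 andbT eq_sym; apply: contra_neq u0; exact: nrm0_eq0.
rewrite -(ler_pM2l nu) -expr2 -rinxx /rin -adjointP.
rewrite (le_trans (le_trans (ler_norm _) (rin_le _ _)))//.
by rewrite mulrA (mulrC (nrm u)) ler_wpM2r ?nrm_ge0.
Qed.

Lemma reop_inner H (A : operator H H) x : inner (reop A x) x = (rin (A x) x)%:C.
Proof.
rewrite /reop scaleopE addopE innerZl innerDl -adjointPr [X in _ + X]inner_conj.
by rewrite [_ + _]addcJ mulrA mulVf ?mul1r// pnatr_eq0.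
Qed.

Lemma op_eq_dense H K (D : set H) (A B : operator H K) : dense D ->
  (forall d, D d -> A d = B d) -> A = B.
Proof.
move=> /hdenseP dD AB; apply: opP => x; apply/eqP; rewrite -subr_eq0; apply/eqP.
apply: nrm0_eq0; apply/eqP; rewrite eq_le nrm_ge0 andbT.
have [M M0 AM] := op_bound (A - B).
apply: (@ler_eps _ _ _ M) => e e0; have [d Dd xd] := dD x e e0.
have -> : A x - B x = (A - B) (x - d).
  by rewrite linearB -[X in _ = _ - X]/(A d - B d) (AB d Dd) subrr subr0.
by rewrite add0r (le_trans (AM _))// ler_wpM2l// ltW.
Qed.

Lemma unitary_pair H (A B : operator H H) :
  (forall x y, inner (A x) y = inner x (B y)) ->
  (forall x, B (A x) = x) -> (forall x, A (B x) = x) -> unitaryop A.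
Proof. by move=> /adjoint_uniq AB BA AB1; split; apply: opP => x /=; rewrite AB.
  Qed.

Lemma op_lim H K (A : nat -> operator H K) (eps : nat -> R) :
  (forall n, 0 <= eps n) ->
  (forall e, 0 < e -> exists M, forall n, (M <= n)%N -> eps n < e) ->
  (forall n m x, (n <= m)%N -> nrm (A m x - A n x) <= eps n * nrm x) ->
  exists S : operator H K, forall n x, nrm (A n x - S x) <= eps n * nrm x.
Proof.
move=> eps0 epsP AA.
have /choice[f fP] x : exists y, hcvg (fun n => A n x) y.
  apply: hcomplete => e e0.
  have x1 : 0 < nrm x + 1 by rewrite ltr_wpDl// nrm_ge0.
  have e' : 0 < e / 2 / (nrm x + 1) by rewrite !divr_gt0.
  have [M Mn] := epsP _ e'; exists M => m n Mm Mn'.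
  have h := Mn M (leqnn _).
  have := AA _ _ x Mm; have := AA _ _ x Mn'.
  have := nrmB (A m x) (A M x) (A n x); rewrite (nrmBC (A M x)).
  rewrite ltr_pdivlMr// in h; move: h; have := nrm_ge0 x; have := eps0 M; nra.
have fA n x : nrm (A n x - f x) <= eps n * nrm x.
  apply: (@ler_eps _ _ _ 1) => e e0; have [M Mn] := fP x e e0.
  have := Mn (maxn M n) (leq_maxl _ _); have := AA _ _ x (leq_maxr M n).
  have := nrmB (A n x) (A (maxn M n) x) (f x); rewrite (nrmBC (A n x) (A (maxn M
    n) x)); lra.
have [M M0 AM] := op_bound (A 0%N).
have [a x y|x|S SP] := @bounded_linear_op _ _ _ f (M + eps 0%N).
- apply/eqP; rewrite -subr_eq0; apply/eqP/nrm0_eq0/eqP; rewrite eq_le nrm_ge0 andbT.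
  apply: (@ler_eps _ _ _ (nrm (a *: x + y) + complex.Re `|a| * nrm x + nrm y)) =>
    e e0.
  have [N Nn] := epsP e e0; have h := ltW (Nn N (leqnn _)).
  have -> : f (a *: x + y) - (a *: f x + f y) =
     - (A N (a *: x + y) - f (a *: x + y)) + (a *: (A N x - f x) + (A N y - f y)).
    rewrite (operator_linear (A N)) opprB scalerBr [X in _ = _ + X]addrACA.
    by rewrite [RHS]addrA subrK opprD.
  have b z : nrm (A N z - f z) <= e * nrm z.
    by rewrite (le_trans (fA _ _))// ler_wpM2r ?nrm_ge0.
  rewrite (le_trans (nrmD _ _))// nrmN add0r.
  have := nrmD (a *: (A N x - f x)) (A N y - f y); rewrite nrmZ.
  have := b x; have := b y; have := b (a *: x + y).
  have : 0 <= complex.Re `|a| by rewrite ge0_Re.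
  have := nrm_ge0 (A N x - f x); nra.
- have := fA 0%N x; have := AM x.
  have := nrmB (f x) (A 0%N x) 0; rewrite !subr0 (nrmBC (f x)); lra.
- by exists S => n x; rewrite SP.
Qed.

End OperatorTheory.

Section Extension.
Context {R : realType} {H K : hilbertType R} (S : H -> K -> Prop) (M : R).
Hypothesis M0 : 0 <= M.
Hypothesis S0 : S 0 0.
Hypothesis SD : forall a x z x' z',
  S x z -> S x' z' -> S (a *: x + x') (a *: z + z').
Hypothesis SM : forall x z, S x z -> nrm z <= M * nrm x.

(** The extension vanishes on the orthogonal complement of the domain because it factors through the
    projection. For an isometric relation it is therefore a partial isometry, expressed by A A^* A =
    A. *)
Lemma op_extendP : exists A : operator H K,
  [/\ forall x z, S x z -> A x = z,
      forall x, nrm (A x) <= M * nrm x,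
      forall x, (forall s z, S s z -> inner x s = 0) -> A x = 0 &
      ((forall x z, S x z -> nrm z = nrm x) ->
        forall x, nrm (A x) <= nrm x /\ A (adjoint A (A x)) = A x)].
Proof.
have [A AP] := op_extend M0 S0 SD SM; exists A.
pose D := [set s | exists z, S s z].
have sD : subspace D.
  split; first by exists 0.
  by move=> a x y [z Sz] [z' Sz']; exists (a *: z + z'); exact: SD.
have AM x : nrm (A x) <= M * nrm x by case: (AP x) => p [].
have padh x p : (forall e : R, 0 < e ->
    exists s z, [/\ S s z, nrm (p - s) < e & nrm (A x - z) < e]) -> adh D p.
  by move=> pw e e0; have [s [z [Sz ps _]]] := pw e e0; exists s => //; exists z.
have A1 x z : S x z -> A x = z.
  move=> Sx; have [p [xp _ pw]] := AP x.
  have xpE : x - p = 0.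
    apply: nrm0_eq0; apply/eqP; rewrite -sqrf_eq0 -rinxx /rin innerBr.
    rewrite (xp _ _ Sx) (@orth_adh _ _ D _ _ p) ?subr0//; first by move=> s [w];
      exact: xp.
    exact: padh pw.
  apply/eqP; rewrite -subr_eq0; apply/eqP/nrm0_eq0/eqP; rewrite eq_le nrm_ge0 andbT.
  apply: (@ler_eps _ _ _ (1 + M)) => e e0; have [s [w [Sw ps Aw]]] := pw e e0.
  have ps' : nrm (s - x) < e by rewrite nrmBC (_ : x = p)//; apply/eqP; rewrite
    -subr_eq0 xpE.
  have := SM (SD (-1) Sx Sw); rewrite !scaleN1r ![- _ + _]addrC.
  have := nrmB (A x) w z.
  have : M * nrm (s - x) <= M * e by rewrite ler_wpM2l// ltW.
  move: Aw; lra.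
have A2 x : (forall s z, S s z -> inner x s = 0) -> A x = 0.
  move=> xS; have [p [xp _ pw]] := AP x.
  have p0 : p = 0.
    apply: nrm0_eq0; apply/eqP; rewrite -sqrf_eq0 -rinxx /rin.
    rewrite (@orth_adh _ _ D _ _ p) //; last exact: padh pw.
    move=> s [w Sw]; have := xp _ _ Sw; rewrite innerBl (xS _ _ Sw) sub0r => /eqP.
    by rewrite oppr_eq0 => /eqP.
  apply/nrm0_eq0/eqP; rewrite eq_le nrm_ge0 andbT.
  apply: (@ler_eps _ _ _ (1 + M)) => e e0; have [s [w [Sw ps Aw]]] := pw e e0.
  rewrite p0 sub0r nrmN in ps.
  have := nrmB (A x) w 0; rewrite !subr0; have := SM Sw.
  have : M * nrm s <= M * e by rewrite ler_wpM2l// ltW.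
  move: Aw; lra.
split=> // Siso x; have [p [xp _ pw]] := AP x.
have Axp : A x = A p.
  by apply/eqP; rewrite -subr_eq0 -(A2 _ xp) linearB.
have nA y : nrm (A y) <= nrm y.
  have [q [yq _ qw]] := AP y.
  have qy : nrm q <= nrm y.
    by apply: (pythagoras_le sD (padh _ _ qw)) => s [z Sz]; exact: yq Sz.
  apply: (@ler_eps _ _ _ 2) => e e0; have [s [w [Sw ps Aw]]] := qw e e0.
  have := nrmB (A y) w 0; rewrite !subr0 (Siso _ _ Sw).
  have := nrmB s q 0; rewrite !subr0 nrmBC; move: ps Aw; lra.
have nAx : nrm (A x) = nrm p.
  apply/eqP; rewrite eq_le Axp nA/=.
  apply: (@ler_eps _ _ _ 2) => e e0; have [s [w [Sw ps Aw]]] := pw e e0.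
  rewrite Axp in Aw.
  have := nrmB p s 0; rewrite !subr0 -(Siso _ _ Sw).
  have := nrmB w (A p) 0; rewrite !subr0 nrmBC; move: ps Aw; lra.
split=> //; rewrite [RHS]Axp; congr (A _).
(* A^* A x = p: the left side has norm at most |p| and real inner product |p|^2 with p, so the
   squared distance is at most 0. *)
apply/eqP; rewrite -subr_eq0; apply/eqP/nrm0_eq0/eqP; rewrite -sqrf_eq0 eq_le
  sqr_ge0 andbT.
have h1 : rin (adjoint A (A x)) p = nrm p ^+ 2.
  by rewrite -nAx -rinxx /rin -adjointPr -Axp.
have h2 : nrm (adjoint A (A x)) <= nrm p.
  by rewrite -nAx -[leRHS]mul1r; apply: adjoint_le => // y; rewrite mul1r.
rewrite nrmB_sqr h1.
have : nrm (adjoint A (A x)) ^+ 2 <= nrm p ^+ 2 by rewrite ler_sqr ?nnegrE.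
lra.
Qed.

End Extension.

(** * Square-summable sequences *)

Section Completeness.
Context {R : realType}.
Local Notation C := (ComplexField.complex_complex__canonical__Num_NumField R).

(** Completeness is phrased with filters. Centres of balls of radius 1/(n+1) belonging to the Cauchy
    filter form a Cauchy sequence, and its limit is the limit of the filter. *)
Lemma seq_complete_cvg (V : normedModType C) :
  (forall u : nat -> V,
    (forall e : R, 0 < e -> exists M, forall m n, (M <= m)%N -> (M <= n)%N ->
      complex.Re `|u m - u n| < e) ->
    exists l, forall e : R, 0 < e -> exists M, forall n, (M <= n)%N ->
      complex.Re `|u n - l| < e) ->
  forall F : set_system V, ProperFilter F -> cauchy F -> cvg F.
Proof.
move=> compl F FF Fc.
have Cn (x : V) (e : R) : (`|x| < e%:C) = (complex.Re `|x| < e).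
  by rewrite (RReE (normr_ge0 x)) ltcR.
have /choice[u uP] (n : nat) : exists x, F (ball x (n.+1%:R^-1)%:C).
  by apply: (cauchyP F).1 => //; rewrite (ltcR 0) invr_gt0.
have uu m n : complex.Re `|u m - u n| < m.+1%:R^-1 + n.+1%:R^-1.
  have [z [mz nz]] := filter_ex (filterI (uP m) (uP n)).
  move: mz nz; rewrite -!ball_normE/= !Cn (distrC (u n)) => mz nz.
  have := ler_normD (u m - z) (z - u n); rewrite addrA subrK lecE => /andP[_].
  by rewrite cReD => /le_lt_trans; apply; apply: ltrD.
have [|l ul] := compl u.
  move=> e e0; have e2 : 0 < e / 2 by rewrite divr_gt0.
  have [M Mn] := archi_inv e2; exists M => m n Mm Mn'.
  by rewrite (lt_trans (uu m n))// [ltRHS]splitr ltrD// Mn.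
apply/cvg_ex; exists l; apply/cvgrPdist_lt => e /gtC0[-> e0].
have e2 : 0 < complex.Re e / 2 by rewrite divr_gt0.
have [M Mn] := archi_inv e2; have [M' Mn'] := ul _ e2.
pose n := maxn M M'.
have h := Mn n (leq_maxl _ _); have h' := Mn' n (leq_maxr _ _).
apply: filterS (uP n) => z; rewrite -ball_normE/= !Cn => h''.
have := ler_normD (l - u n) (u n - z); rewrite addrA subrK lecE => /andP[_].
rewrite cReD => /le_lt_trans; apply.
rewrite [ltRHS]splitr; apply: ltrD; first by rewrite distrC.
exact: lt_trans h'' h.
Qed.

(* An alias of R[i], to keep its Hilbert space structure apart from the field. *)
Definition Cplx : Type := C^o.
HB.instance Definition _ := NormedModule.on Cplx.

Lemma real_seq_complete (u : nat -> R) :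
  (forall e : R, 0 < e -> exists M, forall m n, (M <= m)%N -> (M <= n)%N ->
      `|u m - u n| < e) ->
  exists l, forall e : R, 0 < e -> exists M, forall n, (M <= n)%N ->
      `|u n - l| < e.
Proof.
move=> uc; have : cvg (u @ \oo).
  apply/cauchy_cvgP/cauchyP => e e0; have [M Mu] := uc e e0.
  exists (u M); exists M => // n /= Mn; rewrite -ball_normE/=.
  exact: Mu.
move=> /cvg_ex[l /cvgrPdist_lt ul]; exists l => e e0.
have [M _ Mu] := ul e e0; exists M => n Mn; rewrite distrC; exact: Mu.
Qed.

Lemma Re_norm_leD (z : R[i]) :
  complex.Re `|z| <= `|complex.Re z| + `|complex.Im z|.
Proof.
rewrite {1}[z]complexE -lecR -norm_Re rmorphD/=.
rewrite (le_trans (ler_normD _ _))// normrM.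
rewrite (_ : `|'i| = 1) ?mul1r; last by rewrite normc_def/= expr0n expr1n/= add0r
  sqrtr1.
by rewrite !normc_def/= expr0n/= !addr0 !sqrtr_sqr.
Qed.

Lemma Im_norm_le (z : R[i]) : `|complex.Im z| <= complex.Re `|z|.
Proof.
rewrite -[_ `|z|]ger0_norm ?ge0_Re// -ler_sqr ?nnegrE// !real_normK ?num_real//.
rewrite -lecR normc_def/= sqr_sqrtr ?lecR ?lerDr ?sqr_ge0//.
by rewrite addr_ge0 ?sqr_ge0.
Qed.

Lemma Cplx_complete (F : set_system Cplx) : ProperFilter F -> cauchy F -> cvg F.
Proof.
apply: seq_complete_cvg => u uc.
have [e e0|a ua] := @real_seq_complete (fun n => complex.Re (u n)).
  have [M Mu] := uc e e0; exists M => m n Mm Mn.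
  by rewrite -cReN -cReD (le_lt_trans (Re_norm_le _))// Mu.
have [e e0|b ub] := @real_seq_complete (fun n => complex.Im (u n)).
  have [M Mu] := uc e e0; exists M => m n Mm Mn.
  rewrite (le_lt_trans _ (Mu m n Mm Mn))// (le_trans _ (Im_norm_le _))//.
  by case: (u m) => ? ?; case: (u n).
exists (a +i* b) => e e0; have e2 : 0 < e / 2 by rewrite divr_gt0.
have [M Mu] := ua _ e2; have [M' Mu'] := ub _ e2.
exists (maxn M M') => n; rewrite geq_max => /andP[Mn Mn'].
rewrite (le_lt_trans (Re_norm_leD _))// [ltRHS]splitr ltrD//.
  by rewrite (le_lt_trans _ (Mu n Mn))//; case: (u n).
by rewrite (le_lt_trans _ (Mu' n Mn'))//; case: (u n).
Qed.

HB.instance Definition _ := Uniform_isComplete.Build Cplx Cplx_complete.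

Definition Cplx_inner (x y : Cplx) : R[i] := x * Num.conj y.

Lemma Cplx_inner_linear z : linear_for *%R (Cplx_inner^~ z).
Proof. by move=> a x y; rewrite /Cplx_inner mulrDl mulrA. Qed.

Lemma Cplx_inner_conj x y : Cplx_inner x y = Num.conj (Cplx_inner y x).
Proof. by rewrite /Cplx_inner rmorphM/= conjCK mulrC. Qed.

Lemma Cplx_normr_inner (x : Cplx) : `|x| ^+ 2 = Cplx_inner x x.
Proof. exact: normCK. Qed.

Lemma Cplx_separable : exists2 D : set Cplx, countable D & dense D.
Proof.
exists (range (fun q : rat * rat => (ratr q.1 : R) +i* ratr q.2)).
  exact: sub_countable (card_image_le _ _) (countableP _).
move=> O [x Ox] oO.
have [e /= /gtC0[ee e0] eO] : nbhs_ball (x : Cplx) O by apply/nbhs_ballP; exact: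
  open_nbhs_nbhs.
have e2 : 0 < complex.Re e / 2 by rewrite divr_gt0.
have rd (a : R) : exists q : rat, `|a - ratr q| < complex.Re e / 2.
  have [|q] := @rat_in_itvoo _ (a - complex.Re e / 2) (a + complex.Re e / 2).
    by rewrite ltrD2l gtrN.
  by rewrite in_itv/= => qa; exists q; rewrite distrC ltr_distl.
have [p pP] := rd (complex.Re x); have [q qP] := rd (complex.Im x).
exists ((ratr p : R) +i* ratr q); split; last by exists (p, q).
apply: eO; rewrite -ball_normE/= ee norm_Re ltcR (le_lt_trans (Re_norm_leD _))//.
by case: x {Ox} pP qP => a b /= pP qP; rewrite [ltRHS]splitr ltrD.
Qed.

HB.instance Definition _ := @CompleteNormedModule_isHilbert.Build R Cplx
  Cplx_inner Cplx_inner_linear Cplx_inner_conj Cplx_normr_inner Cplx_separable.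

Lemma Cplx_innerE (x y : Cplx) : inner x y = x * Num.conj y :> R[i].
Proof. by []. Qed.

End Completeness.
Arguments Cplx : clear implicits.

Lemma sum_nat_sub (V : zmodType) (F : nat -> V) m n : (m <= n)%N ->
  \sum_(0 <= i < n) F i - \sum_(0 <= i < m) F i = \sum_(m <= i < n) F i.
Proof. by move=> mn; rewrite (big_cat_nat _ mn)//= addrAC subrr add0r. Qed.

Section HcvgTheory.
Context {R : realType} {H : hilbertType R}.
Implicit Types (u v : nat -> H) (l k : H).

Lemma hcvg_uniq u l k : hcvg u l -> hcvg u k -> l = k.
Proof.
move=> ul uk; apply/eqP; rewrite -subr_eq0; apply/eqP/nrm0_eq0/eqP.
rewrite eq_le nrm_ge0 andbT; apply: (@ler_eps _ _ _ 2) => e e0; rewrite add0r.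
have [M Mu] := ul e e0; have [M' Mu'] := uk e e0.
have := Mu (maxn M M') (leq_maxl _ _); have := Mu' (maxn M M') (leq_maxr _ _).
have := nrmB l (u (maxn M M')) k; rewrite (nrmBC l (u _)); lra.
Qed.

Lemma hcvg_cst l : hcvg (fun=> l) l.
Proof. by move=> e e0; exists 0%N => n _; rewrite subrr nrm0. Qed.

Lemma hcvgDZ a u v l k : hcvg u l -> hcvg v k ->
  hcvg (fun n => a *: u n + v n) (a *: l + k).
Proof.
move=> ul vk e e0; have a1 : 0 < complex.Re `|a| + 1 by rewrite ltr_wpDl// ge0_Re.
have e' : 0 < e / 2 / (complex.Re `|a| + 1) by rewrite !divr_gt0.
have e2 : 0 < e / 2 by rewrite divr_gt0.
have [M Mu] := ul _ e'; have [M' Mu'] := vk _ e2.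
exists (maxn M M') => n; rewrite geq_max => /andP[Mn Mn'].
by rewrite opprD addrACA -scalerBr nrm_comb// (Mu, Mu').
Qed.

End HcvgTheory.

Section CplxTheory.
Context {R : realType}.
Implicit Types (u : nat -> Cplx R) (l : Cplx R).

Lemma hcvg_conj u l : hcvg u l ->
  hcvg (fun n => Num.conj (u n) : Cplx R) (Num.conj l).
Proof.
move=> ul e e0; have [M Mu] := ul e e0; exists M => n Mn.
by rewrite /nrm -(rmorphB Num.conj) norm_conjC; exact: Mu.
Qed.

Lemma hcvg_Re_le u l (B : R) : hcvg u l ->
  (exists M, forall n, (M <= n)%N -> complex.Re (u n) <= B) -> complex.Re l <= B.
Proof.
move=> ul [M' uB]; apply: (@ler_eps _ _ _ 1) => e e0; have [M Mu] := ul e e0.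
have := Mu (maxn M M') (leq_maxl _ _); have := uB (maxn M M') (leq_maxr _ _).
have := Re_norm_le (u (maxn M M') - l); rewrite cReD cReN /nrm.
set z := complex.Re `|_|; rewrite ler_norml => /andP[]; lra.
Qed.

Lemma hcvg_Re_ge u l (B : R) : hcvg u l ->
  (exists M, forall n, (M <= n)%N -> B <= complex.Re (u n)) -> B <= complex.Re l.
Proof.
move=> ul [M uB]; rewrite -lerN2 -cReN.
have ul' := @hcvgDZ R (Cplx R) (-1) u (fun=> 0) l 0 ul (hcvg_cst _).
rewrite (_ : - l = -1 *: l + 0); last by rewrite scaleN1r addr0.
apply: (hcvg_Re_le ul').
by exists M => n /uB; rewrite addr0 scaleN1r cReN lerN2.
Qed.

Lemma mono_cauchy (s : nat -> R) (B : R) : (forall n, s n <= s n.+1) ->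
  (forall n, s n <= B) ->
  forall e, 0 < e -> exists M, forall n, (M <= n)%N -> s n - s M < e.
Proof.
move=> sS sB e e0.
have hs : has_sup (range s).
  by split; [exists (s 0%N), 0%N|exists B => _ [n _ <-]].
have [_ [M _ <-] Ms] := sup_adherent e0 hs; exists M => n Mn.
have : s n <= sup (range s) by apply: sup_upper_bound => //; exists n.
by move: Ms; lra.
Qed.

(** The discriminant bound behind the Cauchy-Schwarz inequality, for forms that are not yet inner
    products of a Hilbert space: [l2inner] and positive semidefinite kernels. *)
Lemma quad_cs (a b c : R) : 0 <= a -> 0 <= c ->
  (forall t, 0 <= a + 2 * t * b + t ^+ 2 * c) -> b ^+ 2 <= a * c.
Proof.
move=> a0 c0 h; have [c00|c00] := eqVneq c 0.
  suff -> : b = 0 by rewrite expr0n/= mulr_ge0.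
  apply/eqP; apply: contraT => b0.
  (* At this point the affine function a + 2 t b takes the value -1. *)
  have := h (- (a + 1) / (2 * b)); rewrite c00 mulr0 addr0.
  have -> : 2 * (- (a + 1) / (2 * b)) * b = - (a + 1) by field.
  lra.
have cp : 0 < c by rewrite lt_neqAle eq_sym c00.
have := h (- b / c).
have -> : a + 2 * (- b / c) * b + (- b / c) ^+ 2 * c = (a * c - b ^+ 2) / c by
  field.
by rewrite pmulr_lge0 ?invr_gt0// subr_ge0.
Qed.

End CplxTheory.

Section L2.
Context {R : realType} (Y : hilbertType R).
Implicit Types x y z : nat -> Y.

Definition sqsum x n : R := \sum_(0 <= i < n) nrm (x i) ^+ 2.
Definition inner_psum x y n : Cplx R := \sum_(0 <= i < n) inner (x i) (y i).

Lemma sqsum_ge0 x n : 0 <= sqsum x n.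
Proof. by apply: sumr_ge0 => i _; exact: sqr_ge0. Qed.

Lemma sqsumS x n : sqsum x n <= sqsum x n.+1.
Proof. by rewrite /sqsum big_nat_recr//= lerDl sqr_ge0. Qed.

Lemma sqsum_comb a x y n :
  sqsum (a *: x + y) n <= 2 * complex.Re `|a| ^+ 2 * sqsum x n + 2 * sqsum y n.
Proof.
have nz (z : Y) : nrm (a *: z) = complex.Re `|a| * nrm z by exact: nrmZ.
have : 0 <= complex.Re `|a| by rewrite ge0_Re.
move: (complex.Re `|a|) nz => s nz s0.
rewrite /sqsum !mulr_sumr -big_split/= ler_sum// => i _.
have -> : (a *: x + y) i = a *: x i + y i by [].
have := nrmD (a *: x i) (y i); rewrite nz.
have := nrm_ge0 (a *: x i + y i); have := nrm_ge0 (x i); have := nrm_ge0 (y i).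
move: (nrm (a *: x i + y i)) (nrm (x i)) (nrm (y i)) => p q r r0 q0 p0 h.
have : p ^+ 2 <= (s * q + r) ^+ 2 by rewrite ler_sqr ?nnegrE// (le_trans p0 h).
have := sqr_ge0 (s * q - r); nra.
Qed.

Definition l2_pred : {pred nat -> Y} :=
  fun x => `[< exists M : R, forall n, sqsum x n <= M >].

Lemma l2_submod : submod_closed l2_pred.
Proof.
split.
  apply/asboolP; exists 0 => n; rewrite /sqsum big1// => i _.
  by rewrite /= nrm0 expr0n.
move=> a x y /asboolP[M xM] /asboolP[M' yM]; apply/asboolP.
exists (2 * complex.Re `|a| ^+ 2 * M + 2 * M') => n.
rewrite (le_trans (sqsum_comb _ _ _ _))// lerD// ler_wpM2l//.
by rewrite mulr_ge0// sqr_ge0.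
Qed.

HB.instance Definition _ := GRing.isSubmodClosed.Build _ _ l2_pred l2_submod.

(** Values in an arbitrary [Y] let one construction serve three times: over [Cplx R] it holds the
    vectors of every countable kernel, over [Y] it is the tensor product of [Y] with that space, and
    its further coordinates give room for unitary dilations. *)
Record l2 : Type := L2 { l2_fun :> nat -> Y; l2P : l2_fun \in l2_pred }.

HB.instance Definition _ := [isSub of l2 for l2_fun].
HB.instance Definition _ := [Choice of l2 by <:].
HB.instance Definition _ := [SubChoice_isSubLmodule of l2 by <:].

Lemma sqsum_bound (x : l2) : exists M, forall n, sqsum x n <= M.
Proof. by have /asboolP := l2P x. Qed.

Lemma inner_psum_cauchy (x y : l2) : hcauchy (inner_psum x y).
Proof.
move=> e e0; pose s n := \sum_(0 <= i < n) nrm (x i) * nrm (y i).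
have [M xM] := sqsum_bound x; have [M' yM] := sqsum_bound y.
have [n|n||n0 nP] := @mono_cauchy _ s (M + M') _ _ (e / 2) _.
- by rewrite /s big_nat_recr//= lerDl mulr_ge0.
- rewrite (le_trans _ (lerD (xM n) (yM n)))// /s /sqsum -big_split ler_sum// => i
  _ /=.
  have := sqr_ge0 (nrm (x i) - nrm (y i)); rewrite !expr2.
  have := nrm_ge0 (x i); have := nrm_ge0 (y i); nra.
- by rewrite divr_gt0.
have key n : (n0 <= n)%N -> nrm (inner_psum x y n - inner_psum x y n0) < e / 2.
  move=> n0n; apply: le_lt_trans (nP n n0n).
  have -> : nrm (inner_psum x y n - inner_psum x y n0) = nrm (\sum_(n0 <= i < n)
    (inner (x i) (y i) : Cplx R)).
    by congr nrm; exact: sum_nat_sub.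
  rewrite /s sum_nat_sub//.
  elim/big_ind2: _ => [|a b c d ab cd|i _].
  - by rewrite nrm0.
  - by rewrite (le_trans (nrmD _ _))// lerD.
  - exact: inner_le.
exists n0 => m n m0 n0n; rewrite (le_lt_trans (nrmB _ (inner_psum x y n0) _))//.
by rewrite [ltRHS]splitr ltrD// ?key// nrmBC key.
Qed.

(* The partial sums converge, so the default value 0 is never used. *)
Definition l2inner (x y : l2) : R[i] := xget (0 : Cplx R) [set l | hcvg
  (inner_psum x y) l].

Lemma l2innerP (x y : l2) : hcvg (inner_psum x y) (l2inner x y).
Proof.
have [l pl] := hcomplete (inner_psum_cauchy x y).
exact: (@xgetPex _ (0 : Cplx R) [set l | hcvg (inner_psum x y) l]) (ex_intro _ l
  pl).
Qed.

Lemma l2inner_linear (z : l2) : linear_for *%R (l2inner^~ z).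
Proof.
move=> a x y; apply: (hcvg_uniq (l2innerP _ _)).
have := hcvgDZ a (l2innerP x z) (l2innerP y z).
congr (hcvg _ _); apply/funext => n.
rewrite /inner_psum scaler_sumr -big_split; apply: eq_bigr => i _ /=.
by rewrite innerDl innerZl.
Qed.

Lemma l2inner_conj (x y : l2) : l2inner x y = Num.conj (l2inner y x).
Proof.
apply: (hcvg_uniq (l2innerP _ _)).
have := hcvg_conj (l2innerP y x).
congr (hcvg _ _); apply/funext => n.
by rewrite /inner_psum rmorph_sum; apply: eq_bigr => i _; rewrite /= -inner_conj.
Qed.

Definition l2_sqnorm (x : l2) : R := complex.Re (l2inner x x).

Lemma inner_psum_diag x n : inner_psum x x n = (sqsum x n)%:C.
Proof.
rewrite /inner_psum /sqsum rmorph_sum; apply: eq_bigr => i _.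
exact: innerxx.
Qed.

Lemma l2innerxx (x : l2) : l2inner x x = (l2_sqnorm x)%:C.
Proof.
have := congr1 (@complex.Im R) (l2inner_conj x x); rewrite cIm_conj /l2_sqnorm.
by case: (l2inner x x) => a b /= bb; congr (_ +i* _); lra.
Qed.

Lemma sqsum_le (x : l2) n : sqsum x n <= l2_sqnorm x.
Proof.
apply: (hcvg_Re_ge (l2innerP x x)); exists n => m nm; rewrite inner_psum_diag/=.
by rewrite /sqsum (big_cat_nat _ nm)//= lerDl sumr_ge0// => i _; exact: sqr_ge0.
Qed.

Lemma l2_sqnorm_le (x : l2) (B : R) : (forall n, sqsum x n <= B) -> l2_sqnorm x
  <= B.
Proof.
move=> h; apply: (hcvg_Re_le (l2innerP x x)); exists 0%N => n _.
by rewrite inner_psum_diag/=.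
Qed.

Lemma l2_sqnorm_ge0 (x : l2) : 0 <= l2_sqnorm x.
Proof. by rewrite (le_trans (sqsum_ge0 x 0)) ?sqsum_le. Qed.

Lemma l2_sqnormD (x y : l2) (t : R) :
  l2_sqnorm (t%:C *: y + x) = l2_sqnorm x + 2 * t * complex.Re (l2inner x y) + t
    ^+ 2 * l2_sqnorm y.
Proof.
rewrite /l2_sqnorm l2inner_linear (l2inner_conj y) (l2inner_conj x) !l2inner_linear.
rewrite cReD cReMl !cRe_conj !cReD !cReMl.
rewrite (l2inner_conj y x) cRe_conj; ring.
Qed.

Definition l2norm (x : l2) : R[i] := (Num.sqrt (l2_sqnorm x))%:C.

Lemma l2norm_triangle (x y : l2) : l2norm (x + y) <= l2norm x + l2norm y.
Proof.
rewrite /l2norm -rmorphD lecR.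
rewrite -[leLHS]ger0_norm ?sqrtr_ge0// -[leRHS]ger0_norm ?addr_ge0 ?sqrtr_ge0//.
rewrite -ler_sqr ?nnegrE// !real_normK ?num_real// sqr_sqrtr ?l2_sqnorm_ge0//.
have := l2_sqnormD y x 1; rewrite rmorph1 scale1r => ->.
have h : complex.Re (l2inner y x) <= Num.sqrt (l2_sqnorm x) * Num.sqrt (l2_sqnorm
  y).
  rewrite -sqrtrM ?l2_sqnorm_ge0// (le_trans (ler_norm _))// -sqrtr_sqr
    ler_wsqrtr//.
  rewrite mulrC; apply: quad_cs; try exact: l2_sqnorm_ge0.
  by move=> t; rewrite -l2_sqnormD l2_sqnorm_ge0.
rewrite sqrrD !sqr_sqrtr ?l2_sqnorm_ge0//; move: h; nra.
Qed.

Lemma l2normZ a (x : l2) : l2norm (a *: x) = `|a| * l2norm x.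
Proof.
rewrite /l2norm norm_Re -rmorphM; congr (_%:C).
have E : l2inner (a *: x) (a *: x) = a * Num.conj a * l2inner x x.
  have Z b u v : l2inner (b *: u) v = b * l2inner u v.
    rewrite -[b *: u]addr0 l2inner_linear.
    have := l2inner_linear v (-1) 0 0.
    by rewrite scaler0 addr0 mulN1r addNr => ->; rewrite addr0.
  by rewrite Z l2inner_conj Z rmorphM/= -(l2inner_conj x) mulrA.
rewrite /l2_sqnorm E -normCK (norm_Re a) -rmorphXn cReMl sqrtrM ?sqr_ge0//
  sqrtr_sqr.
by rewrite ger0_norm// ge0_Re.
Qed.

Lemma l2norm0_eq0 (x : l2) : l2norm x = 0 -> x = 0.
Proof.
move/complexI => /eqP; rewrite sqrtr_eq0 => x0.
apply: val_inj; apply/funext => i; apply: nrm0_eq0; apply/eqP.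
rewrite -sqrf_eq0 eq_le sqr_ge0 andbT (le_trans _ x0)// (le_trans _ (sqsum_le x
  i.+1))//.
by rewrite /sqsum big_nat_recr//= lerDr sumr_ge0// => j _; exact: sqr_ge0.
Qed.

HB.instance Definition _ := Lmodule_isNormed.Build
  (ComplexField.complex_complex__canonical__Num_NumField R) l2
  l2norm_triangle l2normZ l2norm0_eq0.


Lemma l2nrm (x : l2) : complex.Re `|x| = Num.sqrt (l2_sqnorm x).
Proof. by []. Qed.

Lemma l2nrm_sqr (x : l2) : complex.Re `|x| ^+ 2 = l2_sqnorm x.
Proof. by rewrite l2nrm sqr_sqrtr// l2_sqnorm_ge0. Qed.

Lemma l2coord (x : l2) i : nrm (x i) <= complex.Re `|x|.
Proof.
rewrite -ler_sqr ?nnegrE ?ge0_Re// l2nrm_sqr (le_trans _ (sqsum_le x i.+1))//.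
by rewrite /sqsum big_nat_recr//= lerDr sumr_ge0// => j _; exact: sqr_ge0.
Qed.

Lemma l2_complete (F : set_system l2) : ProperFilter F -> cauchy F -> cvg F.
Proof.
apply: seq_complete_cvg => u uc.
have /choice[x xP] i : exists l, hcvg (fun n => u n i) l.
  apply: hcomplete => e e0; have [M Mu] := uc e e0; exists M => m n Mm Mn.
  by apply: le_lt_trans (Mu m n Mm Mn); exact: (l2coord (u m - u n)).
(* Coordinatewise limits can be taken in finite partial sums; the bound is uniform in [k] and so
   passes to the norm. *)
have key e : 0 < e -> exists M, forall n, (M <= n)%N -> forall k,
    \sum_(0 <= i < k) nrm (u n i - x i) ^+ 2 <= e ^+ 2.
  move=> e0; have [M Mu] := uc e e0; exists M => n Mn k.
  have cv i : (fun m => nrm (u n i - u m i)) @ \oo --> nrm (u n i - x i).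
    apply/cvgrPdist_lt => d d0; have [N Nu] := xP i d d0; exists N => // m /Nu /= h.
    apply: le_lt_trans h; rewrite ler_norml; apply/andP; split.
      by have := nrmB (u n i) (x i) (u m i); rewrite (nrmBC (x i) (u m i)); lra.
    by have := nrmB (u n i) (u m i) (x i); lra.
  have cs : (fun m => \sum_(0 <= i < k) nrm (u n i - u m i) ^+ 2) @ \oo -->
      \sum_(0 <= i < k) nrm (u n i - x i) ^+ 2.
    elim: k => [|k IH].
      by under eq_cvg do rewrite big_nil; rewrite big_nil; exact: cvg_cst.
    under eq_cvg do rewrite big_nat_recr//=.
    rewrite big_nat_recr//=; apply: cvgD => //.
    under eq_cvg do rewrite expr2.
    by rewrite expr2; apply: cvgM; exact: cv.
  apply: (cvgr_to_le cs); exists M => // m /= Mm.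
  rewrite (le_trans (sqsum_le (u n - u m) k))// -l2nrm_sqr ler_sqr ?nnegrE
    ?ge0_Re ?(ltW e0)//.
  by rewrite ltW// Mu.
have [M0 M0P] := key 1 ltr01.
have xl2 : x \in @l2_pred.
  have dl2 : (fun i => u M0 i - x i) \in @l2_pred.
    by apply/asboolP; exists (1 ^+ 2) => k; exact: M0P.
  have -> : x = - 1 *: (fun i => u M0 i - x i) + val (u M0).
    apply/funext => i; rewrite -[RHS]/(-1 *: (u M0 i - x i) + u M0 i).
    by rewrite scaleN1r opprB subrK.
  by have [_ h] := l2_submod; apply: h => //; exact: l2P.
exists (L2 xl2) => e e0; have e2 : 0 < e / 2 by rewrite divr_gt0.
have [M MP] := key _ e2; exists M => n Mn.
have h : l2_sqnorm (u n - L2 xl2) <= (e / 2) ^+ 2 by apply: l2_sqnorm_le => k;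
  exact: MP.
rewrite -l2nrm_sqr ler_sqr ?nnegrE ?ge0_Re ?(ltW e2)// in h.
by apply: le_lt_trans h _; rewrite ltr_pdivrMr// ltr_pMr// ltr1n.
Qed.

HB.instance Definition _ := Uniform_isComplete.Build l2 l2_complete.

Lemma l2_normr_inner (x : l2) : `|x| ^+ 2 = l2inner x x.
Proof. by rewrite l2innerxx (RReE (normr_ge0 x)) -rmorphXn; congr (_%:C); exact:
  l2nrm_sqr. Qed.

Definition l2_finite (d : nat -> Y) (s : seq nat) : nat -> Y :=
  fun i => if (i < size s)%N then d (nth 0%N s i) else 0.

Lemma l2_finiteP d s : l2_finite d s \in l2_pred.
Proof.
apply/asboolP; exists (sqsum (l2_finite d s) (size s)) => n.
have [ns|sn] := leqP n (size s).
  by rewrite /sqsum (big_cat_nat _ ns)//= lerDl sumr_ge0// => i _; exact: sqr_ge0.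
rewrite /sqsum (big_cat_nat _ (ltnW sn))//= gerDl big_nat big1// => i /andP[si _].
by rewrite /l2_finite ltnNge si/= nrm0 expr0n.
Qed.

Lemma l2_separable : exists2 D : set l2, countable D & dense D.
Proof.
have [d dP] := @separable_seq _ Y.
exists (range (fun s => L2 (l2_finiteP d s))).
  exact: sub_countable (card_image_le _ _) (countableP _).
move=> O [x Ox] oO.
have [e /= /gtC0[ee e0] eO] : nbhs_ball (x : l2) O by apply/nbhs_ballP; exact:
  open_nbhs_nbhs.
set r := complex.Re e in ee e0.
(* The squared error is at most r^2/2: r^2/4 for the tail after [n], and r^2/4 shared among the
   first [n] coordinates, each of which is allowed the fraction 1/(n+1). *)
have r4 : 0 < r ^+ 2 / 4 by rewrite divr_gt0// exprn_gt0.
have [B xB] := sqsum_bound x.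
have [n nP] := @mono_cauchy _ (sqsum x) B (sqsumS x) xB _ r4.
have n1 : 0 < Num.sqrt (r ^+ 2 / 4 / n.+1%:R) by rewrite sqrtr_gt0 divr_gt0.
have /choice[c cP] i : exists k, nrm (x i - d k) < Num.sqrt (r ^+ 2 / 4 / n.+1%:R).
  exact: dP.
pose s := mkseq c n.
exists (L2 (l2_finiteP d s)); split; last by exists s.
apply: eO; rewrite -ball_normE/= ee (RReE (normr_ge0 _)) ltcR.
rewrite -ltr_sqr ?nnegrE ?ge0_Re ?(ltW e0)//.
rewrite l2nrm_sqr; apply: (@le_lt_trans _ _ (r ^+ 2 / 4 + r ^+ 2 / 4)); last first.
  have : 0 < r ^+ 2 by rewrite exprn_gt0.
  lra.
have key m : (n <= m)%N -> sqsum (x - L2 (l2_finiteP d s)) m <= r ^+ 2 / 4 + r ^+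
  2 / 4.
  move=> nm; rewrite /sqsum (big_cat_nat _ nm)//= lerD//.
    have -> : \sum_(0 <= i < n) nrm ((x - L2 (l2_finiteP d s)) i) ^+ 2 =
        \sum_(i < n) nrm (x i - d (c i)) ^+ 2.
      rewrite big_mkord; apply: eq_bigr => i _.
      by rewrite -[(x - _) i]/(x i - l2_finite d s i) /l2_finite size_mkseq
        ltn_ord nth_mkseq.
    apply: (@le_trans _ _ (\sum_(i < n) (r ^+ 2 / 4 / n.+1%:R))).
      apply: ler_sum => i _; rewrite -[leRHS]sqr_sqrtr ?ler_sqr ?nnegrE
        ?sqrtr_ge0//; first exact: ltW.
      by rewrite divr_ge0// ltW.
    rewrite sumr_const card_ord -[_ *+ n]mulr_natr; move: (r ^+ 2 / 4) r4 => q q0.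
    rewrite -mulrA ler_piMr ?(ltW q0)//.
    by rewrite mulrC ler_pdivrMr// mul1r ler_nat.
  apply: le_trans (ltW (nP m nm)); rewrite /sqsum sum_nat_sub//.
  rewrite big_nat [leRHS]big_nat ler_sum// => i /andP[ni _].
  have -> : nrm ((x - L2 (l2_finiteP d s)) i) = nrm (x i - l2_finite d s i) by [].
  by rewrite /l2_finite size_mkseq ltnNge ni/= subr0.
apply: l2_sqnorm_le => m; have [nm|mn] := leqP n m; first exact: key.
apply: le_trans (key n (leqnn _)); rewrite [leRHS]/sqsum (big_cat_nat _ (ltnW
  mn))//=.
by rewrite lerDl sumr_ge0// => i _; exact: sqr_ge0.
by rewrite ee (lecR 0) ltW.
Qed.

HB.instance Definition _ := @CompleteNormedModule_isHilbert.Build R l2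
  l2inner l2inner_linear l2inner_conj l2_normr_inner l2_separable.

End L2.

Section L2Theory.
Context {R : realType} {Y : hilbertType R}.

Lemma l2_innerP (x y : l2 Y) : hcvg (inner_psum x y) (inner x y).
Proof. exact: l2innerP. Qed.

Lemma l2_ext (x y : l2 Y) : (forall i, x i = y i) -> x = y.
Proof. by move=> xy; apply: val_inj; apply/funext. Qed.

Lemma l2DZE a (x y : l2 Y) i : (a *: x + y) i = a *: x i + y i.
Proof. by []. Qed.

Lemma l2_nrm_sqr (x : l2 Y) : nrm x ^+ 2 = l2_sqnorm x.
Proof. exact: l2nrm_sqr. Qed.

Lemma sqsum_le_nrm (x : l2 Y) n : sqsum x n <= nrm x ^+ 2.
Proof. by rewrite l2_nrm_sqr sqsum_le. Qed.

Lemma l2_nrm_le (x : l2 Y) (B : R) : (forall n, sqsum x n <= B) -> nrm x ^+ 2 <= B.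
Proof. by rewrite l2_nrm_sqr; exact: l2_sqnorm_le. Qed.

Lemma sqsum_delta i (y : Y) n :
  sqsum (fun j => if j == i then y else 0) n = if (i < n)%N then nrm y ^+ 2 else 0.
Proof.
elim: n => [|n IH]; first by rewrite /sqsum big_nil.
rewrite /sqsum big_nat_recr//= -/(sqsum _ n) IH [(i < n.+1)%N]ltnS [(i <=
  n)%N]leq_eqVlt (eq_sym n).
by have [->|ni] := eqVneq i n; rewrite ?ltnn/= ?add0r// nrm0 expr0n addr0.
Qed.

Lemma l2_deltaP i (y : Y) : (fun j => if j == i then y else 0) \in @l2_pred R Y.
Proof.
apply/asboolP; exists (nrm y ^+ 2) => n.
by rewrite sqsum_delta; case: ifP => // _; exact: sqr_ge0.
Qed.

Definition l2_delta i y : l2 Y := L2 (l2_deltaP i y).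

Lemma l2_deltaE i y j : l2_delta i y j = if j == i then y else 0.
Proof. by []. Qed.

Lemma inner_delta i y (x : l2 Y) : inner (l2_delta i y) x = inner y (x i).
Proof.
apply: (hcvg_uniq (l2_innerP _ _)) => e e0; exists i.+1 => n ni.
rewrite (_ : inner_psum _ _ _ = inner y (x i)) ?subrr ?nrm0//.
rewrite /inner_psum (bigD1_seq i) ?mem_index_iota ?iota_uniq//= eqxx big1
  ?addr0// => j ji.
by rewrite (negbTE ji) inner0l.
Qed.

Lemma l2_delta_linear i a y y' : l2_delta i (a *: y + y') = a *: l2_delta i y +
  l2_delta i y'.
Proof.
apply: l2_ext => j; rewrite l2DZE !l2_deltaE; case: eqP => // _.
by rewrite scaler0 addr0.
Qed.

Lemma l2_tail (x : l2 Y) (e : R) : 0 < e -> exists N, forall n, (N <= n)%N ->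
  nrm (x - \sum_(i < n) l2_delta i (x i)) < e.
Proof.
move=> e0; have e4 : 0 < (e / 2) ^+ 2 by rewrite exprn_gt0// divr_gt0.
have [N NP] := @mono_cauchy _ (sqsum x) _ (sqsumS x) (sqsum_le_nrm x) _ e4.
exists N => n Nn.
have sE k : (\sum_(i < n) l2_delta i (x i)) k = if (k < n)%N then x k else 0.
  rewrite (_ : (\sum_(i < n) l2_delta i (x i)) k = \sum_(i < n) l2_delta i (x i) k).
    case: ltnP => kn.
      rewrite (bigD1 (Ordinal kn))//= eqxx big1 ?addr0// => j; rewrite -val_eqE/=
        => jk.
      by rewrite eq_sym (negbTE jk).
    rewrite big1// => j _; rewrite l2_deltaE; case: eqP => // kj.
    by move: kn; rewrite kj leqNgt ltn_ord.
  by apply: (big_morph (fun z : l2 Y => z k)).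
apply: (@le_lt_trans _ _ (e / 2)); last by rewrite ltr_pdivrMr// ltr_pMr// ltr1n.
apply: nrm_le_sqr; first by rewrite divr_ge0// ltW.
apply: l2_nrm_le => m.
have [mn|nm] := leqP m n.
  rewrite /sqsum big_nat big1 ?sqr_ge0// => i /andP[_ im].
  have -> : nrm ((x - \sum_(i < n) l2_delta i (x i)) i) = nrm (x i - (\sum_(i <
    n) l2_delta i (x i)) i) by [].
  by rewrite sE (leq_trans im mn) subrr nrm0 expr0n.
apply: le_trans (ltW (NP m (leq_trans Nn (ltnW nm)))).
rewrite /sqsum (big_cat_nat _ (ltnW nm))//= big_nat big1 ?add0r; last first.
  move=> i /andP[_ im].
  have -> : nrm ((x - \sum_(i < n) l2_delta i (x i)) i) = nrm (x i - (\sum_(i <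
    n) l2_delta i (x i)) i) by [].
  by rewrite sE im subrr nrm0 expr0n.
rewrite sum_nat_sub; last exact: leq_trans Nn (ltnW nm).
rewrite [leRHS](big_cat_nat Nn (ltnW nm))/= -[leLHS]add0r lerD//.
  by apply: sumr_ge0 => i _; exact: sqr_ge0.
rewrite big_nat [leRHS]big_nat ler_sum// => i /andP[ni _].
have -> : nrm ((x - \sum_(i < n) l2_delta i (x i)) i) = nrm (x i - (\sum_(i < n)
  l2_delta i (x i)) i) by [].
by rewrite sE ltnNge ni/= subr0.
Qed.

End L2Theory.

Section L2Tensor.
Context {R : realType} {Y : hilbertType R}.
Local Notation lC := (l2 (Cplx R)).

Lemma sqsum_scale (y : Y) (c : nat -> Cplx R) n :
  sqsum (fun i => (c i : R[i]) *: y) n = sqsum c n * nrm y ^+ 2.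
Proof.
rewrite /sqsum mulr_suml; apply: eq_bigr => i _.
by rewrite nrmZ exprMn.
Qed.

Lemma l2_tensorP (y : Y) (c : lC) :
  (fun i => (c i : R[i]) *: y) \in @l2_pred R Y.
Proof.
apply/asboolP; have [M cM] := sqsum_bound c; exists (M * nrm y ^+ 2) => n.
by rewrite sqsum_scale ler_wpM2r// sqr_ge0.
Qed.

Definition l2_tensor y c : l2 Y := L2 (l2_tensorP y c).

Lemma inner_l2_tensor y y' c c' :
  inner (l2_tensor y c) (l2_tensor y' c') = inner y y' * inner c c'.
Proof.
apply: (hcvg_uniq (l2_innerP _ _)).
have := hcvgDZ (inner y y') (l2_innerP c c') (hcvg_cst (0 : Cplx R)).
rewrite addr0; congr (hcvg _ _); apply/funext => n.
rewrite addr0 /inner_psum scaler_sumr; apply: eq_bigr => i _.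
rewrite /= innerZl innerZr mulrA mulrC.
by congr (_ * _).
Qed.

Lemma l2_tensorDl a y y' c :
  l2_tensor (a *: y + y') c = a *: l2_tensor y c + l2_tensor y' c.
Proof.
apply: l2_ext => i; rewrite l2DZE /= scalerDr !scalerA.
by rewrite (mulrC (c i : R[i])).
Qed.

Lemma l2_tensorDr a y c c' :
  l2_tensor y (a *: c + c') = a *: l2_tensor y c + l2_tensor y c'.
Proof.
by apply: l2_ext => i; rewrite l2DZE /= scalerDl !scalerA.
Qed.

Lemma l2_tensor_bilinear : bilinear_for *:%R *:%R (l2_tensor : Y -> lC -> l2 Y).
Proof.
by split=> z a x y; [exact: l2_tensorDl | exact: l2_tensorDr].
Qed.

HB.instance Definition _ :=
  bilinear_isBilinear.Build _ _ _ _ _ _ (l2_tensor : Y -> lC -> l2 Y)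
    l2_tensor_bilinear.

Lemma l2_tensor_dense : dense [set x : l2 Y |
    exists (n : nat) (y : 'I_n -> Y) (e : 'I_n -> lC),
      x = \sum_(i < n) l2_tensor (y i) (e i)].
Proof.
apply/hdenseP => x e e0; have [N NP] := l2_tail x e0.
exists (\sum_(i < N) l2_delta i (x i)); last exact: NP.
exists N, (fun i => x i), (fun i : 'I_N => l2_delta (i : nat) (1 : Cplx R)).
apply: eq_bigr => i _; apply: l2_ext => j; rewrite /= .
by case: eqP => // _; rewrite ?scale1r ?scale0r.
Qed.

Definition l2_hilbert_tensor : hilbert_tensor Y lC :=
  @HilbertTensor R Y lC (l2 Y) l2_tensor inner_l2_tensor l2_tensor_dense.

End L2Tensor.

(** * Positive semidefinite kernels *)

Section PSD.
Context {R : realType} {X : Type}.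
Implicit Types (K : X -> X -> R[i]) (s : seq (R[i] * X)).

Definition kform K s1 s2 : R[i] :=
  \sum_(p <- s1) \sum_(q <- s2) p.1 * Num.conj q.1 * K p.2 q.2.

Definition psd K := forall s, 0 <= kform K s s.

Lemma kform_cat K s1 s2 t1 t2 : kform K (s1 ++ s2) (t1 ++ t2) =
  kform K s1 t1 + kform K s1 t2 + (kform K s2 t1 + kform K s2 t2).
Proof.
rewrite /kform big_cat/= -!big_split/=; congr (_ + _).
  by apply: eq_bigr => p _; rewrite big_cat.
by apply: eq_bigr => p _; rewrite big_cat.
Qed.

Lemma kform1 K s x (a : R[i]) :
  kform K s [:: (a, x)] = Num.conj a * \sum_(p <- s) p.1 * K p.2 x.
Proof.
rewrite /kform mulr_sumr; apply: eq_bigr => p _.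
by rewrite big_seq1/= mulrA (mulrC p.1).
Qed.

Lemma kform11 K x y (a b : R[i]) :
  kform K [:: (a, x)] [:: (b, y)] = a * Num.conj b * K x y.
Proof. by rewrite /kform !big_seq1. Qed.

Lemma psd_diag K x : psd K -> 0 <= K x x.
Proof. by move=> /(_ [:: (1, x)]); rewrite kform11 rmorph1 !mul1r. Qed.

(** Being nonnegative, the form on the coefficients (1, a) has zero imaginary part; a = 1 and a = 'i
    give the two components of the identity. *)
Lemma psd_conj K x y : psd K -> K x y = Num.conj (K y x).
Proof.
move=> pK; have h a := pK ([:: (1, x)] ++ [:: (a, y)]).
have {}h a : complex.Im (Num.conj a * K x y + a * K y x) = 0.
  have := h a; rewrite kform_cat !kform11 rmorph1 !mul1r mulr1 => /ger0_Im.
  have xx := psd_diag x pK; have yy := psd_diag y pK.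
  have ImD (u v : R[i]) : complex.Im (u + v) = complex.Im u + complex.Im v.
    by case: u; case: v.
  have aa : 0 <= a * Num.conj a * K y y.
    by rewrite -normCK mulr_ge0// exprn_ge0.
  by rewrite !ImD (ger0_Im xx) (ger0_Im aa) add0r addr0.
move: (h 1) (h 'i); rewrite rmorph1 !mul1r.
case: (K x y) => a b; case: (K y x) => c d /=.
rewrite !mul0r !mul1r !mulN1r !add0r => h1 h2.
by congr (_ +i* _); lra.
Qed.

(** Let z be the sum and w = |z|. Positivity on [s] extended by (t z, x) is a quadratic inequality
    in t: the factor z makes both cross terms equal to the real number t w^2. Its discriminant gives
    w^4 <= K(x,x) w^2 times the form, and w^2 cancels. *)
Lemma psd_cs K s x : psd K ->
  complex.Re `|\sum_(p <- s) p.1 * K p.2 x| ^+ 2 <=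
  complex.Re (K x x) * complex.Re (kform K s s).
Proof.
move=> pK; set z := \sum_(p <- s) _.
have Q0 := pK s; have x0 := psd_diag x pK.
have conjz : kform K [:: (1, x)] s = Num.conj z.
  rewrite /kform big_seq1 /z rmorph_sum; apply: eq_bigr => p _.
  by rewrite (psd_conj _ _ pK) mul1r rmorphM.
have [w wE] : exists w, w = complex.Re `|z| by eexists.
rewrite -wE; have h (t : R) : 0 <= complex.Re (kform K s s) +
    2 * t * w ^+ 2 + t ^+ 2 * (complex.Re (K x x) * w ^+ 2).
  have := pK (s ++ [:: (t%:C * z, x)]); rewrite kform_cat kform1 kform11 -/z.
  have -> : kform K [:: (t%:C * z, x)] s = t%:C * z * Num.conj z.
    rewrite -conjz /kform !big_seq1 mulr_sumr; apply: eq_bigr => q _ /=.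
    by rewrite mul1r !mulrA.
  rewrite rmorphM/= conj_RC.
  have -> : t%:C * Num.conj z * z = (t * w ^+ 2)%:C.
    by rewrite -mulrA (mulrC _ z) -normCK norm_Re -wE -!rmorphXn -rmorphM.
  have -> : t%:C * z * Num.conj z = (t * w ^+ 2)%:C.
    by rewrite -mulrA -normCK norm_Re -wE -!rmorphXn -rmorphM.
  have -> : t%:C * z * (t%:C * Num.conj z) * K x x =
     (t ^+ 2 * (complex.Re (K x x) * w ^+ 2))%:C.
    rewrite mulrACA -normCK [K x x in LHS]RReE// norm_Re -wE.
    by rewrite -!rmorphXn -!rmorphM/=; congr (_%:C); ring.
  rewrite {1}(RReE Q0) -!rmorphD (ler0c) => h; apply: le_trans h _.
  by rewrite le_eqVlt; apply/orP; left; apply/eqP; ring.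
have Q0' := ge0_Re Q0; have x0' := ge0_Re x0.
have := quad_cs Q0' _ h; have := ge0_Re (normr_ge0 z); rewrite -wE.
move: (complex.Re (K x x)) (complex.Re (kform K s s)) x0' Q0'.
move=> k q k0 q0 w0 cs.
have {}cs := cs (mulr_ge0 k0 (sqr_ge0 w)).
have [->|wn] := eqVneq w 0; first by rewrite expr0n mulr_ge0.
have w2 : 0 < w ^+ 2 by rewrite exprn_gt0// lt_neqAle eq_sym wn.
by rewrite -(ler_pM2r w2) -expr2 (le_trans cs)// mulrCA mulrA.
Qed.

Lemma psd_offdiag K x y : psd K ->
  complex.Re `|K x y| ^+ 2 <= complex.Re (K y y) * complex.Re (K x x).
Proof.
move=> pK; have := psd_cs [:: (1, x)] y pK.
by rewrite kform11 big_seq1/= rmorph1 !mul1r.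
Qed.

Definition rank_one (u : X -> R[i]) (a b : X) : R[i] := u a * Num.conj (u b).

Lemma rank_one_psd u : psd (rank_one u).
Proof.
move=> s; rewrite /kform /rank_one.
have -> : \sum_(p <- s) \sum_(q <- s) p.1 * Num.conj q.1 * (u p.2 * Num.conj (u
  q.2)) =
    (\sum_(p <- s) p.1 * u p.2) * Num.conj (\sum_(p <- s) p.1 * u p.2).
  rewrite mulr_suml; apply: eq_bigr => p _; rewrite rmorph_sum mulr_sumr.
  by apply: eq_bigr => q _; rewrite rmorphM/=; ring.
by rewrite -normCK exprn_ge0.
Qed.

End PSD.

Section Gram.
Context {R : realType} {X : Type} {H : hilbertType R}.

Lemma gram_form (f : X -> H) (s t : seq (R[i] * X)) :
  kform (fun x y => inner (f x) (f y)) s t =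
  inner (\sum_(p <- s) p.1 *: f p.2) (\sum_(p <- t) p.1 *: f p.2).
Proof.
rewrite inner_suml; apply: eq_bigr => p _; rewrite inner_sumr; apply: eq_bigr =>
  q _.
by rewrite innerZl innerZr mulrA.
Qed.

Lemma gram_psd (f : X -> H) : psd (fun x y => inner (f x) (f y)).
Proof. by move=> s; rewrite gram_form innerxx ler0c sqr_ge0. Qed.

End Gram.

Section Kolmogorov.
Context {R : realType}.
Local Notation lC := (l2 (Cplx R)).

(** The second clause leaves all coordinates from [size s] on free, so that the next vector can
    absorb its defect in the coordinate [size s]. *)
Let valid (K : nat -> nat -> R[i]) (s : seq lC) :=
  (forall i j, (i < size s)%N -> (j < size s)%N -> inner s`_i s`_j = K i j) /\
  (forall i m, (i < size s)%N -> (size s <= m)%N -> s`_i m = 0).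

(* Infinite Cholesky factorization: the vector v in the span of s realising the
   row n is given by Riesz, and the new coordinate n absorbs the defect
   K n n - |v|^2. *)
Let valid_step K (s : seq lC) : psd K -> valid K s -> exists v, valid K (rcons s v).
Proof.
move=> pK [sK s0]; set n := size s in sK s0 *.
pose S (x : lC) (z : Cplx R) := exists a : nat -> R[i],
  x = \sum_(i < n) a i *: s`_i /\ z = \sum_(i < n) a i * K i n.
have kn0 : 0 <= complex.Re (K n n) by rewrite ge0_Re// psd_diag.
pose M := Num.sqrt (complex.Re (K n n)).
have S00 : S 0 0.
  by exists (fun=> 0); split; rewrite big1// => i _; rewrite ?scale0r ?mul0r.
have SD a x z x' z' : S x z -> S x' z' -> S (a *: x + x') (a *: z + z').
  move=> [b [-> ->]] [b' [-> ->]]; exists (fun i => a * b i + b' i); split.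
    by rewrite scaler_sumr -big_split; apply: eq_bigr => i _; rewrite scalerDl
      scalerA.
  rewrite scaler_sumr -big_split; apply: eq_bigr => i _ /=.
  by rewrite mulrDl -mulrA.
(* The Cauchy-Schwarz inequality for the kernel, with M^2 = K n n, shows at once that the relation
   is the graph of a functional and that this functional is bounded. *)
have SM x z : S x z -> nrm z <= M * nrm x.
  move=> [a [-> ->]].
  pose t := [seq (a (nat_of_ord i), nat_of_ord i) | i <- enum 'I_n].
  have := psd_cs t n pK.
  have -> : \sum_(p <- t) p.1 * K p.2 n = \sum_(i < n) a i * K i n.
    by rewrite big_map big_enum.
  have -> : complex.Re (kform K t t) = nrm (\sum_(i < n) a i *: s`_i) ^+ 2.
    rewrite -rinxx /rin; congr complex.Re; rewrite /kform big_map big_enum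
      inner_suml.
    apply: eq_bigr => i _; rewrite big_map big_enum inner_sumr; apply: eq_bigr =>
      j _ /=.
    by rewrite innerZl innerZr sK// mulrA.
  move=> h; apply: nrm_le_sqr; first by rewrite mulr_ge0 ?sqrtr_ge0.
  by rewrite exprMn sqr_sqrtr.
have M0 : 0 <= M by rewrite sqrtr_ge0.
have [A [AS AM A0 _]] := op_extendP M0 S00 SD SM.
have [v vP] : exists v, forall x, (A x : R[i]) = inner x v.
  by apply: (@riesz _ _ (fun x => (A x : R[i])) M) => [a x y|x]; [rewrite
    linearP|exact: AM].
have vK i : (i < n)%N -> inner s`_i v = K i n.
  move=> ni; rewrite -vP; apply: AS; exists (fun j => (j == i)%:R); split.
    rewrite (bigD1 (Ordinal ni))//= eqxx scale1r big1 ?addr0// => j.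
    by rewrite -val_eqE/= => /negbTE ->; rewrite scale0r.
  rewrite (bigD1 (Ordinal ni))//= eqxx mul1r big1 ?addr0// => j.
  by rewrite -val_eqE/= => /negbTE ->; rewrite mul0r.
(* The basis vectors from [n] on are orthogonal to the span of [s], where the extended functional
   vanishes. *)
have v0 m : (n <= m)%N -> v m = 0.
  move=> nm; have : inner (l2_delta m (1 : Cplx R)) v = 0.
    rewrite -vP; apply: A0 => _ z [a [-> _]]; rewrite inner_sumr big1// => i _.
    by rewrite innerZr inner_delta s0// inner0r mulr0.
  rewrite inner_delta => /(congr1 Num.conj); rewrite -inner_conj conjC0.
  by rewrite -[X in inner _ X]/(1 : R[i]) => <-; rewrite /inner/= /Cplx_inner
    rmorph1 mulr1.
have vM : nrm v ^+ 2 <= complex.Re (K n n).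
  have h : nrm v ^+ 2 <= M * nrm v.
    rewrite -rinxx /rin -vP (le_trans (ler_norm _))// (le_trans (Re_norm_le _))//.
    exact: AM.
  have [->|v1] := eqVneq (nrm v) 0; first by rewrite expr0n.
  have vp : 0 < nrm v by rewrite lt_neqAle eq_sym v1 nrm_ge0.
  rewrite expr2 ler_pM2r// in h.
  by rewrite -[leRHS]sqr_sqrtr// ler_sqr ?nnegrE.
pose c := Num.sqrt (complex.Re (K n n) - nrm v ^+ 2).
exists (v + l2_delta n (c%:C : Cplx R)).
have inw i : (i < n)%N -> inner s`_i (v + l2_delta n (c%:C : Cplx R)) = K i n.
  move=> ni; rewrite innerDr vK// [X in _ + X]inner_conj inner_delta s0//.
  by rewrite inner0r conjC0 addr0.
have inww : inner (v + l2_delta n (c%:C : Cplx R)) (v + l2_delta n (c%:C : Cplx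
  R)) = K n n.
  rewrite [RHS]RReE ?psd_diag// innerxx nrmD_sqr rinC /rin inner_delta v0//.
  rewrite inner0r mulr0 addr0 -[nrm (l2_delta _ _) ^+ 2]rinxx /rin inner_delta.
  rewrite l2_deltaE eqxx; congr (_%:C).
  have c2 : c ^+ 2 = complex.Re (K n n) - nrm v ^+ 2 by rewrite sqr_sqrtr ?subr_ge0.
  by rewrite Cplx_innerE conj_RC -rmorphM -expr2 [complex.Re _]/= c2 addrC subrK.
split=> [i j|i m]; rewrite !size_rcons !ltnS !nth_rcons -/n.
  rewrite (leq_eqVlt i) (leq_eqVlt j) => /orP[/eqP ->|ni] /orP[/eqP ->|nj];
    rewrite ?ltnn ?eqxx ?ni ?nj//.
  - by rewrite inner_conj inw// -psd_conj.
  - exact: inw.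
  - exact: sK.
rewrite (leq_eqVlt i) => /orP[/eqP ->|ni] nm; last by rewrite ni s0// ltnW.
rewrite ltnn eqxx -[LHS]/(v m + l2_delta n (c%:C : Cplx R) m) v0 ?(ltnW nm)//.
by rewrite l2_deltaE gtn_eqF// addr0.
Qed.

Lemma kolmogorov_nat (K : nat -> nat -> R[i]) : psd K ->
  exists f : nat -> lC, forall i j, inner (f i) (f j) = K i j.
Proof.
move=> pK.
have /choice[g gP] (s : seq lC) : exists v, valid K s -> valid K (rcons s v).
  have [vs|nvs] := pselect (valid K s); last by exists 0.
  by have [v vP] := valid_step pK vs; exists v.
pose S := fix S n := if n is m.+1 then rcons (S m) (g (S m)) else [::].
have Ssz n : size (S n) = n by elim: n => //= n IH; rewrite size_rcons IH.
have SV n : valid K (S n).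
  by elim: n => [|n IH]; [split=> //|exact: gP].
have Snth n i : (i < n)%N -> (S n)`_i = g (S i).
  elim: n => // n IH; rewrite ltnS leq_eqVlt => /orP[/eqP ->|ni].
    by rewrite /= nth_rcons Ssz ltnn eqxx.
  by rewrite /= nth_rcons Ssz ni IH.
exists (fun n => g (S n)) => i j; pose n := (maxn i j).+1.
have [h _] := SV n.
by rewrite -(@Snth n i) ?ltnS ?leq_maxl// -(@Snth n j) ?ltnS ?leq_maxr// h ?Ssz
  ?ltnS ?leq_maxl ?leq_maxr.
Qed.

Lemma kolmogorov (X : countType) (K : X -> X -> R[i]) : psd K ->
  exists f : X -> lC, forall x y, inner (f x) (f y) = K x y.
Proof.
move=> pK; have [[x0 _]|X0] := pselect (exists x : X, True); last first.
  by exists (fun=> 0) => x; case: X0; exists x.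
pose x_ n := odflt x0 (unpickle n).
have [|f fK] := @kolmogorov_nat (fun i j => K (x_ i) (x_ j)).
  move=> s; have := pK [seq (p.1, x_ p.2) | p <- s].
  by rewrite /kform big_map; under eq_bigr do rewrite big_map.
by exists (f \o pickle) => x y; rewrite /= fK /x_ !pickleK.
Qed.

End Kolmogorov.

Section KformTheory.
Context {R : realType} {X : Type}.
Implicit Types (K L : X -> X -> R[i]) (s : seq (R[i] * X)).

Lemma kformD K L s t : kform (fun x y => K x y + L x y) s t = kform K s t + kform
  L s t.
Proof.
rewrite /kform -big_split; apply: eq_bigr => p _; rewrite -big_split.
by apply: eq_bigr => q _; rewrite mulrDr.
Qed.

Lemma kformZ a K s t : kform (fun x y => a * K x y) s t = a * kform K s t.
Proof.
rewrite /kform mulr_sumr; apply: eq_bigr => p _; rewrite mulr_sumr.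
by apply: eq_bigr => q _; rewrite mulrCA.
Qed.

Lemma kformB K L s t : kform (fun x y => K x y - L x y) s t = kform K s t - kform
  L s t.
Proof.
rewrite /kform -sumrB; apply: eq_bigr => p _; rewrite -sumrB.
by apply: eq_bigr => q _; rewrite mulrBr.
Qed.

Lemma kform_sum (I : Type) (r : seq I) (P : pred I) (K : I -> X -> X -> R[i]) s t :
  kform (fun x y => \sum_(i <- r | P i) K i x y) s t = \sum_(i <- r | P i) kform
    (K i) s t.
Proof.
rewrite /kform [RHS]exchange_big; apply: eq_bigr => p _; rewrite [RHS]exchange_big.
by apply: eq_bigr => q _; rewrite mulr_sumr.
Qed.

Lemma eq_kform K L s t : (forall x y, K x y = L x y) -> kform K s t = kform L s t.
Proof. by move=> KL; apply: eq_bigr => p _; apply: eq_bigr => q _; rewrite KL. Qed.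

Lemma psdD K L : psd K -> psd L -> psd (fun x y => K x y + L x y).
Proof. by move=> pK pL s; rewrite kformD addr_ge0. Qed.

Lemma psdZ a K : 0 <= a -> psd K -> psd (fun x y => a * K x y).
Proof. by move=> a0 pK s; rewrite kformZ mulr_ge0. Qed.

Lemma psd_sum (I : Type) (r : seq I) (P : pred I) (K : I -> X -> X -> R[i]) :
  (forall i, P i -> psd (K i)) -> psd (fun x y => \sum_(i <- r | P i) K i x y).
Proof. by move=> pK s; rewrite kform_sum sumr_ge0// => i Pi; exact: pK. Qed.

Lemma psd_comp (X' : Type) (g : X' -> X) K : psd K -> psd (fun x y => K (g x) (g
  y)).
Proof.
move=> pK s; have := pK [seq (p.1, g p.2) | p <- s].
by rewrite /kform big_map; under eq_bigr do rewrite big_map.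
Qed.

(* Schur's product theorem: a finite Gram matrix is realised in l2, and the
   entrywise product of two Gram matrices is the Gram matrix of the tensors. *)
Lemma psdM K L : psd K -> psd L -> psd (fun x y => K x y * L x y).
Proof.
move=> pK pL [|p0 s0]; first by rewrite /kform big_nil.
set s := p0 :: s0; pose x_ i := (nth p0 s i).2.
have [f fK] := kolmogorov_nat (psd_comp x_ pK).
have [g gL] := kolmogorov_nat (psd_comp x_ pL).
have := @gram_psd R nat _ (fun i => l2_tensor (f i) (g i))
  [seq ((nth p0 s i).1, i) | i <- iota 0 (size s)].
rewrite /kform !big_map (big_nth p0) /index_iota subn0.
under eq_bigr do rewrite big_map.
congr (0 <= _); apply: eq_bigr => i _; rewrite (big_nth p0) /index_iota subn0.
by apply: eq_bigr => j _; rewrite inner_l2_tensor fK gL.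
Qed.

End KformTheory.

(** * Operators determined by Gram matrices *)

Section GramOperator.
Context {R : realType}.
Implicit Types H K : hilbertType R.

Definition lincomb (X : Type) H (f : X -> H) (s : seq (R[i] * X)) : H :=
  \sum_(p <- s) p.1 *: f p.2.

Lemma lincomb_gram (X : Type) H (f : X -> H) s :
  kform (fun x y => inner (f x) (f y)) s s = (nrm (lincomb f s) ^+ 2)%:C.
Proof. by rewrite gram_form innerxx. Qed.

Lemma lincomb_le (X : Type) H K (f : X -> H) (g : X -> K) (M : R) s : 0 <= M ->
  0 <= kform (fun x y => (M ^+ 2)%:C * inner (f x) (f y) - inner (g x) (g y)) s s ->
  nrm (lincomb g s) <= M * nrm (lincomb f s).
Proof.
move=> M0; rewrite kformB kformZ !lincomb_gram -rmorphM -rmorphB ler0c subr_ge0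
  -exprMn.
by rewrite ler_sqr ?nnegrE ?mulr_ge0.
Qed.

Lemma lincomb1 (X : Type) H (f : X -> H) x : lincomb f [:: (1, x)] = f x.
Proof. by rewrite /lincomb big_seq1 scale1r. Qed.

Lemma lincombDZ (X : Type) H (f : X -> H) a s t :
  lincomb f ([seq (a * p.1, p.2) | p <- s] ++ t) = a *: lincomb f s + lincomb f t.
Proof.
rewrite /lincomb big_cat big_map/= scaler_sumr.
by congr (_ + _); apply: eq_bigr => p _; rewrite scalerA.
Qed.

(** |A^* A x - x|^2 = |A^* A x|^2 - 2 |A x|^2 + |x|^2, and for a contraction with |A x| = |x| this
    is at most 0. *)
Lemma adjoint_isometric H K (A : operator H K) x : (forall y, nrm (A y) <= nrm y) ->
  nrm (A x) = nrm x -> adjoint A (A x) = x.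
Proof.
move=> A1 Ax; apply/eqP; rewrite -subr_eq0; apply/eqP/nrm0_eq0/eqP.
rewrite -sqrf_eq0 eq_le sqr_ge0 andbT nrmB_sqr /rin -adjointPr innerxx Ax/=.
have : nrm (adjoint A (A x)) <= nrm x.
  by rewrite -Ax -[leRHS]mul1r; apply: adjoint_le => // y; rewrite mul1r.
have := nrm_ge0 (adjoint A (A x)); have := nrm_ge0 x.
by move: (nrm x) (nrm _) => a b; nra.
Qed.

Lemma isometry_inner H K (A : operator H K) : (forall x, nrm (A x) = nrm x) ->
  forall x y, inner (A x) (A y) = inner x y.
Proof.
move=> A1 x y; rewrite adjointPr adjoint_isometric// => z.
by rewrite A1.
Qed.

(** The inequality between linear combinations makes f x |-> g x well defined on the span and bounds
    it there. Nearly all operators below arise this way, their inequality being the positivity of a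
    kernel. *)
Lemma gram_op (X : Type) H K (f : X -> H) (g : X -> K) (M : R) : 0 <= M ->
  (forall s, nrm (lincomb g s) <= M * nrm (lincomb f s)) ->
  exists A : operator H K,
  [/\ forall x, A (f x) = g x,
      forall x, nrm (A x) <= M * nrm x,
      forall x, (forall y, inner x (f y) = 0) -> A x = 0 &
      ((forall s, nrm (lincomb g s) = nrm (lincomb f s)) ->
        forall x, nrm (A x) <= nrm x /\ A (adjoint A (A x)) = A x)].
Proof.
move=> M0 fg; pose S x z := exists s, x = lincomb f s /\ z = lincomb g s.
have [|a x z x' z' [s [-> ->]] [t [-> ->]]|x z [s [-> ->]]|A [AS AM A0 AI]] :=
    @op_extendP R H K S M M0.
- by exists [::]; rewrite /lincomb !big_nil.
- by exists ([seq (a * p.1, p.2) | p <- s] ++ t); rewrite !lincombDZ.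
- exact: fg.
exists A; split=> //.
- by move=> x; apply: AS; exists [:: (1, x)]; rewrite !lincomb1.
- move=> x xf; apply: A0 => _ z [s [-> _]]; rewrite inner_sumr big1// => p _.
  by rewrite innerZr xf mulr0.
- by move=> h; apply: AI => x z [s [-> ->]].
Qed.

(** If A is the partial isometry that fixes every f x and vanishes on the orthogonal complement,
    then A^* A is the projection onto the closed span. *)
Lemma span_projection (X : Type) H (f : X -> H) : exists Q : operator H H,
  [/\ forall x, Q (f x) = f x,
      forall x, (forall y, inner x (f y) = 0) -> Q x = 0,
      forall x y, inner (Q x) y = inner x (Q y) &
      forall x, Q (Q x) = Q x].
Proof.
have [s|A [Af _ A0 AI]] := @gram_op X H H f f 1 ler01; first by rewrite mul1r.
have {}AI := AI (fun=> erefl).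
exists (compop (adjoint A) A); split=> /=.
- move=> x; rewrite adjoint_isometric ?Af// => y; first by case: (AI y).
- by move=> x /A0 ->; rewrite linear0.
- by move=> x y; rewrite -adjointPr adjointP.
- by move=> x; have [_ ->] := AI x.
Qed.

Lemma gram_isometry H K (f : nat -> H) (g : nat -> K) :
  (forall x (e : R), 0 < e -> exists n, nrm (x - f n) < e) ->
  (forall i j, inner (g i) (g j) = inner (f i) (f j)) ->
  exists2 J : operator H K, forall n, J (f n) = g n & forall x, nrm (J x) = nrm x.
Proof.
move=> dP fg.
have fds s : nrm (lincomb g s) = nrm (lincomb f s).
  apply/eqP; rewrite -(@eqrXn2 _ 2)//; apply/eqP; apply: complexI.
  by rewrite -!lincomb_gram; apply: eq_kform.
have [s|J [Jd J1 _ _]] := @gram_op _ _ _ f g 1 ler01; first by rewrite mul1r fds.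
exists J => // x; apply/eqP; rewrite eq_le -[leRHS]mul1r J1/=.
apply: (@ler_eps _ _ _ 2) => e e0; have [n xn] := dP x e e0.
have Jn : nrm (J (f n)) = nrm (f n) by rewrite Jd -(lincomb1 g n) fds lincomb1.
have := J1 (f n - x); rewrite linearB/= mul1r nrmBC.
have := nrmB x (f n) 0; rewrite !subr0; have := nrmB (J (f n)) (J x) 0; rewrite
  !subr0.
rewrite nrmBC -(nrmBC (f n)) Jn (nrmBC (f n)).
move: xn; rewrite (nrmBC (J x)); lra.
Qed.

(** Kolmogorov's construction applied to the Gram kernel of a dense sequence. *)
Lemma l2_embedding H : exists J : operator H (l2 (Cplx R)),
  forall x, nrm (J x) = nrm x.
Proof.
have [d dP] := @separable_seq _ H.
have [f fd] := kolmogorov_nat (gram_psd d).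
by have [J _ JI] := gram_isometry dP fd; exists J.
Qed.

(** A norm bound put as positivity of a kernel, the form in which it can be multiplied with other
    kernels by [psdM]. *)
Lemma psd_bound H K (A : operator H K) (M : R) : 0 <= M ->
  (forall x, nrm (A x) <= M * nrm x) ->
  psd (fun x y => (M ^+ 2)%:C * inner x y - inner (A x) (A y)).
Proof.
move=> M0 AM s; rewrite kformB kformZ (lincomb_gram id) (lincomb_gram A).
rewrite -rmorphM -rmorphB ler0c subr_ge0 -exprMn ler_sqr ?nnegrE ?mulr_ge0//.
have -> : lincomb A s = A (lincomb id s).
  by rewrite /lincomb linear_sum; apply: eq_bigr => p _; rewrite linearZ.
exact: AM.
Qed.

End GramOperator.

Section TensorOperator.
Context {R : realType} {Y E : hilbertType R} (T : hilbert_tensor Y E).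

Lemma tensor_lincomb_dense : dense [set lincomb (fun p : Y * E => tensor T p.1
  p.2) s | s in setT].
Proof.
apply/hdenseP => x e e0; have [_ [n [y [e' ->]] xe]] := (hdenseP _).1
  (dense_tensor (h:=T)) x e e0.
exists (\sum_(i < n) tensor T (y i) (e' i)) => //.
exists [seq (1, (y i, e' i)) | i <- enum 'I_n] => //.
by rewrite /lincomb big_map big_enum; apply: eq_bigr => i _; rewrite scale1r.
Qed.

Lemma tensor_ext (K : hilbertType R) (A B : operator T K) :
  (forall y e, A (tensor T y e) = B (tensor T y e)) -> A = B.
Proof.
move=> AB; apply: (op_eq_dense tensor_lincomb_dense) => _ [s _ <-].
by rewrite /lincomb !linear_sum; apply: eq_bigr => p _; rewrite !linearZ/= AB.
Qed.

Lemma tensoropP A B y e : tensorop T A B (tensor T y e) = tensor T (A y) (B e).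
Proof.
suff [D DP] : exists D : operator T T,
    forall y e, D (tensor T y e) = tensor T (A y) (B e).
  have := @xgetPex _ (0 : operator T T)
    [set D : operator T T | forall y e, D (tensor T y e) = tensor T (A y) (B e)].
  by move=> /(_ (ex_intro _ D DP))/(_ y e).
have [M M0 AM] := op_bound A; have [M' M0' BM] := op_bound B.
have [s|D [DP _ _ _]] := @gram_op R (Y * E) T T (fun p => tensor T p.1 p.2)
   (fun p => tensor T (A p.1) (B p.2)) (M * M') (mulr_ge0 M0 M0'); last first.
  by exists D => y' e'; rewrite (DP (y', e')).
apply: lincomb_le; first exact: mulr_ge0.
(* M^2 M'^2 <y,y'><e,e'> - <A y,A y'><B e,B e'> is the sum of (M^2 <y,y'> - <A y,A y'>) <B e,B e'>
   and M^2 <y,y'> (M'^2 <e,e'> - <B e,B e'>), both Schur products of positive semidefinite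
   kernels. *)
have h1 := psdM (psd_comp (fun p : Y * E => p.1) (psd_bound M0 AM))
  (psd_comp (fun p : Y * E => p.2) (gram_psd B)).
have h2 := psdM (psd_comp (fun p : Y * E => p.1) (gram_psd id))
  (psd_comp (fun p : Y * E => p.2) (psd_bound M0' BM)).
have M2 : 0 <= (M ^+ 2)%:C by rewrite ler0c sqr_ge0.
have := psdD h1 (psdZ M2 h2) s.
congr (0 <= _); apply: eq_kform => p q; rewrite !inner_tensor exprMn rmorphM; ring.
Qed.

End TensorOperator.

(** * Unitary dilation of a partial isometry *)

Section Halmos.
Context {R : realType} {H : hilbertType R}.

Lemma nrm_delta i (x : H) : nrm (l2_delta i x) = nrm x.
Proof.
apply/eqP; rewrite -(@eqrXn2 _ 2)// -!rinxx /rin inner_delta l2_deltaE eqxx.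
by [].
Qed.

Lemma delta_op i : exists D : operator H (l2 H), forall x, D x = l2_delta i x.
Proof.
apply: (@bounded_linear_op _ _ _ _ 1); first exact: l2_delta_linear.
by move=> x; rewrite nrm_delta mul1r.
Qed.

Lemma coord_op i : exists P : operator (l2 H) H, forall x, P x = x i.
Proof.
apply: (@bounded_linear_op _ _ _ (fun x : l2 H => x i) 1) => // x.
by rewrite mul1r; exact: l2coord.
Qed.

(** The block matrix with rows (A, 1 - A B) and (1 - B A, - B) on the coordinates 0 and 1, and the
    identity on the others, written as a perturbation of x so that it visibly stays in l2. For B =
    A^* and A a partial isometry, the off-diagonal blocks are projections, hence their own square
    roots. *)
Definition halmos (A B : operator H H) (x : l2 H) : l2 H :=
  x + l2_delta 0 (A (x 0%N) + (x 1%N - A (B (x 1%N))) - x 0%N)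
    + l2_delta 1 (x 0%N - B (A (x 0%N)) - B (x 1%N) - x 1%N).

Lemma halmos_op A B : exists U : operator (l2 H) (l2 H), forall x, U x = halmos A
  B x.
Proof.
have [D0 D0P] := delta_op 0; have [D1 D1P] := delta_op 1.
have [P0 P0P] := coord_op 0; have [P1 P1P] := coord_op 1.
exists (idop _ + compop D0 (compop A P0 + (P1 - compop A (compop B P1)) - P0)
   + compop D1 (P0 - compop B (compop A P0) - compop B P1 - P1)) => x.
rewrite /halmos -D0P -D1P -P0P -P1P.
by [].
Qed.

Lemma halmosE A B x i : halmos A B x i =
  if i == 0%N then A (x 0%N) + (x 1%N - A (B (x 1%N)))
  else if i == 1%N then x 0%N - B (A (x 0%N)) - B (x 1%N) else x i.
Proof.
have -> : halmos A B x i = x i + l2_delta 0 (A (x 0%N) + (x 1%N - A (B (x 1%N)))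
  - x 0%N) i
    + l2_delta 1 (x 0%N - B (A (x 0%N)) - B (x 1%N) - x 1%N) i by [].
rewrite !l2_deltaE; case: i => [|[|i]]/=; rewrite ?addr0//.
  by rewrite addrC subrK.
by rewrite addrC subrK.
Qed.

Lemma halmosK (A B : operator H H) x : (forall x, A (B (A x)) = A x) ->
  (forall x, B (A (B x)) = B x) -> halmos B A (halmos A B x) = x.
Proof.
move=> ABA BAB; apply: l2_ext => i; rewrite !halmosE/=.
set a := x 0%N; set b := x 1%N.
have e1 : B (A a + (b - A (B b))) = B (A a).
  by rewrite opD opB BAB subrr addr0.
have e2 : A (a - B (A a) - B b) = - A (B b).
  by rewrite !opB ABA subrr sub0r.
rewrite e1 e2 opN BAB opprK.
case: i => [|[|i]]//=.
  by rewrite subrK addrC subrK.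
by rewrite ABA opprK (addrC (A a)) addrK subrK.
Qed.

(* Halmos' dilation, acting on the first two coordinates of l2 H. *)
Lemma halmos_dilation (A : operator H H) :
  (forall x, A (adjoint A (A x)) = A x) ->
  exists U U' : operator (l2 H) (l2 H),
  [/\ forall x y, inner (U x) y = inner x (U' y),
      forall x, U' (U x) = x, forall x, U (U' x) = x &
      forall x, adjoint A (A x) = x -> U (l2_delta 0 x) = l2_delta 0 (A x)].
Proof.
move=> AAA; set B := adjoint A.
have AB u v : inner (A u) v = inner u (B v) by exact: adjointP.
have BA u v : inner (B u) v = inner u (A v) by rewrite adjointPr.
have BAB x : B (A (B x)) = B x.
  by apply: inner_extl => y; rewrite BA AB BA AAA BA.
have [U UP] := halmos_op A B; have [U' UP'] := halmos_op B A.
exists U, U'; split.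
- move=> x y; rewrite UP UP' /halmos !innerDl !inner_delta.
  rewrite !innerDr ![inner x (l2_delta _ _)]inner_conj !inner_delta -!inner_conj.
  rewrite !(innerDl, innerNl, innerDr, innerNr) !(AB, BA); ring.
- by move=> x; rewrite UP' UP halmosK.
- by move=> x; rewrite UP' UP halmosK.
- move=> x BAx; rewrite UP; apply: l2_ext => i; rewrite halmosE !l2_deltaE/=.
  by rewrite !op0 !subr0 addr0 BAx subrr; case: i => [|[|i]].
Qed.

End Halmos.

(** * From unitary pencils to the Herglotz-Agler class *)

Section Pencil.
Context {R : realType} {N : nat} {H : hilbertType R} (G : 'I_N -> operator H H).
Hypothesis Gu : unitary_pencil G.

Lemma pencil_inner (zeta : 'I_N -> R[i]) x y : (forall k, `|zeta k| = 1) ->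
  inner (\sum_k zeta k *: G k x) (\sum_k zeta k *: G k y) = inner x y.
Proof.
move=> /Gu[/(congr1 (fun A : operator H H => A y)) /= UU _].
have E z : \sum_k zeta k *: G k z = (\sum_(k < N) zeta k *: G k) z by rewrite
  sumopE.
by rewrite !E adjointP UU.
Qed.

(* Varying zeta_p over {1, -1, i, -i} and zeta_q over {1, -1} isolates the Fourier
   coefficient <G_p x, G_q y> of a constant function on the torus. *)
Lemma pencil_orth p q x y : p != q -> inner (G p x) (G q y) = 0.
Proof.
move=> pq.
pose zeta (e h : R[i]) k := if k == p then e else if k == q then h else 1.
pose a z := \sum_(k | (k != p) && (k != q)) G k z.
have zE e h z : \sum_k zeta e h k *: G k z = e *: G p z + (h *: G q z + a z).
  rewrite (bigD1 p)//= {1}/zeta eqxx (bigD1 q) 1?eq_sym//= {1}/zeta eqxx.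
  rewrite eq_sym (negbTE pq); congr (_ + (_ + _)); apply: eq_bigr => k /andP[kp kq].
  by rewrite /zeta (negbTE kp) (negbTE kq) scale1r.
have key e h : `|e| = 1 -> `|h| = 1 ->
    inner (e *: G p x + (h *: G q x + a x)) (e *: G p y + (h *: G q y + a y)) =
      inner x y.
  move=> e1 h1; rewrite -!zE pencil_inner// => k.
  by rewrite /zeta; case: eqP => // _; case: eqP => // _; rewrite normr1.
have n1 : `|1 : R[i]| = 1 by rewrite normr1.
have nN1 : `|-1 : R[i]| = 1 by rewrite normrN1.
have ni : `|'i : R[i]| = 1 by rewrite normc_def/= expr0n expr1n/= add0r sqrtr1.
have nNi : `|- 'i : R[i]| = 1 by rewrite normrN.
have ci : Num.conj ('i : R[i]) = - 'i by apply/eqP; rewrite eq_complex/= oppr0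
  !eqxx.
have cNi : Num.conj (- 'i : R[i]) = 'i by apply/eqP; rewrite eq_complex/= oppr0
  opprK !eqxx.
have cN1 : Num.conj (-1 : R[i]) = -1 by rewrite rmorphN rmorph1.
have ii : 'i * 'i = -1 :> R[i] by rewrite -expr2 sqr_i.
have d e : `|e| = 1 -> inner (a x) (G q y) + e * inner (G p x) (G q y) +
    inner (G q x) (a y) + Num.conj e * inner (G q x) (G p y) = 0.
  move=> e1; have := key e 1 e1 n1; rewrite -(key e (-1) e1 nN1).
  rewrite !(innerDl, innerDr, innerZl, innerZr) rmorphN rmorph1 => h.
  have {}h : 2 * (inner (a x) (G q y) + e * inner (G p x) (G q y) +
    inner (G q x) (a y) + Num.conj e * inner (G q x) (G p y)) = 0.
    by move/eqP: h; rewrite -subr_eq0 => /eqP h; rewrite -[RHS]h; ring.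
  by move/eqP: h; rewrite mulf_eq0 pnatr_eq0/= => /eqP.
have d1 := d 1 n1; have dN1 := d (-1) nN1; have di := d 'i ni; have dNi := d (-
  'i) nNi.
move: d1 dN1 di dNi; rewrite rmorph1 cN1 ci cNi.
move: (inner (a x) _) (inner (G p x) _) (inner (G q x) (a y)) (inner (G q x) (G p
  y)) => u v w z.
move=> d1 dN1 di dNi.
(* e = 1, -1 give v + z = 0 and e = 'i, -'i give v - z = 0; here v is the wanted inner product and z
   the one with p and q exchanged. *)
have h1 : v + z = 0.
  have : 2 * (v + z) = 0.
    rewrite (_ : _ * _ = u + 1 * v + w + 1 * z - (u + -1 * v + w + -1 * z)).
      by rewrite d1 dN1 subrr.
    ring.
  by move/eqP; rewrite mulf_eq0 pnatr_eq0/= => /eqP.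
have h2 : v - z = 0.
  have : 2 * (v - z) = 0.
    have e : 2 * 'i * (v - z) = 0.
      rewrite (_ : _ * _ = u + 'i * v + w + - 'i * z - (u + - 'i * v + w + 'i * z)).
        by rewrite di dNi subrr.
      ring.
    have -> : 2 * (v - z) = - ('i * 'i) * (2 * (v - z)) by rewrite ii opprK mul1r.
    rewrite (_ : _ * _ = - 'i * (2 * 'i * (v - z))); first by rewrite e mulr0.
    ring.
  by move/eqP; rewrite mulf_eq0 pnatr_eq0/= => /eqP.
have : 2 * v = 0 by rewrite (_ : _ * _ = v + z + (v - z)); [rewrite h1 h2
  addr0|ring].
by move/eqP; rewrite mulf_eq0 pnatr_eq0/= => /eqP.
Qed.

(** This is sum_k G_k^* G_k = 1: unitarity at zeta = (1, ..., 1), where all cross terms vanish by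
    [pencil_orth]. *)
Lemma pencil_sum x y : \sum_k inner (G k x) (G k y) = inner x y.
Proof.
rewrite -(@pencil_inner (fun=> 1)) => [|k]; last exact: normr1.
rewrite inner_suml; apply: eq_bigr => k _; rewrite inner_sumr (bigD1 k)//= big1.
  by rewrite !scale1r addr0.
by move=> j jk; rewrite !scale1r pencil_orth// eq_sym.
Qed.

End Pencil.

Section TensorInner.
Context {R : realType} {Y E : hilbertType R} (T : hilbert_tensor Y E).

Lemma tensor_inner_ext (x x' : T) :
  (forall y e, inner x (tensor T y e) = inner x' (tensor T y e)) -> x = x'.
Proof.
move=> xx'; apply/eqP; rewrite -subr_eq0; apply/eqP/nrm0_eq0/eqP.
rewrite -sqrf_eq0 -rinxx /rin.
pose D := [set lincomb (fun p : Y * E => tensor T p.1 p.2) s | s in setT].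
rewrite (@orth_adh _ _ D _ _ (x - x'))//.
  move=> _ [s _ <-]; rewrite inner_sumr big1// => p _.
  by rewrite innerZr innerBl xx' subrr mulr0.
move=> e e0; have [d Dd xd] := (hdenseP _).1 (@tensor_lincomb_dense _ _ _ T) (x -
  x') e e0.
by exists d.
Qed.

End TensorInner.

Lemma big_tuple_cons (V : nmodType) (I : finType) m (F : seq I -> V) :
  \sum_(w : m.+1.-tuple I) F w = \sum_k \sum_(w : m.-tuple I) F (k :: w).
Proof.
rewrite pair_bigA /= (reindex (fun p : I * m.-tuple I => [tuple of p.1 :: p.2]))//=.
exists (fun w : m.+1.-tuple I => (thead w, [tuple of behead w])) => [[k w]|w] _ /=.
  by congr (_, _); apply: val_inj.
by rewrite [w in RHS]tuple_eta.
Qed.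

Section Sufficiency.
Context {R : realType} {N : nat} {Y H : hilbertType R} (G : 'I_N -> operator H H).
Variable V : operator Y H.
Hypothesis Gu : unitary_pencil G.
Hypothesis VI : isometryop V.

Definition herglotz_coef (w : word N) : operator Y Y :=
  if w is [::] then 2^-1 *: idop Y else compop (adjoint V) (compop (opword G w) V).

Section FixE.
Variables (E : hilbertType R) (C : 'I_N -> operator E E) (T : hilbert_tensor Y E).
Variable r : R.
Hypothesis r0 : 0 <= r.
Hypothesis r1 : r < 1.
Hypothesis Cr : forall k x, nrm (C k x) <= r * nrm x.

Lemma isometryop_nrm x : nrm (V x) = nrm x.
Proof. by rewrite /nrm VI. Qed.

(* A is sum_k G_k (x) C_k and J is V (x) 1, on the model l2 H of H (x) E. *)
Lemma contraction_model : exists (J : operator T (l2 H)) (A : operator (l2 H) (l2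
  H)),
  [/\ forall x, nrm (J x) = nrm x, forall x, nrm (A x) <= r * nrm x &
      forall m, (0 < m)%N -> homogeneous_part T herglotz_coef C m =
         compop (adjoint J) (compop (iter m (compop A) (idop _)) J)].
Proof.
(* With E embedded isometrically in l2, the vectors [t (h, e)] realise the elementary tensors of H
   and E inside [l2 H]. *)
have [L LI] := l2_embedding E; have LL := isometry_inner LI.
pose t (p : H * E) := l2_tensor p.1 (L p.2).
have tt p q : inner (t p) (t q) = inner p.1 q.1 * inner p.2 q.2.
  by rewrite inner_l2_tensor LL.
have [s|A [At Ar _ _]] := @gram_op R (H * E) _ _ t
    (fun p => \sum_k t (G k p.1, C k p.2)) r r0.
  apply: lincomb_le => //.
  (* By [pencil_sum], the kernel for |A| <= r splits as the sum over k of <G_k x,G_k x'> (r^2 <e,e'>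
     - <C_k e,C_k e'>), with Schur products as summands. *)
  have pk (k : 'I_N) : psd (fun p q : H * E => inner (G k p.1) (G k q.1) *
       ((r ^+ 2)%:C * inner p.2 q.2 - inner (C k p.2) (C k q.2))).
    exact: psdM (psd_comp fst (gram_psd (G k))) (psd_comp snd (psd_bound r0 (Cr
      k))).
  have := psd_sum (index_enum 'I_N) (P := xpredT) (fun k _ => pk k) s.
  congr (0 <= _); apply: eq_kform => p q.
  rewrite tt -(pencil_sum Gu p.1) mulr_suml mulr_sumr inner_suml -sumrB.
  apply: eq_bigr => k _; rewrite inner_sumr (bigD1 k)//= big1 ?addr0 ?tt/=; last
    first.
    by move=> l lk; rewrite tt pencil_orth ?mul0r// eq_sym.
  by rewrite mulrBr mulrCA.
have VV := isometry_inner isometryop_nrm.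
have [s|J [JT J1 _ _]] := @gram_op R (Y * E) _ _ (fun p => tensor T p.1 p.2)
    (fun p => t (V p.1, p.2)) 1 ler01.
  apply: lincomb_le => //; rewrite expr1n.
  rewrite (_ : kform _ s s = 0)// /kform big1// => p _; rewrite big1// => q _.
  by rewrite tt/= VV inner_tensor mul1r subrr mulr0.
have {}J1 x : nrm (J x) <= nrm x by have := J1 x; rewrite mul1r.
have {}JT y e : J (tensor T y e) = t (V y, e) by exact: (JT (y, e)).
have JJ : compop (adjoint J) J = idop T.
  apply: tensor_ext => y e /=; apply: adjoint_isometric => //.
  rewrite JT; apply/eqP; rewrite -(@eqrXn2 _ 2)// -!rinxx /rin tt/= VV inner_tensor.
  by [].
exists J, A; split=> //.
  move=> x; apply/eqP; rewrite -(@eqrXn2 _ 2)// -!rinxx /rin adjointP.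
  by have := congr1 (fun A : operator T T => A x) JJ => /= ->.
have Am m h e : iter m (compop A) (idop _) (t (h, e)) =
    \sum_(w : m.-tuple 'I_N) t (opword G w h, opword C w e).
  elim: m => [|m IH].
    rewrite (big_pred1 [tuple]) => [|w]; first by [].
    by rewrite [w]tuple0 /= eqxx.
  rewrite /= IH op_sum (big_tuple_cons _ (fun w => t (opword G w h, opword C w e))).
  by rewrite exchange_big; apply: eq_bigr => w _; rewrite At.
have Jt h e : adjoint J (t (h, e)) = tensor T (adjoint V h) e.
  apply: tensor_inner_ext => y e'.
  by rewrite -adjointPr JT tt inner_tensor/= -adjointPr.
move=> m m0; apply: tensor_ext => y e.
rewrite /homogeneous_part sumopE [RHS]/= JT Am op_sum; apply: eq_bigr => w _.
(* For m > 0 the word is nonempty, so its coefficient is the compression of G^w and not the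
   exceptional 1/2. *)
rewrite tensoropP Jt; case: m m0 w => // m _ w.
by rewrite (tuple_eta w).
Qed.


Lemma homogeneous_part0 : homogeneous_part T herglotz_coef C 0 = 2^-1 *: idop T.
Proof.
apply: tensor_ext => y e; rewrite /homogeneous_part sumopE.
rewrite (big_pred1 [tuple]) => [|w]; last by rewrite [w]tuple0 /= eqxx.
by rewrite tensoropP /= linearZl_LR.
Qed.

Lemma homogeneous_bound m x :
  nrm (homogeneous_part T herglotz_coef C m x) <= r ^+ m * nrm x.
Proof.
have [J [A [JI Ar hom]]] := contraction_model.
case: m => [|m].
  rewrite homogeneous_part0 nrmZ expr0 ler_wpM2r//.
  rewrite normfV ger0_norm ?ler0n// -(rmorph_nat (real_complex R)) -fmorphV/=.
  by rewrite invf_le1 ?ltr0n// ler1n.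
have JA y : nrm (adjoint J y) <= nrm y.
  by rewrite -[leRHS]mul1r; apply: adjoint_le => // z; rewrite mul1r JI.
have it k y : nrm (iter k (compop A) (idop _) y) <= r ^+ k * nrm y.
  elim: k => [|k IH]; first by rewrite expr0 mul1r.
  by rewrite (le_trans (Ar _))// exprS -mulrA ler_wpM2l.
by rewrite hom// (le_trans (JA _))// (le_trans (it _ _))// JI.
Qed.

Lemma geometric_tail n m : (n <= m)%N ->
  \sum_(n <= k < m) r ^+ k <= r ^+ n * (1 - r)^-1.
Proof.
move=> nm; have r10 : 0 < 1 - r by rewrite subr_gt0.
rewrite ler_pdivlMr// mulr_suml.
rewrite (eq_big_nat _ _ (F2 := fun k => - (r ^+ k.+1 - r ^+ k))); last first.
  by move=> k _; rewrite exprS; ring.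
by rewrite sumrN telescope_sumr// opprB gerBl exprn_ge0.
Qed.

Lemma sum_op_diff (K : hilbertType R) (F : nat -> operator K K) n m x : (n <=
  m)%N ->
  (\sum_(0 <= k < m) F k) x - (\sum_(0 <= k < n) F k) x = \sum_(n <= k < m) F k x.
Proof. by move=> nm; rewrite !sumopE sum_nat_sub. Qed.

(* With u = sum_(m <= n) A^m xi one has xi = u - A u + A^(n+1) xi, whence
   2 Re <u, xi> - |xi|^2 = |u|^2 - |u - xi|^2 = |u|^2 - |A u - A^(n+1) xi|^2. *)
Lemma partial_sum_lower_bound n x :
  - (r ^+ n * (2 * (1 - r)^-1 + 1) * nrm x ^+ 2) <=
  2 * rin ((\sum_(0 <= m < n.+1) homogeneous_part T herglotz_coef C m) x) x.
Proof.
have [J [A [JI Ar hom]]] := contraction_model.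
pose B m := iter m (compop A) (idop (l2 H)).
pose xi := J x; pose u := \sum_(0 <= m < n.+1) B m xi.
have BS m y : B m.+1 y = A (B m y) by [].
have it k y : nrm (B k y) <= r ^+ k * nrm y.
  elim: k => [|k IH]; first by rewrite expr0 mul1r.
  by rewrite BS (le_trans (Ar _))// exprS -mulrA ler_wpM2l.
have uE : u - xi = A u - B n.+1 xi.
  rewrite /u op_sum.
  rewrite [X in _ = X - _](_ : _ = \sum_(0 <= m < n.+1) B m.+1 xi)//.
  by rewrite big_nat_recl// addrC addKr big_nat_recr//= addrK.
(* The sum [u] starts with [xi] while f starts with 1/2, which accounts for the term |xi|^2. *)
have sE : 2 * rin ((\sum_(0 <= m < n.+1) homogeneous_part T herglotz_coef C m) x)
  x =
    2 * rin u xi - nrm xi ^+ 2.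
  rewrite sumopE /u !big_nat_recl// homogeneous_part0 !rinDl.
  have -> : rin ((2^-1 *: idop T) x) x = 2^-1 * nrm x ^+ 2.
    by rewrite scaleopE /= -rinxx -rinZl fmorphV rmorph_nat.
  have -> : rin (B 0%N xi) xi = nrm xi ^+ 2 by rewrite rinxx.
  have -> : rin (\sum_(0 <= i < n) homogeneous_part T herglotz_coef C i.+1 x) x =
     rin (\sum_(0 <= i < n) B i.+1 xi) xi.
    rewrite /rin !inner_suml; congr complex.Re; apply: eq_bigr => i _.
    by rewrite hom// -adjointPr.
  by rewrite /xi JI; field.
have un : nrm u <= (1 - r)^-1 * nrm xi.
  apply: (@le_trans _ _ (\sum_(0 <= k < n.+1) r ^+ k * nrm xi)).
    rewrite /u; elim/big_ind2: _ => [|a b c d ab cd|k _]; first by rewrite nrm0.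
      by rewrite (le_trans (nrmD _ _))// lerD.
    exact: it.
  by rewrite -mulr_suml ler_wpM2r// -[leRHS]mul1r -(expr0 r) geometric_tail.
have rn0 : 0 <= r ^+ n by rewrite exprn_ge0.
have rnS : r ^+ n.+1 <= r ^+ n by rewrite exprS ler_piMl// ltW.
have rn1 : r ^+ n <= 1 by rewrite exprn_ile1// ltW.
(* Squaring this gives the constant: the cross term is at most 2 (1 - r)^-1 r^n |xi|^2, and r^(2n)
   |xi|^2 <= r^n |xi|^2 yields the 1. *)
have h1 : nrm (u - xi) <= nrm u + r ^+ n * nrm xi.
  rewrite uE (le_trans (nrmD _ _))// nrmN lerD//.
    by rewrite (le_trans (Ar _))// ler_piMl// ltW.
  by rewrite (le_trans (it _ _))// ler_wpM2r.
have h2 : nrm (u - xi) ^+ 2 <= (nrm u + r ^+ n * nrm xi) ^+ 2.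
  by rewrite ler_sqr ?nnegrE ?addr_ge0 ?mulr_ge0.
rewrite sE -[nrm x]JI -/xi.
move: h2; rewrite nrmB_sqr => h2.
have h3 : nrm u * (r ^+ n * nrm xi) <= (1 - r)^-1 * nrm xi * (r ^+ n * nrm xi).
  by rewrite ler_wpM2r// mulr_ge0.
have h4 : (r ^+ n * nrm xi) ^+ 2 <= r ^+ n * nrm xi ^+ 2.
  by rewrite exprMn ler_wpM2r ?sqr_ge0// expr2 ler_piMl.
move: h2 h3 h4; move: (1 - r)^-1 (r ^+ n) (nrm xi) (nrm u) (rin u xi) => p q a b c.
rewrite !expr2; lra.
Qed.

Lemma herglotz_sum : exists S : operator T T,
  converges_to herglotz_coef C S /\ psdop (reop S).
Proof.
pose SS n := \sum_(0 <= m < n) homogeneous_part T herglotz_coef C m.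
pose eps n := r ^+ n * (1 - r)^-1.
have r10 : 0 < 1 - r by rewrite subr_gt0.
have eps0 n : 0 <= eps n by rewrite mulr_ge0 ?exprn_ge0 ?invr_ge0 ?(ltW r10).
have rlim : (fun n => r ^+ n) @ \oo --> (0 : R).
  by apply: cvg_expr; rewrite ger0_norm.
have small (c e : R) : 0 < e -> exists M, forall n, (M <= n)%N -> r ^+ n * c < e.
  move=> e0; have c1 : 0 < `|c| + 1 by rewrite ltr_wpDl.
  have /cvgrPdist_lt/(_ (e / (`|c| + 1))) := rlim.
  rewrite divr_gt0// => /(_ isT)[M _ MP]; exists M => n /MP /=.
  rewrite sub0r normrN ger0_norm ?exprn_ge0// ltr_pdivlMr// => h.
  apply: le_lt_trans h; rewrite ler_wpM2l ?exprn_ge0//.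
  by rewrite (le_trans (ler_norm _))// lerDl.
have [n m x nm|S SP] := op_lim eps0 (small (1 - r)^-1) (A := SS).
  rewrite sum_op_diff// (le_trans (_ : _ <= \sum_(n <= k < m) r ^+ k * nrm x))//.
    elim/big_ind2: _ => [|a b c d ab cd|k _]; first by rewrite nrm0.
      by rewrite (le_trans (nrmD _ _))// lerD.
    exact: homogeneous_bound.
  by rewrite -mulr_suml ler_wpM2r// geometric_tail.
exists S; split.
  apply/cvgrPdist_lt => e e0; have [M MP] := small (1 - r)^-1 e e0.
  exists M => // n /MP h /=; rewrite sub0r normrN ger0_norm ?opnorm_ge0//.
  by apply: le_lt_trans h; apply: opnorm_le => [|x]; [exact: eps0|exact: SP].
move=> x.
rewrite reop_inner ler0c -(pmulr_rge0 _ (ltr0n R 2)).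
(* One [e] comes from the lower bound for partial sums, two from replacing twice the partial sum by
   twice [S]. *)
apply: (@ler_eps _ _ _ 3) => e e0.
have [M1 h1] := small ((2 * (1 - r)^-1 + 1) * nrm x ^+ 2) e e0.
have [M2 h2] := small ((1 - r)^-1 * nrm x ^+ 2) e e0.
pose n := maxn M1 M2.
have {}h1 := h1 n (leq_maxl _ _); have {}h2 := h2 n (leq_maxr _ _).
have := partial_sum_lower_bound n x; rewrite -/(SS n.+1) -mulrA.
have : rin (SS n.+1 x) x - rin (S x) x <= r ^+ n * ((1 - r)^-1 * nrm x ^+ 2).
  rewrite -rinNl -rinDl (le_trans (ler_norm _))// (le_trans (rin_le _ _))//.
  rewrite (le_trans (ler_wpM2r _ (SP _ _)))// /eps exprS.
  rewrite [leLHS](_ : _ = r * (r ^+ n * ((1 - r)^-1 * nrm x ^+ 2))); last first.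
    by move: (1 - r)^-1 => p; ring.
  rewrite ler_piMl ?(ltW r1)//.
  by rewrite mulr_ge0 ?exprn_ge0// mulr_ge0 ?sqr_ge0// invr_ge0 ltW.
move: h1 h2; lra.
Qed.

End FixE.

Lemma herglotz_coef_agler : herglotz_agler herglotz_coef.
Proof.
move=> E C C1 T.
(* As there are finitely many C_k, one r < 1 bounds all their norms. *)
pose r := \big[Num.max/0]_k opnorm (C k).
have r0 : 0 <= r by apply: bigmax_ge_id.
have r1 : r < 1 by apply: bigmax_lt.
apply: (@herglotz_sum E C T r) => // k x.
by rewrite (le_trans (opnormP _ _))// ler_wpM2r// le_bigmax.
Qed.

End Sufficiency.

(** * Agler decompositions *)

Section Cone.
Context {R : realType} {H : hilbertType R}.

(** Let p be the point of the closed cone nearest to d. Moving p along a q of the cone gives <q, p -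
    d> >= 0, and moving it towards 0 gives <d - p, p> >= 0. The dual hypothesis for p - d then
    forces |d - p|^2 <= 0. *)
Lemma cone_adh (K : set H) (d : H) : K 0 ->
  (forall (t : R) a b, 0 <= t -> K a -> K b -> K (t%:C *: a + b)) ->
  (forall L, (forall q, K q -> 0 <= rin q L) -> 0 <= rin d L) -> adh K d.
Proof.
move=> K0 KD dual.
have KDa t a b : 0 <= t -> adh K a -> adh K b -> adh K (t%:C *: a + b).
  move=> t0 aK bK e e0.
  have e' : 0 < e / 2 / (complex.Re `|t%:C| + 1).
    by rewrite !divr_gt0// ltr_wpDl// ge0_Re.
  have e2 : 0 < e / 2 by rewrite divr_gt0.
  have [a' Ka' aa'] := aK _ e'; have [b' Kb' bb'] := bK _ e2.
  exists (t%:C *: a' + b'); first exact: KD.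
  by rewrite opprD addrACA -scalerBr nrm_comb.
have [|a b Ka Kb|p Kp pmin] := @nearest_point _ _ K d.
- by exists 0.
- rewrite -[_ *: _]addr0; apply: (KD); rewrite ?invr_ge0//.
  by rewrite -[a]scale1r -(rmorph1 (real_complex R)); exact: KD.
have h1 q : K q -> 0 <= rin q (p - d).
  move=> Kq; rewrite rinC -opprB rinNl oppr_ge0; apply: variation => t t0 _.
  rewrite (_ : d - p - t%:C *: q = d - (t%:C *: q + p)).
    by apply: pmin; apply: KDa => //; [exact: ltW|exact: sub_adh].
  by rewrite opprD [- _ - p]addrC addrA.
have h2 : rin (d - p) (- p) <= 0.
  apply: variation => t t0 t1.
  rewrite (_ : d - p - t%:C *: - p = d - ((1 - t)%:C *: p + 0)).
    by apply: pmin; apply: KDa => //; [rewrite subr_ge0|exact: sub_adh].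
  by rewrite addr0 rmorphB rmorph1 scalerBl scale1r scalerN opprK opprB addrA
    addrAC.
suff -> : d = p by [].
apply/eqP; rewrite -subr_eq0; apply/eqP/nrm0_eq0/eqP; rewrite -sqrf_eq0 eq_le
  sqr_ge0 andbT.
have := dual _ h1; move: h2; rewrite rinNr -(opprB d) rinNr (rinC d).
rewrite -rinxx (rinDr (d - p)) rinNr; lra.
Qed.

End Cone.

Section Agler.
Context {R : realType} {N : nat}.
Local Notation lC := (l2 (Cplx R)).
Local Notation X := (word N * nat)%type.
Implicit Types (K : X -> X -> R[i]) (u : X -> R[i]).

Definition unrcons (w : word N) : option (word N * 'I_N) :=
  if w is x :: s then Some (belast x s, last x s) else None.

Lemma unrcons_rcons w k : unrcons (rcons w k) = Some (w, k).
Proof. by case: w => //= x s; rewrite belast_rcons last_rcons. Qed.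

(* Right multiplication by g_k on finitely supported functions of words; the
   second component of X indexes a sequence of vectors of Y. *)
Definition shift (k : 'I_N) u (a : X) : R[i] :=
  if unrcons a.1 is Some (w, l) then (if l == k then u (w, a.2) else 0) else 0.

Lemma shift_nil k u i : shift k u ([::], i) = 0.
Proof. by []. Qed.

Lemma shift_rcons k u w l i :
  shift k u (rcons w l, i) = if l == k then u (w, i) else 0.
Proof. by rewrite /shift unrcons_rcons. Qed.

Definition kshift (k : 'I_N) K (a b : X) : R[i] :=
  shift k (fun a' => shift k (K a') b) a.

Lemma kshift_nill k K i b : kshift k K ([::], i) b = 0.
Proof. by []. Qed.

Lemma kshift_nilr k K a i : kshift k K a ([::], i) = 0.
Proof.
by rewrite /kshift /shift; case: unrcons => [[w l]|]//; case: ifP.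
Qed.

Lemma kshift_rcons k K w l i v m j : kshift k K (rcons w l, i) (rcons v m, j) =
  if (l == k) && (m == k) then K (w, i) (v, j) else 0.
Proof. by rewrite /kshift !shift_rcons; case: ifP. Qed.

(* The coefficients of sum_k (K_k(z, w) - z_k K_k(z, w) conj(w_k)). *)
Definition agler_gap (K : 'I_N -> X -> X -> R[i]) (a b : X) : R[i] :=
  \sum_k (K k a b - kshift k (K k) a b).

Lemma kshift_rank_one k u a b : kshift k (rank_one u) a b = rank_one (shift k u)
  a b.
Proof.
case: a b => a i [b j]; rewrite /rank_one.
case/lastP: a => [|a l]; first by rewrite kshift_nill shift_nil mul0r.
case/lastP: b => [|b m]; first by rewrite kshift_nilr shift_nil conjC0 mulr0.
rewrite kshift_rcons !shift_rcons.
by case: (l == k); case: (m == k); rewrite ?mul0r// conjC0 mulr0.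
Qed.

Lemma shift0 k a : shift k (fun=> 0) a = 0.
Proof. by rewrite /shift; case: unrcons => [[w l]|]//; case: ifP. Qed.

Lemma kshift0 k a b : kshift k (fun _ _ => 0) a b = 0.
Proof. by rewrite /kshift shift0 shift0. Qed.

Variable Zs : seq X.
Hypothesis Zu : uniq Zs.

(** The entries on the finite grid, stored at the codes of pairs, place kernels in a Hilbert space
    where [cone_adh] applies and where closeness in norm is closeness of every entry. *)
Definition kernel_vector K : lC :=
  \sum_(a <- Zs) \sum_(b <- Zs) K a b *: l2_delta (pickle (a, b)) (1 : Cplx R).

Definition pairing K (B : X -> X -> R[i]) : R[i] :=
  \sum_(a <- Zs) \sum_(b <- Zs) K a b * B a b.

Lemma inner_kernel_vector K (L : lC) :
  inner (kernel_vector K) L = pairing K (fun a b => Num.conj (L (pickle (a, b)))).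
Proof.
rewrite inner_suml; apply: eq_bigr => a _; rewrite inner_suml; apply: eq_bigr =>
  b _.
by rewrite innerZl inner_delta Cplx_innerE mul1r.
Qed.

Lemma pairingDr K B B' :
  pairing K (fun a b => B a b + B' a b) = pairing K B + pairing K B'.
Proof.
rewrite /pairing -big_split; apply: eq_bigr => a _; rewrite -big_split.
by apply: eq_bigr => b _; rewrite mulrDr.
Qed.

(** Against a Hermitian kernel only the Hermitian part of [B] counts in the real part, so a
    separating functional may be taken Hermitian. *)
Lemma pairing_herm K B : (forall a b, K a b = Num.conj (K b a)) ->
  complex.Re (pairing K (fun a b => B a b + Num.conj (B b a))) =
  2 * complex.Re (pairing K B).
Proof.
move=> KH; rewrite pairingDr cReD.
rewrite (_ : pairing K (fun a b => Num.conj (B b a)) = Num.conj (pairing K B)).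
  by rewrite cRe_conj; ring.
rewrite /pairing rmorph_sum exchange_big; apply: eq_bigr => a _.
by rewrite rmorph_sum; apply: eq_bigr => b _; rewrite rmorphM/= -KH.
Qed.

Lemma kernel_vector_coord K a b : a \in Zs -> b \in Zs -> kernel_vector K (pickle
  (a, b)) = K a b.
Proof.
move=> aZ bZ.
have E : kernel_vector K (pickle (a, b)) =
    \sum_(a' <- Zs) \sum_(b' <- Zs) (if (a == a') && (b == b') then K a' b' else 0).
  rewrite /kernel_vector.
  have c i : forall x y : lC, (x + y) i = x i + y i by [].
  rewrite (big_morph (fun x : lC => x (pickle (a, b))) (c _) (erefl _)).
  apply: eq_bigr => a' _.
  rewrite (big_morph (fun x : lC => x (pickle (a, b))) (c _) (erefl _)).
  apply: eq_bigr => b' _.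
  rewrite -[LHS]/(K a' b' * (if pickle (a, b) == pickle (a', b') then 1 else 0)).
  rewrite (inj_eq (pcan_inj pickleK)) xpair_eqE.
  by case: ifP; rewrite ?mulr1 ?mulr0.
rewrite E (bigD1_seq a)//= (bigD1_seq b)//= !eqxx/= big1 ?addr0 => [|b' /negbTE
  bb]; last first.
  by rewrite eq_sym bb.
rewrite big1 ?addr0// => a' /negbTE aa; rewrite big1// => b' _.
by rewrite eq_sym aa.
Qed.

(** Separation from the cone of all [agler_gap K]. The rank-one kernels placed in a single index k
    belong to this cone, so any functional nonnegative on the cone meets the premise of the dual
    hypothesis. *)
Lemma agler_approx (D : X -> X -> R[i]) :
  (forall a b, D a b = Num.conj (D b a)) ->
  (forall B, (forall a b, B a b = Num.conj (B b a)) ->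
    (forall u k, 0 <= complex.Re (pairing
      (fun a b => rank_one u a b - rank_one (shift k u) a b) B)) ->
    0 <= complex.Re (pairing D B)) ->
  forall e, 0 < e -> exists2 K : 'I_N -> X -> X -> R[i], forall k, psd (K k) &
    forall a b, a \in Zs -> b \in Zs ->
      complex.Re `|D a b - agler_gap K a b| < e.
Proof.
move=> DH dual e e0.
pose Cone := [set x | exists2 K : 'I_N -> X -> X -> R[i],
  forall k, psd (K k) & x = kernel_vector (agler_gap K)].
have embDZ (c : R[i]) K K' : kernel_vector (fun a b => c * K a b + K' a b) = c *:
  kernel_vector K + kernel_vector K'.
  rewrite /kernel_vector scaler_sumr -big_split; apply: eq_bigr => a _.
  rewrite scaler_sumr -big_split; apply: eq_bigr => b _.
  by rewrite scalerDl scalerA.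
have shiftDZ k c u u' a : shift k (fun x => c * u x + u' x) a = c * shift k u a +
  shift k u' a.
  rewrite /shift; case: unrcons => [[w l]|]; last by rewrite mulr0 addr0.
  by case: eqP => // _; rewrite mulr0 addr0.
have gapDZ (c : R[i]) (K K' : 'I_N -> X -> X -> R[i]) a b : agler_gap (fun k a b
  => c * K k a b + K' k a b) a b =
    c * agler_gap K a b + agler_gap K' a b.
  rewrite /agler_gap mulr_sumr -big_split; apply: eq_bigr => k _ /=.
  have -> : kshift k (fun a b => c * K k a b + K' k a b) a b =
      c * kshift k (K k) a b + kshift k (K' k) a b.
    rewrite /kshift -shiftDZ; congr (shift k _ a); apply/funext => a'.
    by rewrite -shiftDZ.
  ring.
have embE K K' : (forall a b, K a b = K' a b) -> kernel_vector K = kernel_vector K'.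
  by move=> KK; apply: eq_bigr => a _; apply: eq_bigr => b _; rewrite KK.
have [||L LC|] := @cone_adh _ _ Cone (kernel_vector D) _ _ _ e e0.
- exists (fun _ _ _ => 0) => [k s|].
    by rewrite /kform big1// => p _; rewrite big1// => q _; rewrite mulr0.
  rewrite /kernel_vector big1// => a _; rewrite big1// => b _.
  by rewrite /agler_gap big1 ?scale0r// => k _; rewrite kshift0 subrr.
- move=> t _ _ t0 [K pK ->] [K' pK' ->]; exists (fun k a b => t%:C * K k a b + K'
  k a b).
    by move=> k; apply: psdD => //; apply: psdZ => //; rewrite ler0c.
  by rewrite -embDZ; apply: embE => a b; rewrite gapDZ.
- pose B (a b : X) : R[i] := Num.conj (L (pickle (a, b))) + Num.conj (Num.conj (L
  (pickle (b, a)))).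
  have := dual B; rewrite /B pairing_herm// -inner_kernel_vector -/(rin _ _)
    pmulr_rge0//; apply.
    by move=> a b; rewrite rmorphD/= !conjCK addrC.
  move=> u k; rewrite pairing_herm.
    rewrite -inner_kernel_vector -/(rin _ _) pmulr_rge0//; apply: LC.
    exists (fun l => if l == k then rank_one u else fun _ _ => 0).
      move=> l; case: eqP => _; first exact: rank_one_psd.
      by move=> s; rewrite /kform big1// => p _; rewrite big1// => q _; rewrite
        mulr0.
    apply: embE => a b; rewrite /agler_gap (bigD1 k)//= eqxx kshift_rank_one big1
      ?addr0//.
    by move=> l /negbTE ->; rewrite kshift0 subrr.
  by move=> a b; rewrite /rank_one rmorphB !rmorphM/= !conjCK [u a * _]mulrC
    [shift k u a * _]mulrC.
- move=> _ [K pK ->] De; exists K => // a b aZ bZ.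
  rewrite -(kernel_vector_coord D aZ bZ) -(kernel_vector_coord (agler_gap K) aZ bZ).
  by apply: le_lt_trans De; exact: (l2coord (kernel_vector D - kernel_vector
    (agler_gap K)) (pickle (a, b))).
Qed.

End Agler.

(** * The separating functional as an inner product *)

Section Positivity.
Context {R : realType} {N : nat}.
Local Notation X := (word N * nat)%type.

Lemma iter_shift0 k m (u : X -> R[i]) w i : (size w < m)%N ->
  iter m (shift k) u (w, i) = 0.
Proof.
elim: m w => // m IH w wm /=; case/lastP: w wm => [|w l]; first by rewrite
  shift_nil.
by rewrite size_rcons ltnS => wm; rewrite shift_rcons IH// if_same.
Qed.

Variables (Zs : seq X) (B : X -> X -> R[i]) (k0 : 'I_N).
Hypothesis Zu : uniq Zs.
Hypothesis BH : forall a b, B a b = Num.conj (B b a).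
Hypothesis BS : forall u k, 0 <= complex.Re (pairing Zs
      (fun a b => rank_one u a b - rank_one (shift k u) a b) B).

Lemma pairingBl K K' : pairing Zs (fun a b => K a b - K' a b) B =
  pairing Zs K B - pairing Zs K' B.
Proof.
rewrite /pairing -sumrB; apply: eq_bigr => a _; rewrite -sumrB.
by apply: eq_bigr => b _; rewrite mulrBl.
Qed.

Let Q u := pairing Zs (rank_one u) B.

Lemma pairing_shift_le u k : complex.Re (Q (shift k u)) <= complex.Re (Q u).
Proof. by have := BS u k; rewrite pairingBl cReD cReN subr_ge0. Qed.

Lemma pairing_rank_one_conj u : Num.conj (Q u) = Q u.
Proof.
rewrite /Q /pairing rmorph_sum exchange_big; apply: eq_bigr => a _.
rewrite rmorph_sum; apply: eq_bigr => b _.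
rewrite rmorphM/= -BH; congr (_ * _).
by rewrite /rank_one rmorphM/= conjCK mulrC.
Qed.

(** Shifting decreases Re Q, and after more shifts than the longest word of the grid the support has
    left the grid, where Q is 0. The imaginary part vanishes because [B] is Hermitian. *)
Lemma pairing_rank_one_ge0 u : 0 <= Q u.
Proof.
have h m : complex.Re (Q (iter m (shift k0) u)) <= complex.Re (Q u).
  by elim: m => // m IH; exact: le_trans (pairing_shift_le _ _) IH.
pose m := (\max_(a <- Zs) size a.1).+1.
have := h m; rewrite {1}/Q /pairing big_seq big1 => [|[w i] wZ].
  move=> Qu; have := cIm_conj (Q u); rewrite pairing_rank_one_conj => Qi.
  rewrite lecE Qu andbT; apply/eqP; move: Qi => /=; lra.
rewrite big1// => b _; rewrite /rank_one iter_shift0 ?mul0r//.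
by rewrite ltnS (@leq_bigmax_seq _ Zs xpredT (fun a : X => size a.1) (w, i) wZ isT).
Qed.

Definition grid_restrict (a b : X) := if (a \in Zs) && (b \in Zs) then B a b else 0.

Lemma grid_restrictE x y : grid_restrict x y =
  \sum_(a <- Zs) \sum_(b <- Zs) (x == a)%:R * (y == b)%:R * B a b.
Proof.
rewrite /grid_restrict; have [xZ|xZ] := boolP (x \in Zs); last first.
  rewrite big_seq big1// => a aZ; rewrite big1// => b _.
  by rewrite (_ : x == a = false) ?mul0r//; apply: contraNF xZ => /eqP ->.
rewrite (bigD1_seq x)//= [X in _ = _ + X]big1 ?addr0; last first.
  by move=> a ax; rewrite big1// => b _; rewrite eq_sym (negbTE ax) !mul0r.
have [yZ|yZ] := boolP (y \in Zs); last first.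
  rewrite big_seq big1// => b bZ.
  by rewrite (_ : y == b = false) ?mulr0 ?mul0r//; apply: contraNF yZ => /eqP ->.
rewrite (bigD1_seq y)//= [X in _ = _ + X]big1 ?addr0; last first.
  by move=> b bx; rewrite [y == b]eq_sym (negbTE bx) mulr0 mul0r.
by rewrite !eqxx !mul1r.
Qed.

(** The push-forward along [g] of the formal combination [s], as a function on X; it turns a
    quadratic form of [grid_restrict] into the pairing of [B] with a rank-one kernel. *)
Definition collect (g : X -> X) (s : seq (R[i] * X)) (a : X) : R[i] :=
  \sum_(p <- s) p.1 * (g p.2 == a)%:R.

Lemma kform_grid_restrict g s :
  kform (fun x y => grid_restrict (g x) (g y)) s s = Q (collect g s).
Proof.
rewrite (eq_kform _ _ (fun x y => grid_restrictE (g x) (g y))) kform_sum.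
apply: eq_bigr => a _; rewrite kform_sum; apply: eq_bigr => b _.
rewrite /kform /rank_one /collect mulr_suml mulr_suml; apply: eq_bigr => p _.
rewrite rmorph_sum mulr_sumr mulr_suml; apply: eq_bigr => q _.
by rewrite rmorphM rmorph_nat; ring.
Qed.

Lemma grid_restrict_psd : psd grid_restrict.
Proof.
move=> s; rewrite -(eq_kform (K := fun x y => grid_restrict (id x) (id y)))//.
by rewrite kform_grid_restrict pairing_rank_one_ge0.
Qed.

Lemma collect_rcons k s a :
  collect (fun x : X => (rcons x.1 k, x.2)) s a = shift k (collect id s) a.
Proof.
case: a => w i; rewrite /collect; case/lastP: w => [|w l].
  rewrite shift_nil big1// => p _.
  by rewrite xpair_eqE -size_eq0 size_rcons /= mulr0.
rewrite shift_rcons; case: eqP => [->|lk].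
  apply: eq_bigr => -[c [v j]] _ /=; rewrite !xpair_eqE eqseq_rcons eqxx andbT.
  by [].
rewrite big1// => -[c [v j]] _ /=; rewrite !xpair_eqE eqseq_rcons.
by rewrite [k == l]eq_sym (negbTE (introN eqP lk)) andbF mulr0.
Qed.

Local Notation lC := (l2 (Cplx R)).

(** The bound |S_k| <= 1 is Q(shift u) <= Q(u) for the collected combinations. Since [grid_restrict]
    vanishes off the grid, so does [phi]. *)
Lemma shift_model : exists (phi : X -> lC) (S : 'I_N -> operator lC lC),
  [/\ forall a b, inner (phi a) (phi b) = grid_restrict a b,
      forall k w i, S k (phi (w, i)) = phi (rcons w k, i) &
      forall k x, nrm (S k x) <= nrm x].
Proof.
have [phi phiE] := kolmogorov grid_restrict_psd; exists phi.
have /choice[S SP] (k : 'I_N) : exists S : operator lC lC,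
    (forall x, S (phi x) = phi (rcons x.1 k, x.2)) /\ forall x, nrm (S x) <= nrm x.
  have [s|S [S1 S2 _ _]] := @gram_op R X _ _ phi
      (fun x => phi (rcons x.1 k, x.2)) 1 ler01; last first.
    by exists S; split=> // x; have := S2 x; rewrite mul1r.
  apply: lincomb_le => //; rewrite kformB kformZ expr1n mul1r.
  rewrite (eq_kform s s (L := fun x y => grid_restrict (id x) (id y)) (fun x y =>
    phiE x y)).
  rewrite (eq_kform s s (L := fun x y => grid_restrict (rcons x.1 k, x.2) (rcons
    y.1 k, y.2)) (fun x y => phiE _ _)).
  rewrite !kform_grid_restrict (_ : collect (fun x : X => (rcons x.1 k, x.2)) s =
    shift k (collect id s)); last first.
    by apply/funext => a; exact: collect_rcons.
  rewrite lecE cReD cReN subr_ge0 pairing_shift_le andbT.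
  by have := ger0_Im (pairing_rank_one_ge0 (collect id s)); have := ger0_Im
    (pairing_rank_one_ge0 (shift k (collect id s)));
    case: (Q _) => a b; case: (Q _) => c d /= -> ->; rewrite oppr0 addr0.
exists S; split=> // [k w i|k x]; first by case: (SP k) => ->.
by case: (SP k).
Qed.

End Positivity.

Lemma tuple_sum_seq (V : nmodType) (I : finType) (F : seq I -> V) (L : seq (seq
  I)) n :
  uniq L -> (forall w, w \in L -> (size w < n)%N) -> (forall w, w \notin L -> F w
    = 0) ->
  \sum_(0 <= m < n) \sum_(w : m.-tuple I) F w = \sum_(w <- L) F w.
Proof.
move=> uL Ln F0.
have key m : \sum_(w : m.-tuple I) F w = \sum_(w <- L | size w == m) F w.
  rewrite -[RHS]big_filter.
  have -> : \sum_(w : m.-tuple I) F w = \sum_(w : m.-tuple I | val w \in L) F w.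
    rewrite [RHS]big_mkcond; apply: eq_bigr => w _; case: ifPn => // /F0 -> //.
  transitivity (\sum_(w <- [seq tval w | w <- index_enum _ & tval (w : m.-tuple
    I) \in L]) F w).
    by rewrite big_map big_filter.
  apply: perm_big.
  apply: uniq_perm; rewrite ?filter_uniq// ?map_inj_uniq ?filter_uniq
    ?index_enum_uniq//.
    exact: val_inj.
  move=> w; rewrite mem_filter; apply/mapP/andP => [[t]|[/eqP wm wL]].
    by rewrite mem_filter => /andP[tL _] ->; rewrite size_tuple.
  by exists (tcast wm (in_tuple w)); rewrite ?val_tcast// mem_filter val_tcast/=
    wL mem_index_enum.
under eq_bigr do rewrite key big_mkcond.
rewrite exchange_big big_seq [RHS]big_seq; apply: eq_bigr => w wL.
rewrite (bigD1_seq (size w)) ?iota_uniq ?mem_index_iota ?Ln//= eqxx big1 ?addr0//.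
by move=> m /negbTE; rewrite eq_sym => ->.
Qed.

Lemma bernoulli {R : realType} (r : R) m : 0 <= r -> r <= 1 -> 1 - r ^+ m <= m%:R
  * (1 - r).
Proof.
move=> r0 r1; elim: m => [|m IH]; first by rewrite expr0 subrr mul0r.
have h : 0 <= r ^+ m by rewrite exprn_ge0.
have h1 : r ^+ m <= 1 by rewrite exprn_ile1.
rewrite exprSr -natr1 mulrDl mul1r.
have : r ^+ m * (1 - r) <= 1 * (1 - r) by rewrite ler_wpM2r// subr_ge0.
by move: IH; rewrite mulrBr mulr1 mul1r; lra.
Qed.

(** * Testing the Herglotz kernel against the functional *)

Section HerglotzAglerPositivity.
Context {R : realType} {N : nat} {Y : hilbertType R}.
Variables (f : word N -> operator Y Y) (y : nat -> Y) (Ls : seq (word N)) (n : nat).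
Local Notation X := (word N * nat)%type.
Local Notation lC := (l2 (Cplx R)).
Hypothesis fA : herglotz_agler f.
Hypothesis Lu : uniq Ls.
Hypothesis Lnil : [::] \in Ls.

(* The coefficients of f(z) + f(w)^*, for f with constant term 1/2, are the sum of
   this kernel and of its conjugate transpose. *)
Definition herglotz_half (a b : X) : R[i] :=
  if a.1 == [::] then inner (f b.1 (y a.2)) (y b.2) else 0.

Definition herglotz_kernel (a b : X) : R[i] :=
  herglotz_half a b + Num.conj (herglotz_half b a).

Definition word_grid : seq X := [seq (w, i) | w <- Ls, i <- iota 0 n].

Lemma word_grid_uniq : uniq word_grid.
Proof. by apply: allpairs_uniq => //; [exact: iota_uniq|move=> [a b] [c d]]. Qed.

Lemma mem_word_grid w i : ((w, i) \in word_grid) = (w \in Ls) && (i < n)%N.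
Proof.
apply/allpairsP/andP => [[[w' i'] /= [wL iI [-> ->]]]|[wL iI]].
  by move: iI; rewrite mem_iota.
by exists (w, i); rewrite mem_iota.
Qed.

Variables (B : X -> X -> R[i]) (k0 : 'I_N).
Hypothesis BH : forall a b, B a b = Num.conj (B b a).
Hypothesis BS : forall u k, 0 <= complex.Re (pairing word_grid
      (fun a b => rank_one u a b - rank_one (shift k u) a b) B).

Let Br := grid_restrict word_grid B.

(** The contribution of the word [w] to <f(C) x, x> in [radial_positivity], without its factor
    r^|w|. It is 0 for words outside [Ls], so the form is a polynomial in r. *)
Let tau (w : word N) : R[i] :=
  \sum_(i <- iota 0 n) \sum_(j <- iota 0 n)
     inner (f w (y i)) (y j) * Br ([::], i) (w, j).

Let tau0 w : w \notin Ls -> tau w = 0.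
Proof.
move=> wL; rewrite /tau big1// => i _; rewrite big1// => j _.
by rewrite /Br /grid_restrict mem_word_grid [X in _ && X]mem_word_grid (negbTE
  wL) andbF mulr0.
Qed.

Let n0 := (\max_(w <- Ls) size w).+1.

Let sizeL w : w \in Ls -> (size w < n0)%N.
Proof. by move=> wL; rewrite ltnS (@leq_bigmax_seq _ Ls xpredT size w wL isT). Qed.

Let tm m : R := complex.Re (\sum_(w : m.-tuple 'I_N) tau w).

Let tm0 m : (n0 <= m)%N -> tm m = 0.
Proof.
move=> nm; rewrite /tm big1// => w _; apply: tau0; apply/negP => /sizeL.
by rewrite size_tuple ltnNge nm.
Qed.

Lemma pairing_herglotz :
  complex.Re (pairing word_grid herglotz_kernel B) = 2 * \sum_(0 <= m < n0) tm m.
Proof.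
rewrite -cRe_sum (tuple_sum_seq Lu sizeL tau0).
have E : pairing word_grid herglotz_half B = \sum_(w <- Ls) tau w.
  rewrite /pairing /word_grid big_allpairs_dep/=.
  rewrite (bigD1_seq [::])//= [X in _ + X]big1 ?addr0; last first.
    move=> w /negbTE w0; rewrite big1// => i _; rewrite big1// => b _.
    by rewrite /herglotz_half /= w0 mul0r.
  rewrite /tau [RHS]exchange_big big_seq [RHS]big_seq; apply: eq_bigr => i iI.
  rewrite big_allpairs_dep/= big_seq [RHS]big_seq; apply: eq_bigr => w wL.
  rewrite big_seq [RHS]big_seq; apply: eq_bigr => j jI.
  rewrite /herglotz_half/= /Br /grid_restrict !mem_word_grid wL Lnil/=.
  by move: iI jI; rewrite !mem_iota !add0n /= => -> ->.
have E2 : pairing word_grid (fun a b => Num.conj (herglotz_half b a)) B =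
    Num.conj (pairing word_grid herglotz_half B).
  rewrite /pairing rmorph_sum exchange_big; apply: eq_bigr => a _.
  by rewrite rmorph_sum; apply: eq_bigr => b _; rewrite rmorphM/= -BH.
have -> : pairing word_grid herglotz_kernel B = pairing word_grid herglotz_half B +
    pairing word_grid (fun a b => Num.conj (herglotz_half b a)) B.
  rewrite /pairing -big_split; apply: eq_bigr => a _; rewrite -big_split.
  by apply: eq_bigr => b _; rewrite /= -mulrDl.
rewrite E2 cReD cRe_conj E; ring.
Qed.

(* f is evaluated at C_k = r S_k^*, on the vector sum_i y_i (x) phi(1, i). *)
Lemma radial_positivity (r : R) : 0 <= r -> r < 1 -> 0 <= \sum_(0 <= m < n0) r ^+
  m * tm m.
Proof.
move=> r0 r1.
have [phi [S [phiE Sphi S1]]] := shift_model k0 word_grid_uniq BH BS.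
pose C k := r%:C *: adjoint (S k).
have C1 k : opnorm (C k) < 1.
  apply: le_lt_trans r1; apply: opnorm_le => // x.
  rewrite scaleopE nrmZr ger0_norm// ler_wpM2l// -[leRHS]mul1r.
  by apply: adjoint_le => // z; rewrite mul1r.
(* The class speaks of every tensor product of Y and E; for E = l2 a concrete one is at hand. *)
pose T := @l2_hilbert_tensor R Y.
have [SS [SC /= Spos]] := fA C1 T.
pose x : T := \sum_(i <- iota 0 n) tensor T (y i) (phi ([::], i)).
(* Each C_k moves across the inner product as r S_k and appends its letter to the word on the right;
   [be] is general for the induction. *)
have Cw w be j u : inner (opword C w u) (phi (be, j)) =
    (r ^+ size w)%:C * inner u (phi (be ++ w, j)).
  elim: w be => [|k w IH] be; first by rewrite cats0 /= mul1r.
  rewrite /= innerZl -adjointPr Sphi IH cat_rcons mulrA -rmorphM.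
  by rewrite exprS.
have hom m : rin (homogeneous_part T f C m x) x = r ^+ m * tm m.
  rewrite /tm -cReMl; congr complex.Re.
  rewrite /homogeneous_part sumopE inner_suml mulr_sumr; apply: eq_bigr => w _.
  rewrite /x op_sum inner_suml /tau mulr_sumr; apply: eq_bigr => i _.
  rewrite inner_sumr mulr_sumr; apply: eq_bigr => j _.
  rewrite tensoropP inner_tensor Cw size_tuple phiE mulrCA.
  by [].
(* Past degree [n0] the homogeneous parts contribute nothing at [x], so the form at [SS] is this
   finite sum up to an arbitrarily small error. *)
have SP M : (n0 <= M)%N ->
    rin ((\sum_(0 <= m < M) homogeneous_part T f C m) x) x = \sum_(0 <= m < n0) r
      ^+ m * tm m.
  move=> nM; rewrite sumopE /rin inner_suml cRe_sum.
  rewrite [LHS](eq_bigr (fun m => r ^+ m * tm m)) => [|m _]; last exact: hom.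
  rewrite (big_cat_nat _ nM)//= [X in _ + X]big_nat [X in _ + X]big1 ?addr0// =>
    m /andP[nm _].
  by rewrite tm0// mulr0.
have := Spos x; rewrite reop_inner ler0c => h.
apply: (@ler_eps _ _ _ (nrm x ^+ 2)) => e e0.
move/cvgrPdist_lt: SC => /(_ e e0)[M _ MP].
have := MP (maxn M n0) (leq_maxl _ _); rewrite sub0r normrN ger0_norm
  ?opnorm_ge0// => op.
rewrite -(SP (maxn M n0) (leq_maxr _ _)).
set P := \sum_(0 <= m < maxn M n0) _ in op *.
have : rin (SS x) x - rin (P x) x <= nrm x ^+ 2 * e.
  rewrite -rinNl -rinDl (le_trans (ler_norm _))// (le_trans (rin_le _ _))//.
  rewrite nrmBC (le_trans (ler_wpM2r _ (opnormP (P - SS) x)))//.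
  by rewrite -mulrA -expr2 mulrC ler_wpM2l ?sqr_ge0// ltW.
move: h; lra.
Qed.

Lemma herglotz_kernel_positive : 0 <= complex.Re (pairing word_grid
  herglotz_kernel B).
Proof.
rewrite pairing_herglotz mulr_ge0//.
apply: (@ler_eps _ _ _ (\sum_(0 <= m < n0) m%:R * `|tm m|)) => e e0.
(* r = 1 - d lies in [0, 1), and 1 - (1 - d)^m <= m d bounds the change from r to 1 by e times the
   sum of m |tm m|. *)
pose d := Num.min e 1.
have d0 : 0 < d by rewrite lt_min e0 ltr01.
have d1 : d <= 1 by rewrite ge_min lexx orbT.
have de : d <= e by rewrite ge_min lexx.
have := @radial_positivity (1 - d); rewrite subr_ge0 ltrBlDr ltrDl => /(_ d1 d0) h.
apply: (le_trans h); rewrite -lerBlDl -sumrB mulr_suml ler_sum// => m _.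
rewrite -{2}[tm m]mul1r -mulrBl.
have h0 : 0 <= 1 - (1 - d) ^+ m.
  by rewrite subr_ge0 exprn_ile1 ?subr_ge0// lerBlDr lerDl ltW.
have b : 1 - (1 - d) ^+ m <= m%:R * d.
  have := @bernoulli _ (1 - d) m; rewrite (_ : 1 - (1 - d) = d); last by ring.
  by apply; rewrite ?subr_ge0// lerBlDr lerDl ltW.
rewrite (le_trans (ler_norm _))// normrM distrC -[leRHS]mulrA [X in _ <= _ *
  X]mulrC mulrA.
rewrite ler_wpM2r// (ger0_norm h0) (le_trans b)// ler_wpM2l// ler0n.
Qed.

End HerglotzAglerPositivity.

(* Unlike [ultra_image], this does not require u to be surjective. *)
Lemma fmap_ultra (T U : Type) (u : T -> U) (F : set_system T) :
  UltraFilter F -> UltraFilter (fmap u F).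
Proof.
move=> FU; split; first exact: fmap_proper_filter.
move=> G GF uG; rewrite predeqE => A; split; last exact: uG.
move=> GA; have [//|FA] := in_ultra_setVsetC (u @^-1` A) FU.
by have /filter_ex[x []] : G (A `&` ~` A) by apply: filterI => //; exact: uG.
Qed.

(** * Limits along an ultrafilter *)

Section UltraLimit.
Context {R : realType} (F : set_system nat) {UF : UltraFilter F}.

(** Compactness of the interval gives the limit without a choice of subsequence, so all entries of
    all kernels converge along the same ultrafilter. *)
Lemma ultra_bounded (u : nat -> R) (M : R) : F [set n | `|u n| <= M] ->
  exists l, forall e : R, 0 < e -> F [set n | `|u n - l| < e].
Proof.
move=> uM; have := @segment_compact R (- M) M; rewrite compact_ultra.
move=> /(_ (u @ F) (fmap_ultra _ UF))[|l [_ ul]].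
  rewrite set_itvcc; apply: (@filterS _ F _ _ (u @^-1` _) _ uM) => n un.
  by rewrite /preimage/mkset -ler_norml.
exists l => e e0; move/cvgrPdist_lt: ul => /(_ e e0).
by apply: filterS => n /=; rewrite distrC.
Qed.

Definition fcvg (u : nat -> R[i]) (l : R[i]) :=
  forall e : R, 0 < e -> F [set n | complex.Re `|u n - l| < e].

Lemma fcvg_ex (u : nat -> R[i]) (M : R) : F [set n | complex.Re `|u n| <= M] ->
  exists l, fcvg u l.
Proof.
move=> uM.
have [|a ua] := @ultra_bounded (fun n => complex.Re (u n)) M.
  by apply: filterS uM => n un; exact: le_trans (Re_norm_le _) un.
have [|b ub] := @ultra_bounded (fun n => complex.Im (u n)) M.
  by apply: filterS uM => n un; exact: le_trans (Im_norm_le _) un.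
exists (a +i* b) => e e0; have e2 : 0 < e / 2 by rewrite divr_gt0.
apply: filterS (filterI (ua _ e2) (ub _ e2)) => n /= [h1 h2].
rewrite (le_lt_trans (Re_norm_leD _))// [ltRHS]splitr; move: h1 h2.
by case: (u n) => c d /= h1 h2; exact: ltrD.
Qed.

Lemma fcvg_uniq u l l' : fcvg u l -> fcvg u l' -> l = l'.
Proof.
move=> ul ul'; apply/eqP; rewrite -subr_eq0 -normr_eq0 norm_Re; apply/eqP.
congr (_%:C); apply/eqP; rewrite eq_le ge0_Re// andbT.
apply: (@ler_eps _ _ _ 2) => e e0; rewrite add0r.
have [n [h1 h2]] := filter_ex (filterI (ul _ e0) (ul' _ e0)).
have := ler_normD (l - u n) (u n - l'); rewrite addrA subrK lecE => /andP[_].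
by rewrite cReD (distrC l (u n)); move: h1 h2; rewrite /mkset; lra.
Qed.

Lemma fcvg0 : fcvg (fun=> 0) 0.
Proof. by move=> e e0; apply: filterE => n; rewrite /mkset subrr normr0. Qed.

Lemma fcvgD u v l k : fcvg u l -> fcvg v k -> fcvg (fun n => u n + v n) (l + k).
Proof.
move=> ul vk e e0; have e2 : 0 < e / 2 by rewrite divr_gt0.
apply: filterS (filterI (ul _ e2) (vk _ e2)) => n [/= h1 h2].
have := ler_normD (u n - l) (v n - k); rewrite addrACA -opprD lecE => /andP[_].
by rewrite cReD => /le_lt_trans; apply; rewrite [ltRHS]splitr; exact: ltrD.
Qed.

Lemma fcvgM c u l : fcvg u l -> fcvg (fun n => c * u n) (c * l).
Proof.
move=> ul e e0; have c1 : 0 < complex.Re `|c| + 1 by rewrite ltr_wpDl// ge0_Re.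
have e' : 0 < e / (complex.Re `|c| + 1) by rewrite divr_gt0.
apply: filterS (ul _ e') => n; rewrite /mkset ltr_pdivlMr// => h.
rewrite -mulrBr normrM (norm_Re c) cReMl; apply: le_lt_trans h.
by rewrite mulrC ler_wpM2l ?ge0_Re// lerDl.
Qed.

Lemma fcvg_sum I (r : seq I) (P : pred I) (u : I -> nat -> R[i]) (l : I -> R[i]) :
  (forall i, P i -> fcvg (u i) (l i)) ->
  fcvg (fun n => \sum_(i <- r | P i) u i n) (\sum_(i <- r | P i) l i).
Proof.
move=> ul; elim: r => [|i r IH].
  rewrite big_nil (_ : (fun n => _) = fun=> 0); first exact: fcvg0.
  by apply/funext => n; rewrite big_nil.
rewrite big_cons (_ : (fun n => _) = fun n => if P i then u i n + \sum_(j <- r |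
  P j) u j n
   else \sum_(j <- r | P j) u j n).
  by case: ifP => Pi //; apply: fcvgD => //; exact: ul.
by apply/funext => n; rewrite big_cons.
Qed.

Lemma fcvg_ge0 u l : fcvg u l -> (forall n, 0 <= u n) -> 0 <= l.
Proof.
move=> ul u0; rewrite lecE/=.
have h e : 0 < e -> `|complex.Im l| < e /\ - e < complex.Re l.
  move=> e0; have [n h] := filter_ex (ul _ e0); have := u0 n.
  move: h; rewrite /mkset lecE/= => h /andP[/eqP ui ur].
  have h1 := le_lt_trans (Im_norm_le (u n - l)) h.
  have h2 := le_lt_trans (Re_norm_le (u n - l)) h.
  move: h1 h2 ui ur; case: (u n) => a b; case: (l) => c d /= h1 h2 b0 a0.
  rewrite b0 sub0r normrN in h1; split=> //.
  by move: h2; rewrite ltr_norml => /andP[]; lra.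
apply/andP; split.
  rewrite -normr_le0; apply: (@ler_eps _ _ _ 1) => e /h[/ltW]; lra.
apply: (@ler_eps _ _ _ 1) => e /h[_ /ltW]; lra.
Qed.

End UltraLimit.

Section AglerDecomposition.
Context {R : realType} {N : nat} {Y : hilbertType R}.
Variables (f : word N -> operator Y Y) (y : nat -> Y) (Ls : seq (word N)) (k0 :
  'I_N).
Local Notation X := (word N * nat)%type.
Hypothesis fA : herglotz_agler f.
Hypothesis Lu : uniq Ls.
Hypothesis Lnil : [::] \in Ls.
Hypothesis Lpre : forall w k, rcons w k \in Ls -> w \in Ls.

Let approximant : exists K : nat -> 'I_N -> X -> X -> R[i],
  (forall n k, psd (K n k)) /\
  (forall n a b, a \in word_grid Ls n -> b \in word_grid Ls n ->
    complex.Re `|herglotz_kernel f y a b - agler_gap (K n) a b| < n.+1%:R^-1).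
Proof.
have /choice[K KP] (n : nat) : exists K : 'I_N -> X -> X -> R[i],
    (forall k, psd (K k)) /\
    (forall a b, a \in word_grid Ls n -> b \in word_grid Ls n ->
      complex.Re `|herglotz_kernel f y a b - agler_gap K a b| < n.+1%:R^-1).
  have n0 : 0 < n.+1%:R^-1 :> R by rewrite invr_gt0.
  have [||K K1 K2] := @agler_approx R N _ (word_grid_uniq n Lu) (herglotz_kernel
    f y) _ _ _ n0.
  - by move=> a b; rewrite /herglotz_kernel rmorphD/= conjCK addrC.
  - by move=> B BH BS; apply: herglotz_kernel_positive BH BS.
  - by exists K.
by exists K; split=> n; [move=> k|]; case: (KP n).
Qed.

Lemma agler_decomposition : exists2 K : 'I_N -> X -> X -> R[i], forall k, psd (K
  k) &
  forall a b, a.1 \in Ls -> b.1 \in Ls -> herglotz_kernel f y a b = agler_gap K a b.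
Proof.
have [K [Kpsd Kgap]] := approximant.
(* The sum over l of K_l(a,a) is the gap plus the shifted diagonals; the gap is within 1/(n+1) <= 1
   of the Herglotz kernel, and each summand is nonnegative. *)
have diag1 n k a : a \in word_grid Ls n -> complex.Re (K n k a a) <=
    complex.Re (herglotz_kernel f y a a) + 1 + complex.Re (\sum_l kshift l (K n
      l) a a).
  move=> an; have := Kgap n a a an an.
  set g := agler_gap (K n) a a; set D := herglotz_kernel f y a a => gD.
  have n1 : n.+1%:R^-1 <= 1 :> R by rewrite invf_le1 ?ltr0n// ler1n.
  have := le_lt_trans (Re_norm_le (D - g)) (lt_le_trans gD n1).
  rewrite cReD cReN ltr_norml => /andP[h _].
  have : complex.Re (K n k a a) <= complex.Re (\sum_l K n l a a).
    rewrite (bigD1 k)//= cReD lerDl cRe_sum sumr_ge0// => l _.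
    by apply: ge0_Re; exact: psd_diag.
  have : complex.Re (\sum_l K n l a a) = complex.Re g + complex.Re (\sum_l kshift
    l (K n l) a a).
    by rewrite -cReD /g /agler_gap sumrB subrK.
  by move: h; lra.
(* At the word w g_l the only shifted diagonal is K_l at w, a prefix, already bounded uniformly in
   n; at the empty word there is none. *)
have diag w i : w \in Ls -> exists M, forall n k, (i < n)%N ->
    complex.Re (K n k (w, i) (w, i)) <= M.
  elim/last_ind: w => [|w l IH] wL.
    exists (complex.Re (herglotz_kernel f y ([::], i) ([::], i)) + 1) => n k ni.
    have /diag1 : ([::], i) \in word_grid Ls n by rewrite mem_word_grid Lnil.
    by move=> /(_ k)/le_trans; apply; rewrite big1// addr0.
  have [M MP] := IH (Lpre wL).
  exists (complex.Re (herglotz_kernel f y (rcons w l, i) (rcons w l, i)) + 1 + M)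
    => n k ni.
  have /diag1 : (rcons w l, i) \in word_grid Ls n by rewrite mem_word_grid wL.
  move=> /(_ k)/le_trans; apply; rewrite lerD2l (bigD1 l)//= kshift_rcons eqxx/=.
  rewrite big1 ?addr0; first exact: MP.
  by move=> m /negbTE ml; rewrite kshift_rcons eq_sym ml.
pose inL (a b : X) := (a.1 \in Ls) && (b.1 \in Ls).
(* Only entries at words of [Ls] are controlled. Setting the others to 0 keeps the kernels positive
   semidefinite and gives every entry a limit. *)
pose K' n k (a b : X) := if inL a b then K n k a b else 0.
have [F [UF Foo]] := ultraFilterLemma (eventually_filter).
have K'psd n k : psd (K' n k).
  move=> s; have := Kpsd n k [seq p <- s | p.2.1 \in Ls].
  rewrite /kform big_filter big_mkcond; congr (0 <= _); apply: eq_bigr => p _.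
  rewrite /K' /inL; case: ifP => pL; last by rewrite big1// => q _; rewrite mulr0.
  rewrite big_filter big_mkcond; apply: eq_bigr => q _ /=.
  by case: ifP; rewrite ?mulr0.
have /choice[L LP] (t : 'I_N * X * X) : exists l, fcvg F (fun n => K' n t.1.1
  t.1.2 t.2) l.
  case: t => -[k [w i]] [v j]; rewrite /K' /inL /=.
  have [/andP[wL vL]|_] := boolP ((w \in Ls) && (v \in Ls)); last by exists 0;
    exact: fcvg0.
  have [M MP] := diag w i wL; have [M' MP'] := diag v j vL.
  apply: (@fcvg_ex _ _ _ _ (M + M')).
  apply: Foo; exists (maxn i j).+1 => // n nm; rewrite /mkset.
  have h1 := MP n k (leq_ltn_trans (leq_maxl _ _) nm).
  have h2 := MP' n k (leq_ltn_trans (leq_maxr _ _) nm).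
  have := psd_offdiag (w, i) (v, j) (Kpsd n k).
  have := ge0_Re (psd_diag (w, i) (Kpsd n k)); have := ge0_Re (psd_diag (v, j)
    (Kpsd n k)).
  have := ge0_Re (normr_ge0 (K n k (w, i) (v, j))).
  move: (complex.Re `|_|) (complex.Re (K n k (w, i) _)) (complex.Re (K n k (v, j)
    _)) h1 h2.
  move=> x p q h1 h2 x0 q0 p0 h; apply: (le_trans _ (lerD h1 h2)).
  have pq : x ^+ 2 <= (p + q) ^+ 2 by nra.
  by rewrite ler_sqr ?nnegrE ?addr_ge0 in pq.
pose KL k a b := L (k, a, b).
have KLP k a b : fcvg F (fun n => K' n k a b) (KL k a b) by exact: (LP (k, a, b)).
exists KL.
  move=> k s; apply: (@fcvg_ge0 _ F UF (fun n => kform (K' n k) s s)) => [|n];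
    last exact: K'psd.
  by apply: fcvg_sum => p _; apply: fcvg_sum => q _; apply: fcvgM.
move=> [w i] [v j] /= wL vL.
apply: (@fcvg_uniq _ F UF (fun n => agler_gap (K n) (w, i) (v, j))).
  move=> e e0; have [M MP] := archi_inv e0.
  apply: Foo; exists (maxn (maxn i j).+1 M) => // n nn.
  have /andP[nm nM] : ((maxn i j).+1 <= n)%N && (M <= n)%N by rewrite -geq_max.
  rewrite /mkset distrC (lt_trans _ (MP n nM))// Kgap// mem_word_grid ?wL ?vL/=.
    exact: leq_ltn_trans (leq_maxl _ _) nm.
  exact: leq_ltn_trans (leq_maxr _ _) nm.
apply: fcvg_sum => k _.
have cK a b : inL a b -> fcvg F (fun n => K n k a b) (KL k a b).
  by move=> ab; have := KLP k a b; rewrite /K' ab.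
rewrite (_ : (fun n => _) = fun n => K n k (w, i) (v, j) + -1 * kshift k (K n k)
  (w, i) (v, j)); last first.
  by apply/funext => n; rewrite mulN1r.
rewrite -[- kshift _ _ _ _]mulN1r; apply: fcvgD; first by apply: cK; rewrite /inL
  wL.
apply: (@fcvgM _ F UF (-1) (fun n => kshift k (K n k) (w, i) (v, j))).
case/lastP: w wL => [|w l] wL.
  by rewrite kshift_nill; exact: fcvg0.
case/lastP: v vL => [|v m] vL.
  rewrite kshift_nilr (_ : (fun n => _) = fun=> 0); first exact: fcvg0.
  by apply/funext => n; rewrite kshift_nilr.
rewrite kshift_rcons (_ : (fun n => _) = fun n => if (l == k) && (m == k) then K
  n k (w, i) (v, j) else 0).
  case: ifP => _; last exact: fcvg0.
  by apply: cK; rewrite /inL/= (Lpre wL) (Lpre vL).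
by apply/funext => n; rewrite kshift_rcons.
Qed.

End AglerDecomposition.

(** * The lurking isometry *)

Section Projections.
Context {R : realType} {N : nat} {H : hilbertType R}.
Variables (Q : 'I_N -> operator H H) (k0 : 'I_N).
Hypothesis Qsa : forall k x y, inner (Q k x) y = inner x (Q k y).
Hypothesis Qid : forall k x, Q k (Q k x) = Q k x.
Hypothesis Qorth : forall k l x, k != l -> Q k (Q l x) = 0.

(* P k acts as Q k on the coordinate 0 of l2 H, except that the complement of all
   the Q k is assigned to k0. *)
Lemma resolution_of_identity : exists P : 'I_N -> operator (l2 H) (l2 H),
  [/\ forall k x y, inner (P k x) y = inner x (P k y),
      forall k l x, P k (P l x) = if k == l then P k x else 0,
      forall x, \sum_k P k x = x &
      forall g : 'I_N -> H, (forall k l, Q k (g l) = if k == l then g k else 0) ->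
        forall k, P k (l2_delta 0 (\sum_l g l)) = l2_delta 0 (g k)].
Proof.
have [D DP] := @delta_op R H 0; have [C CP] := @coord_op R H 0.
have CD x : C (D x) = x by rewrite DP CP.
have Dsa x y : inner (D x) y = inner x (C y) by rewrite DP CP inner_delta.
have Csa x y : inner (C x) y = inner x (D y).
  by rewrite inner_conj -Dsa -inner_conj.
pose P0 k := compop D (compop (Q k) C).
have P0sa k x y : inner (P0 k x) y = inner x (P0 k y).
  by rewrite /= Dsa Qsa Csa.
have P0M k l x : P0 k (P0 l x) = if k == l then P0 k x else 0.
  rewrite /= CD; have [->|kl] := eqVneq k l; first by rewrite Qid.
  by rewrite Qorth// op0.
pose S := \sum_(k | k != k0) P0 k.
have SE x : S x = \sum_(k | k != k0) P0 k x by rewrite sumopE.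
have P0S k x : k != k0 -> P0 k (S x) = P0 k x.
  move=> kk; rewrite SE op_sum (bigD1 k)// P0M eqxx big1; first exact: addr0.
  by move=> l /andP[_ lk]; rewrite P0M; case: eqVneq lk => // ->; rewrite eqxx.
have SP0 k x : k != k0 -> S (P0 k x) = P0 k x.
  move=> kk; rewrite SE (bigD1 k)// P0M eqxx big1; first exact: addr0.
  by move=> l /andP[_ lk]; rewrite P0M (negbTE lk).
have SS x : S (S x) = S x.
  by rewrite [in RHS]SE [LHS]SE; apply: eq_bigr => k kk; rewrite P0S.
have idS x : (idop _ - S) x = x - S x by [].
pose P k := if k == k0 then idop _ - S else P0 k.
exists P; split.
- move=> k x y; rewrite /P; case: eqP => // _.
  rewrite !idS innerDl innerDr innerNl innerNr; congr (_ - _).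
  by rewrite !SE inner_suml inner_sumr; apply: eq_bigr => l _; exact: P0sa.
- move=> k l x; rewrite /P.
  have [->|kk] := eqVneq k k0; have [lk|lk] := eqVneq l k0.
  + by rewrite !idS opB SS subrr subr0.
  + by rewrite idS SP0// subrr.
  + by rewrite idS opB P0S// subrr lk (negbTE kk).
  + exact: P0M.
- move=> x; rewrite (bigD1 k0)//= /P eqxx idS SE.
  rewrite (_ : \sum_(i | i != k0) (if i == k0 then idop (l2 H) - S else P0 i) x =
    \sum_(i | i != k0) P0 i x) ?subrK//.
  by apply: eq_bigr => k /negbTE ->.
- move=> g Qg k.
  have P0g l : P0 l (l2_delta 0 (\sum_l g l)) = l2_delta 0 (g l).
    rewrite -DP /= CD op_sum (bigD1 l)//= Qg eqxx big1 ?addr0 ?DP// => m ml.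
    by rewrite Qg eq_sym (negbTE ml).
  rewrite /P; case: eqP => [->|_] //.
  rewrite idS SE (eq_bigr (fun l => D (g l))) => [|l _]; last by rewrite P0g DP.
  by rewrite -op_sum /= -!DP -opB (bigD1 k0)//= addrK.
Qed.

End Projections.

Section LurkingIsometry.
Context {R : realType} {N : nat} {Y : hilbertType R}.
Variables (f : word N -> operator Y Y) (y : nat -> Y) (Ls : seq (word N)) (k0 :
  'I_N).
Local Notation X := (word N * nat)%type.
Local Notation lC := (l2 (Cplx R)).
Hypothesis y_dense : forall x (e : R), 0 < e -> exists n, nrm (x - y n) < e.
Hypothesis Lnil : [::] \in Ls.
Hypothesis Lpre : forall w k, rcons w k \in Ls -> w \in Ls.
Hypothesis f_nil : f [::] = 2^-1 *: idop Y.
Variable K : 'I_N -> X -> X -> R[i].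
Hypothesis Kpsd : forall k, psd (K k).
Hypothesis Kgap : forall a b, a.1 \in Ls -> b.1 \in Ls ->
  herglotz_kernel f y a b = agler_gap K a b.

(** The K_k are the diagonal blocks of one kernel on pairs (index, point), so that all g_k live in a
    common space with mutually orthogonal ranges. Each block is a Schur product of K_m with a
    rank-one indicator. *)
Let gram_vectors : exists g : 'I_N -> X -> lC,
  forall k l a b, inner (g k a) (g l b) = if k == l then K k a b else 0.
Proof.
pose Kt (p q : 'I_N * X) := \sum_m rank_one (fun x : 'I_N * X => (x.1 == m)%:R) p
  q * K m p.2 q.2.
have Ktp : psd Kt.
  apply: psd_sum => m _; apply: psdM; first exact: rank_one_psd.
  exact: (psd_comp (fun p : 'I_N * X => p.2) (Kpsd m)).
have [g gK] := kolmogorov Ktp; exists (fun k a => g (k, a)) => k l a b.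
rewrite gK /Kt /rank_one (bigD1 k)//= eqxx big1 ?addr0 => [|m /negbTE mk].
  by rewrite mul1r rmorph_nat eq_sym; case: eqP => _; rewrite ?mul1r ?mul0r.
by rewrite eq_sym mk !mul0r.
Qed.

Lemma lurking_isometry : exists (G : 'I_N -> operator (l2 lC) (l2 lC)) (V :
  operator Y (l2 lC)),
  [/\ unitary_pencil G, isometryop V &
      forall w i j, w \in Ls ->
        inner (opword G w (V (y i))) (V (y j)) = herglotz_kernel f y ([::], i)
          (w, j)].
Proof.
have [g gK] := gram_vectors.
pose h a := \sum_k g k a.
have hh a b : a.1 \in Ls -> b.1 \in Ls -> inner (h a) (h b) =
    herglotz_kernel f y a b + \sum_k kshift k (K k) a b.
  move=> aL bL; rewrite Kgap// /agler_gap sumrB subrK /h inner_suml.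
  apply: eq_bigr => k _; rewrite inner_sumr (bigD1 k)//= gK eqxx big1 ?addr0//.
  by move=> l lk; rewrite gK eq_sym (negbTE lk).
pose next (p : 'I_N * X) : X := (rcons p.2.1 p.1, p.2.2).
(* Both families are 0 when the extended word leaves [Ls], where the decomposition gives no
   information. *)
pose fW p := if (next p).1 \in Ls then g p.1 p.2 else 0.
pose gW p := if (next p).1 \in Ls then h (next p) else 0.
(* For two nonempty words the Herglotz kernel is 0, so <h(v g_k), h(w g_l)> reduces to the shifted
   kernels, which leave K_k(v,w) if k = l and 0 otherwise. *)
have fgW p q : inner (gW p) (gW q) = inner (fW p) (fW q).
  rewrite /gW /fW; case: p q => [k [v i]] [l [w j]]; rewrite /next/=.
  case: ifP => vL; last by rewrite !inner0l.
  case: ifP => wL; last by rewrite !inner0r.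
  rewrite hh// gK /herglotz_kernel /herglotz_half /=.
  rewrite -!size_eq0 !size_rcons /= conjC0 addr0 add0r.
  rewrite (bigD1 k)//= kshift_rcons eqxx/= big1 ?addr0 1?eq_sym//.
  by move=> m /negbTE mk; rewrite kshift_rcons eq_sym mk.
have lW s : nrm (lincomb gW s) = nrm (lincomb fW s).
  apply/eqP; rewrite -(@eqrXn2 _ 2)//; apply/eqP; apply: complexI.
  by rewrite -!lincomb_gram; apply: eq_kform.
have [s|W [WE _ _ /(_ lW) WI]] := @gram_op _ _ _ _ fW gW 1 ler01; first by
  rewrite mul1r lW.
have W1 x : nrm (W x) <= nrm x by case: (WI x).
have [U [U' [Usa U'U UU' UW]]] := halmos_dilation (fun x => (WI x).2).
have Ug k a : rcons a.1 k \in Ls -> U (l2_delta 0 (g k a)) = l2_delta 0 (h (rcons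
  a.1 k, a.2)).
  move=> aL; have fE : fW (k, a) = g k a by rewrite /fW /= aL.
  have gE : gW (k, a) = h (rcons a.1 k, a.2) by rewrite /gW /= aL.
  have WgE : W (g k a) = h (rcons a.1 k, a.2) by rewrite -fE WE gE.
  rewrite UW; first by rewrite WgE.
  apply: adjoint_isometric => //.
  by rewrite WgE -gE -fE -(lincomb1 gW) lW lincomb1.
have /choice[Q QP] k := span_projection (g k).
have Qg k l a : Q k (g l a) = if k == l then g k a else 0.
  have [Q1 Q2 _ _] := QP k; have [->|kl] := eqVneq k l; first by have [-> _ _ _]
    := QP l.
  by apply: Q2 => b; rewrite gK eq_sym (negbTE kl).
have Qorth k l x : k != l -> Q k (Q l x) = 0.
  move=> kl; have [_ Q2 _ _] := QP k; apply: Q2 => b.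
  by have [_ _ -> _] := QP l; rewrite Qg eq_sym (negbTE kl) inner0r.
have [|//|P [Psa PM Psum Pg]] := @resolution_of_identity R N lC Q k0 _ _ Qorth.
- by move=> k x z; case: (QP k).
- by move=> k x; case: (QP k).
have Ph k a : P k (l2_delta 0 (h a)) = l2_delta 0 (g k a).
  by apply: (Pg (fun l => g l a)) => l m; exact: Qg.
pose G k := compop (P k) U'.
have G_pencil : unitary_pencil G.
  move=> z z1.
  have zz k : Num.conj (z k) * z k = 1 by rewrite mulrC -normCK z1 expr1n.
  have zz' k : z k * Num.conj (z k) = 1 by rewrite -normCK z1 expr1n.
  (* zeta G is sum_k zeta_k P_k times the unitary [U']; the first factor is inverted by conjugating
     the coefficients. *)
  have mulD (s t : 'I_N -> R[i]) x : (forall k, s k * t k = 1) ->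
      \sum_k s k *: P k (\sum_l t l *: P l x) = x.
    move=> st; rewrite -[RHS]Psum; apply: eq_bigr => k _.
    rewrite op_sum (bigD1 k)//= opZ PM eqxx big1 ?addr0 ?scalerA ?st ?scale1r//
      => l lk.
    by rewrite opZ PM eq_sym (negbTE lk) scaler0.
  have GE x : (\sum_k z k *: G k) x = \sum_k z k *: P k (U' x) by rewrite sumopE.
  pose B := compop U (\sum_k Num.conj (z k) *: P k).
  have BE x : B x = U (\sum_k Num.conj (z k) *: P k x) by rewrite /= sumopE.
  apply: (@unitary_pair _ _ _ B) => [x x'|x|x].
  - rewrite GE BE [RHS]inner_conj Usa -inner_conj inner_suml inner_sumr.
    by apply: eq_bigr => k _; rewrite innerZl innerZr conjCK Psa.
  - by rewrite BE GE mulD ?UU'.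
  - by rewrite GE BE U'U mulD.
(* No shifted term occurs at the empty word, and f has constant term 1/2, so the kernel there is 1/2
   + 1/2 times <y_i, y_j>. Hence y_i |-> h(1, i) extends to an isometry. *)
have hnil i j : inner (l2_delta 0 (h ([::], i))) (l2_delta 0 (h ([::], j))) =
  inner (y i) (y j).
  rewrite inner_delta l2_deltaE eqxx hh// big1 ?addr0// /herglotz_kernel
    /herglotz_half/=.
  rewrite f_nil !scaleopE !innerZl /= rmorphM/= -inner_conj fmorphV rmorph_nat
    -mulrDl.
  by rewrite (_ : 2^-1 + 2^-1 = 1) ?mul1r//; field.
have [V Vy VN] := gram_isometry y_dense hnil.
exists G, V; split=> //; first by move=> x; rewrite !normE VN.
(* One letter: P_k takes h(be) to g_k(be) across the inner product, then U, the adjoint of [U'],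
   takes g_k(be) to h(be g_k). Every prefix of be w must lie in [Ls] for this. *)
have Gw w u be j : be ++ w \in Ls ->
    inner (opword G w u) (l2_delta 0 (h (be, j))) = inner u (l2_delta 0 (h (be ++
      w, j))).
  elim: w be => [|k w IH] be; first by rewrite cats0.
  rewrite -cat_rcons => bL.
  have bk : rcons be k \in Ls.
    elim/last_ind: (w) bL => [|w' l IHw]; first by rewrite cats0.
    by rewrite -rcons_cat => /Lpre; exact: IHw.
  rewrite [LHS]/= Psa Ph [LHS]inner_conj -Usa Ug// -inner_conj.
  exact: IH.
move=> w i j wL; rewrite !Vy Gw// inner_delta l2_deltaE eqxx hh// big1 ?addr0//.
Qed.

End LurkingIsometry.

(** * Interpolation on an admissible set of words *)

Section Interpolation.
Context {R : realType} {N : nat}.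

Lemma admissible_prefix (Lambda : set (word N)) (Ls : seq (word N)) :
  admissible Lambda -> Lambda = [set` Ls] ->
  forall w k, rcons w k \in Ls -> w \in Ls.
Proof.
move=> [_ adm] LE w k wk; have [//|wL] := boolP (w \in Ls).
have nw : ~ Lambda w by rewrite LE; apply/negP.
by have [_] := adm w nw k; rewrite LE /= wk => /(_ isT).
Qed.

Lemma admissible_nil (Lambda : set (word N)) (Ls : seq (word N)) :
  admissible Lambda -> Lambda = [set` Ls] -> Lambda !=set0 -> [::] \in Ls.
Proof.
move=> adm LE [w]; have pre := admissible_prefix adm LE; rewrite LE /=.
by elim/last_ind: w => // w k IH /pre.
Qed.

Lemma dense_inner_ext (Y : hilbertType R) (y : nat -> Y) (x x' : Y) :
  (forall z (e : R), 0 < e -> exists n, nrm (z - y n) < e) ->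
  (forall j, inner x (y j) = inner x' (y j)) -> x = x'.
Proof.
move=> yd xx'; apply/eqP; rewrite -subr_eq0; apply/eqP/nrm0_eq0/eqP.
rewrite -sqrf_eq0 -rinxx /rin (@orth_adh _ _ (range y) _ _ (x - x'))//.
  by move=> _ [j _ <-]; rewrite innerBl xx' subrr.
by move=> e /yd-/(_ (x - x'))[n yn]; exists (y n) => //; exists n.
Qed.

End Interpolation.

Theorem theorem4p3 (R : realType) (N : nat) (hN : (0 < N)%N)
    (Lambda : set (word N)) (Lambda_adm : admissible Lambda)
    (Lambda_neq0 : Lambda !=set0) (Y : hilbertType R)
    (c : word N -> operator Y Y) (c_nil : c [::] = idop Y) :
  (exists f : word N -> operator Y Y,
    [/\ herglotz_agler f,
        f [::] = 2^-1 *: c [::],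
        f [::] = 2^-1 *: idop Y &
        forall w, (Lambda `\ [::]) w -> f w = c w])
  <->
  (exists (H : hilbertType R) (G : 'I_N -> operator H H) (V : operator Y H),
    [/\ unitary_pencil G,
        isometryop V &
        forall w, Lambda w ->
          c w = compop (adjoint V) (compop (opword G w) V)]).
Proof.
split=> [[f [fA _ f_nil fc]]|[H [G [V [Gu VI cG]]]]]; last first.
  exists (herglotz_coef G V); split=> //.
  - exact: herglotz_coef_agler.
  - by rewrite c_nil.
  - by move=> [|k w] [Lw w0]; [case: w0|rewrite cG].
have [finL _] := Lambda_adm.
have [Ls0 L0E] : exists s : seq (word N), Lambda = [set` s] by apply/finite_seqP.
pose Ls := undup Ls0.
have LE : Lambda = [set` Ls].
  by rewrite L0E; apply/seteqP; split=> w /=; rewrite mem_undup.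
have Lnil := admissible_nil Lambda_adm LE Lambda_neq0.
have Lpre := admissible_prefix Lambda_adm LE.
(* N > 0 supplies the letter whose shift is iterated for positivity and the index whose projection
   receives the remaining part of the identity. *)
pose k0 := Ordinal hN.
have [y yd] := @separable_seq _ Y.
have [K Kpsd Kgap] := agler_decomposition y k0 fA (undup_uniq Ls0) Lnil Lpre.
have [G [V [Gu VI GV]]] := lurking_isometry k0 yd Lnil Lpre f_nil Kpsd Kgap.
exists (l2 (l2 (Cplx R))), G, V; split=> // w Lw.
have wL : w \in Ls by rewrite LE in Lw.
(* Both operators are compared through <c_w y_i, y_j> on the dense sequence. The kernel at (1, w) is
   this number alone for w nonempty, and the sum of two halves for w empty. *)
apply: (op_eq_dense (D := range y)).
  by apply/hdenseP => x e /yd-/(_ x)[n xn]; exists (y n) => //; exists n.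
move=> _ [i _ <-]; apply: (dense_inner_ext yd) => j.
rewrite [RHS]/= -adjointPr GV// /herglotz_kernel /herglotz_half /=.
have [w0|w0] := eqVneq w [::].
  rewrite w0 c_nil f_nil !scaleopE !innerZl /= rmorphM/= -inner_conj fmorphV
    rmorph_nat -mulrDl.
  by rewrite (_ : 2^-1 + 2^-1 = 1) ?mul1r//; field.
by rewrite conjC0 addr0 fc//; split=> //; exact/eqP.
Qed.
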